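(* Let $k$ be a field of characteristic $p>0$ and let $G$ be a finite unipotent commutative group scheme over $k$ of height $1$, i.e. annihilated by the relative Frobenius $G\to G^{(p)}$. Then $\operatorname{ed}_k G\ge n_V(G)$.
   Context: Essential dimension: let $G$ be an affine group scheme of finite type over a field $k$. For a field extension $K/k$, $\operatorname{H}^1(\operatorname{Spec} K,G)$ is the pointed set of isomorphism classes of fppf $G$-torsors over $\operatorname{Spec} K$. For a $G$-torsor $\xi$ over $\operatorname{Spec} K$, $\operatorname{ed}_k\xi$ is the smallest integer $n\ge 0$ such that there is an intermediate field $k\subseteq L\subseteq K$ with $\operatorname{tr\,deg}(L/k)=n$ and with $[\xi]$ in the image of $\operatorname{H}^1(\operatorname{Spec} L,G)\to \operatorname{H}^1(\operatorname{Spec} K,G)$. Then $\operatorname{ed}_k G$ is the supremum of $\operatorname{ed}_k\xi$ over all field extensions $K/k$ and all $G$-torsors $\xi$ over $\operatorname{Spec} K$. Verschiebung and $V$-order: for a commutative group scheme $G$ over a field $k$ of characteristic $p>0$, let $G^{(p)}$ be the base change of $G$ along the absolute Frobenius of $\operatorname{Spec} k$, and let $V:G^{(p)}\to G$ be the Verschiebung homomorphism (for finite $G$, the Cartier dual of the relative Frobenius $G^\vee\to (G^{\vee})^{(p)}$). Its $n$-th iterate is $V^n:G^{(p^n)}\to G$. For $G$ commutative unipotent, the $V$-order $n_V(G)$ is the smallest integer $n\ge 1$ such that $V^n=0$ on $G$.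
   Formalization: The group scheme G is assumed nontrivial: for trivial G every torsor is trivial, so ed_k G = 0, while n_V(G) = 1 under the convention n ≥ 1, and the inequality fails. *)

(* Defs.v *)
(* Schemes over a field k enter through their functors of points on commutative
   k-algebras.  An affine group scheme is a representable group-valued functor,
   and by Yoneda's lemma no tensor product of k-algebras is ever needed: base
   changes are restrictions of functors. *)
From HB Require Import structures.
From mathcomp Require Import all_boot all_order all_algebra.
From mathcomp Require Import boolp.
From mathcomp Require Import mpoly.

Set Implicit Arguments.
Unset Strict Implicit.
Unset Printing Implicit Defensive.

Import GRing.Theory.
Local Open Scope ring_scope.

(* The carrier is a comPzRingType, so that the zero algebra is included. *)
Record calg (k : fieldType) := CAlg {
  calg_ring :> comPzRingType;
  calg_str : {rmorphism k -> calg_ring} }.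

Record ahom (k : fieldType) (R S : calg k) := AHom {
  ahom_fun :> {rmorphism R -> S};
  ahomP : forall c : k, ahom_fun (calg_str R c) = calg_str S c }.

Lemma rmorph_ext (R S : pzSemiRingType) (f g : {rmorphism R -> S}) :
  f =1 g -> f = g.
Proof.
case: f g => [f cf] [g cg] /= /funext fg; subst g.
congr GRing.RMorphism.Pack.
case: cf cg => [[n1] [m1]] [[n2] [m2]].
by congr GRing.RMorphism.Class; congr (_ _); exact: Prop_irrelevance.
Qed.

Lemma ahom_ext (k : fieldType) (R S : calg k) (f g : ahom R S) :
  f =1 g -> f = g.
Proof.
case: f g => [f pf] [g pg] /= /rmorph_ext fg; subst g.
by congr AHom; exact: Prop_irrelevance.
Qed.

Definition ahom_id (k : fieldType) (R : calg k) : ahom R R :=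
  @AHom k R R idfun (fun=> erefl).

Lemma ahom_comp_subproof (k : fieldType) (R S T : calg k)
    (g : ahom S T) (f : ahom R S) (c : k) :
  (g \o f) (calg_str R c) = calg_str T c.
Proof. by rewrite /= !ahomP. Qed.

Definition ahom_comp (k : fieldType) (R S T : calg k)
    (g : ahom S T) (f : ahom R S) : ahom R T :=
  @AHom k R T (g \o f) (ahom_comp_subproof g f).

Definition module_finite (k : fieldType) (R : calg k) : Prop :=
  exists e : seq R, forall x : R, exists a : 'I_(size e) -> k,
    x = \sum_i calg_str R (a i) * e`_i.

Definition finitely_generated (k : fieldType) (R S : calg k) (s : ahom R S) :
    Prop :=
  exists e : seq S, forall P : S -> Prop,
    (forall a, P (s a)) -> (forall x, x \in e -> P x) ->
    (forall x y, P x -> P y -> P (x + y)) ->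
    (forall x y, P x -> P y -> P (x * y)) ->
    forall x, P x.

Record kfunctor (k : fieldType) := KFunctor {
  kf_obj :> calg k -> Type;
  kf_map : forall R S : calg k, ahom R S -> kf_obj R -> kf_obj S;
  kf_map_id : forall (R : calg k) (x : kf_obj R), kf_map (ahom_id R) x = x;
  kf_map_comp : forall (R S T : calg k) (g : ahom S T) (f : ahom R S)
      (x : kf_obj R),
    kf_map (ahom_comp g f) x = kf_map g (kf_map f x) }.

Arguments kf_map {k} X {R S} f x : rename.

(* H represents X: some u in X(H) is universal, i.e. X is isomorphic to
   Hom(H, -). *)
Definition represents (k : fieldType) (H : calg k) (X : kfunctor k) : Prop :=
  exists u : X H, forall (R : calg k) (x : X R),
    exists! h : ahom H R, kf_map X h u = x.

Record gfunctor (k : fieldType) := GFunctor {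
  gf_functor :> kfunctor k;
  gone : forall R, gf_functor R;
  gmul : forall R, gf_functor R -> gf_functor R -> gf_functor R;
  ginv : forall R, gf_functor R -> gf_functor R;
  gmulA : forall R (x y z : gf_functor R),
    gmul x (gmul y z) = gmul (gmul x y) z;
  gmul1 : forall R (x : gf_functor R), gmul (gone R) x = x;
  gmulV : forall R (x : gf_functor R), gmul (ginv x) x = gone R;
  gmul_map : forall R S (f : ahom R S) (x y : gf_functor R),
    kf_map gf_functor f (gmul x y)
      = gmul (kf_map gf_functor f x) (kf_map gf_functor f y) }.

Arguments gone {k} G R : rename.
Arguments gmul {k G R} x y : rename.
Arguments ginv {k G R} x : rename.

Definition commutative_gf (k : fieldType) (G : gfunctor k) : Prop :=
  forall R (x y : G R), gmul x y = gmul y x.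

Definition nontrivial_gf (k : fieldType) (G : gfunctor k) : Prop :=
  exists R, exists x : G R, x <> gone G R.

Definition finite_gf (k : fieldType) (G : gfunctor k) : Prop :=
  exists H : calg k, module_finite H /\ represents H G.

Record ghom (k : fieldType) (G H : gfunctor k) := GHom {
  ghom_fun :> forall R, G R -> H R;
  ghom_map : forall R S (f : ahom R S) (x : G R),
    ghom_fun (kf_map G f x) = kf_map H f (ghom_fun x);
  ghom_mul : forall R (x y : G R),
    ghom_fun (gmul x y) = gmul (ghom_fun x) (ghom_fun y) }.

Record lin_rep (k : fieldType) (G : gfunctor k) (n : nat) := LinRep {
  rep_fun :> forall R, G R -> 'M[R]_n;
  rep_map : forall R S (f : ahom R S) (x : G R),
    rep_fun (kf_map G f x) = map_mx f (rep_fun x);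
  rep_one : forall R, rep_fun (gone G R) = 1%:M;
  rep_mul : forall R (x y : G R),
    rep_fun (gmul x y) = rep_fun x *m rep_fun y }.

(* Every nonzero finite-dimensional linear representation has a nonzero fixed
   vector: this is the intrinsic definition, valid for any affine group scheme. *)
Definition unipotent (k : fieldType) (G : gfunctor k) : Prop :=
  forall (n : nat) (rho : lin_rep G n), (0 < n)%N ->
    exists v : 'cV[k]_n, v <> 0 /\
      forall R (x : G R),
        rho R x *m map_mx (calg_str R) v = map_mx (calg_str R) v.

(* The twist of R is the ring R on which k acts through
   c |-> c ^+ p; the base change of X along the absolute Frobenius of Spec k is
   R |-> X (twist R). *)

Section Frobenius.
Variables (k : fieldType) (p : nat) (chp : p \in [pchar k]).

Definition twist (R : calg k) : calg k :=
  @CAlg k R (calg_str R \o pFrobenius_aut chp).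

Definition twist_hom (R S : calg k) (f : ahom R S) : ahom (twist R) (twist S) :=
  @AHom k (twist R) (twist S) (ahom_fun f) (fun c => ahomP f _).

Definition frob (R : calg k) (x : R) : R := x ^+ p.

Fact frob_additive (R : calg k) : nmod_morphism (@frob R).
Proof.
have p_pr := pcharf_prime chp; have p_gt0 := prime_gt0 p_pr.
split=> [|x y]; first by rewrite /frob expr0n; case: (p) p_gt0.
have pR0 : p%:R = 0 :> R.
  by rewrite -(rmorph_nat (calg_str R)) (pcharf0 chp) rmorph0.
rewrite /frob exprDn -(prednK p_gt0) big_ord_recl big_ord_recr /= big1 ?add0r.
  by rewrite subnn subn0 bin0 binn !expr0 mulr1 mul1r !mulr1n.
move=> i _; rewrite /bump /= add1n -mulr_natr prednK //.
have /dvdnP[q ->] : (p %| 'C(p, i.+1))%N.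
  by apply: prime_dvd_bin => //=; have := ltn_ord i; rewrite -ltnS prednK.
by rewrite natrM pR0 !mulr0.
Qed.

Fact frob_multiplicative (R : calg k) : monoid_morphism (@frob R).
Proof. by split=> [|x y]; rewrite /frob ?expr1n ?exprMn. Qed.

HB.instance Definition _ (R : calg k) :=
  GRing.isNmodMorphism.Build R R (@frob R) (frob_additive R).
HB.instance Definition _ (R : calg k) :=
  GRing.isMonoidMorphism.Build R R (@frob R) (frob_multiplicative R).

Fact frob_str (R : calg k) (c : k) :
  frob (calg_str R c) = calg_str (twist R) c.
Proof. by rewrite /frob -rmorphXn. Qed.

Definition frob_hom (R : calg k) : ahom R (twist R) :=
  @AHom k R (twist R) (@frob R) (@frob_str R).

Fact twist_kfunctor_id (X : kfunctor k) (R : calg k) (x : X (twist R)) :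
  kf_map X (twist_hom (ahom_id R)) x = x.
Proof.
rewrite -[RHS](kf_map_id (x : X (twist R))).
by congr (kf_map X _ x); apply: ahom_ext.
Qed.

Fact twist_kfunctor_comp (X : kfunctor k) (R S T : calg k) (g : ahom S T)
    (f : ahom R S) (x : X (twist R)) :
  kf_map X (twist_hom (ahom_comp g f)) x
    = kf_map X (twist_hom g) (kf_map X (twist_hom f) x).
Proof. by rewrite -kf_map_comp; congr (kf_map X _ x); apply: ahom_ext. Qed.

Definition twist_kfunctor (X : kfunctor k) : kfunctor k :=
  @KFunctor k (fun R => X (twist R))
    (fun R S f => kf_map X (twist_hom f))
    (@twist_kfunctor_id X) (@twist_kfunctor_comp X).

Definition twist_gfunctor (G : gfunctor k) : gfunctor k :=
  @GFunctor k (twist_kfunctor G) (fun R => gone G (twist R))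
    (fun R => @gmul k G (twist R)) (fun R => @ginv k G (twist R))
    (fun R => @gmulA k G (twist R)) (fun R => @gmul1 k G (twist R))
    (fun R => @gmulV k G (twist R)) (fun R S f => gmul_map (twist_hom f)).

Definition rel_frob (X : kfunctor k) (R : calg k) (x : X R) :
    twist_kfunctor X R :=
  kf_map X (frob_hom R) x.

Definition height_one (G : gfunctor k) : Prop :=
  forall R (x : G R), rel_frob x = gone (twist_gfunctor G) R.

End Frobenius.

(* A point of the dual over R is a homomorphism G_R -> G_m; an
   R-algebra is a k-algebra S together with s : ahom R S.  Values are units
   because of char_one and char_mul. *)

Record character (k : fieldType) (G : gfunctor k) (R : calg k) := Character {
  char_fun :> forall S : calg k, ahom R S -> G S -> S;
  char_map : forall S T (s : ahom R S) (t : ahom S T) (x : G S),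
    char_fun (ahom_comp t s) (kf_map G t x) = t (char_fun s x);
  char_one : forall S (s : ahom R S), char_fun s (gone G S) = 1;
  char_mul : forall S (s : ahom R S) (x y : G S),
    char_fun s (gmul x y) = char_fun s x * char_fun s y }.

Lemma char_ext (k : fieldType) (G : gfunctor k) (R : calg k)
    (a b : character G R) :
  (forall S (s : ahom R S) x, a S s x = b S s x) -> a = b.
Proof.
case: a b => [a a1 a2 a3] [b b1 b2 b3] /= ab.
have E : a = b.
  apply: functional_extensionality_dep => S.
  by apply: functional_extensionality_dep => s; apply: funext => x; apply: ab.
by subst b; congr Character; exact: Prop_irrelevance.
Qed.

Section CartierDual.
Variables (k : fieldType) (G : gfunctor k).

Fact dual_map_subproof (R R' : calg k) (f : ahom R R') (chi : character G R)
    (S T : calg k) (s : ahom R' S) (t : ahom S T) (x : G S) :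
  chi T (ahom_comp (ahom_comp t s) f) (kf_map G t x)
    = t (chi S (ahom_comp s f) x).
Proof.
rewrite -char_map; congr (chi T _ _); exact: ahom_ext.
Qed.

Definition dual_map (R R' : calg k) (f : ahom R R') (chi : character G R) :
    character G R' :=
  @Character k G R' (fun S s => chi S (ahom_comp s f))
    (@dual_map_subproof R R' f chi)
    (fun S s => char_one chi (ahom_comp s f))
    (fun S s => char_mul chi (ahom_comp s f)).

Fact dual_map_id (R : calg k) (chi : character G R) :
  dual_map (ahom_id R) chi = chi.
Proof.
by apply: char_ext => S s x /=; congr (chi S _ x); apply: ahom_ext.
Qed.

Fact dual_map_comp (R S T : calg k) (g : ahom S T) (f : ahom R S)
    (chi : character G R) :
  dual_map (ahom_comp g f) chi = dual_map g (dual_map f chi).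
Proof.
by apply: char_ext => U s x /=; congr (chi U _ x); apply: ahom_ext.
Qed.

Definition cartier_dual : kfunctor k :=
  @KFunctor k (character G) dual_map dual_map_id dual_map_comp.

Definition pairing (R : calg k) (chi : cartier_dual R) (x : G R) : R :=
  chi R (ahom_id R) x.

End CartierDual.

(* Extended natural numbers: None is infinity. *)
Definition enat := option nat.

Definition enat_le (a b : enat) : Prop :=
  match a, b with
  | _, None => True
  | None, Some _ => False
  | Some m, Some n => (m <= n)%N
  end.

Fact asbool_ex (P : nat -> Prop) : (exists n, P n) -> exists n, `[< P n >].
Proof. by case=> n Pn; exists n; apply/asboolP. Qed.

Definition enat_min (P : nat -> Prop) : enat :=
  match pselect (exists n, P n) with
  | left exP => Some (ex_minn (asbool_ex exP))
  | right _ => None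
  end.

Definition enat_sup (E : enat -> Prop) : enat :=
  enat_min (fun n => forall e, E e -> enat_le e (Some n)).

Section Verschiebung.
Variables (k : fieldType) (p : nat) (chp : p \in [pchar k]).

(* V is the Cartier dual of the relative Frobenius F of the dual of G, i.e. its
   adjoint: <chi, V x> = <F chi, x>.  The pairing on the right is that of the
   Frobenius twists of G and of its dual; on R-points it is the pairing of G
   and its dual on (twist R)-points.  For finite commutative G such a V exists
   and is unique, by Cartier duality. *)
Definition is_verschiebung (G : gfunctor k) (V : ghom (twist_gfunctor chp G) G) :
    Prop :=
  forall (R : calg k) (chi : cartier_dual G R) (x : G (twist chp R)),
    pairing chi (V R x)
      = pairing (rel_frob chp chi : cartier_dual G (twist chp R)) x
          :> (R : Type).

Definition twistn (n : nat) (R : calg k) : calg k := iter n (twist chp) R.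

Fixpoint V_iter (G : gfunctor k) (V : ghom (twist_gfunctor chp G) G) (n : nat)
    (R : calg k) : G (twistn n R) -> G R :=
  match n with
  | 0 => fun x => x
  | m.+1 => fun x => V_iter V (V (twistn m R) x)
  end.

Definition V_order (G : gfunctor k) : enat :=
  enat_min (fun n => (1 <= n)%N /\
    exists V : ghom (twist_gfunctor chp G) G, is_verschiebung V /\
      forall R (x : G (twistn n R)), V_iter V x = gone G R).

End Verschiebung.

(* A k-functor X over Spec B with an action of G over Spec B (equivalently, of
   G_B): gs_pr sends a point of X to the point of Spec B below it. *)
Record gspace (k : fieldType) (G : gfunctor k) (B : calg k) := GSpace {
  gs_functor :> kfunctor k;
  gs_pr : forall R, gs_functor R -> ahom B R;
  gs_act : forall R, G R -> gs_functor R -> gs_functor R;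
  gs_pr_map : forall R S (f : ahom R S) (x : gs_functor R),
    gs_pr (kf_map gs_functor f x) = ahom_comp f (gs_pr x);
  gs_act_map : forall R S (f : ahom R S) (g : G R) (x : gs_functor R),
    kf_map gs_functor f (gs_act g x)
      = gs_act (kf_map G f g) (kf_map gs_functor f x);
  gs_pr_act : forall R (g : G R) (x : gs_functor R),
    gs_pr (gs_act g x) = gs_pr x;
  gs_act1 : forall R (x : gs_functor R), gs_act (gone G R) x = x;
  gs_actM : forall R (g h : G R) (x : gs_functor R),
    gs_act (gmul g h) x = gs_act g (gs_act h x) }.

Arguments gs_pr {k G B} X {R} x : rename.
Arguments gs_act {k G B} X {R} g x : rename.

(* fppf G-torsor over Spec B, for G affine over k and B a field extension of k:
   X is representable, G acts simply transitively on the fibres, and X has a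
   section over some fppf covering of Spec B (B being a field, over the spectrum
   of a nonzero finitely generated B-algebra). *)
Definition is_torsor (k : fieldType) (G : gfunctor k) (B : calg k)
    (X : gspace G B) : Prop :=
  [/\ exists A : calg k, represents A X,
      forall R (x y : X R), gs_pr X x = gs_pr X y ->
        exists! g : G R, gs_act X g x = y
    & exists (R : calg k) (x : X R),
        (1 : R) <> 0 /\ finitely_generated (gs_pr X x)].

Definition gspace_iso (k : fieldType) (G : gfunctor k) (B : calg k)
    (X Y : gspace G B) : Prop :=
  exists f : forall R, X R -> Y R,
    [/\ forall R, bijective (f R),
        forall R S (h : ahom R S) (x : X R),
          f S (kf_map X h x) = kf_map Y h (f R x),
        forall R (x : X R), gs_pr Y (f R x) = gs_pr X x
      & forall R (g : G R) (x : X R), f R (gs_act X g x) = gs_act Y g (f R x)].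

(* Base change along Spec B -> Spec A, for j : A -> B: the fibre product of X
   and Spec B over Spec A. *)
Section BaseChange.
Variables (k : fieldType) (G : gfunctor k) (A B : calg k) (j : ahom A B).
Variable X : gspace G A.

Record bc_point (R : calg k) := BCPoint {
  bc_fst : X R;
  bc_snd : ahom B R;
  bc_eq : gs_pr X bc_fst = ahom_comp bc_snd j }.

Lemma bc_ext (R : calg k) (x y : bc_point R) :
  bc_fst x = bc_fst y -> bc_snd x = bc_snd y -> x = y.
Proof.
case: x y => [x s e] [y t e'] /= xy st; subst y t.
by congr BCPoint; exact: Prop_irrelevance.
Qed.

Fact bc_map_subproof (R S : calg k) (f : ahom R S) (x : bc_point R) :
  gs_pr X (kf_map X f (bc_fst x)) = ahom_comp (ahom_comp f (bc_snd x)) j.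
Proof. by rewrite gs_pr_map bc_eq; apply: ahom_ext. Qed.

Definition bc_map (R S : calg k) (f : ahom R S) (x : bc_point R) : bc_point S :=
  BCPoint (bc_map_subproof f x).

Fact bc_map_id (R : calg k) (x : bc_point R) : bc_map (ahom_id R) x = x.
Proof. by apply: bc_ext; rewrite /= ?kf_map_id //; apply: ahom_ext. Qed.

Fact bc_map_comp (R S T : calg k) (g : ahom S T) (f : ahom R S)
    (x : bc_point R) :
  bc_map (ahom_comp g f) x = bc_map g (bc_map f x).
Proof. by apply: bc_ext; rewrite /= ?kf_map_comp //; apply: ahom_ext. Qed.

Definition bc_kfunctor : kfunctor k :=
  @KFunctor k bc_point bc_map bc_map_id bc_map_comp.

Fact bc_act_subproof (R : calg k) (g : G R) (x : bc_point R) :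
  gs_pr X (gs_act X g (bc_fst x)) = ahom_comp (bc_snd x) j.
Proof. by rewrite gs_pr_act bc_eq. Qed.

Definition bc_act (R : calg k) (g : G R) (x : bc_kfunctor R) : bc_kfunctor R :=
  BCPoint (bc_act_subproof g x).

Fact bc_act_map (R S : calg k) (f : ahom R S) (g : G R) (x : bc_kfunctor R) :
  kf_map bc_kfunctor f (bc_act g x)
    = bc_act (kf_map G f g) (kf_map bc_kfunctor f x).
Proof. by apply: bc_ext; rewrite /= ?gs_act_map. Qed.

Fact bc_act1 (R : calg k) (x : bc_kfunctor R) : bc_act (gone G R) x = x.
Proof. by apply: bc_ext; rewrite /= ?gs_act1. Qed.

Fact bc_actM (R : calg k) (g h : G R) (x : bc_kfunctor R) :
  bc_act (gmul g h) x = bc_act g (bc_act h x).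
Proof. by apply: bc_ext; rewrite /= ?gs_actM. Qed.

Definition base_change : gspace G B :=
  @GSpace k G B bc_kfunctor bc_snd bc_act (fun _ _ _ _ => erefl) bc_act_map
    (fun _ _ _ => erefl) bc_act1 bc_actM.

End BaseChange.

Section TrDeg.
Variables (k L : fieldType) (i : {rmorphism k -> L}).

Definition alg_independent (n : nat) (x : 'I_n -> L) : Prop :=
  forall P : {mpoly k[n]}, mmap i x P = 0 -> P = 0.

Definition in_adjoin (n : nat) (x : 'I_n -> L) (y : L) : Prop :=
  exists P Q : {mpoly k[n]}, mmap i x Q <> 0 /\ y = mmap i x P / mmap i x Q.

Definition algebraic_over_adjoin (n : nat) (x : 'I_n -> L) : Prop :=
  forall y : L, exists q : {poly L},
    [/\ q != 0, forall m : nat, in_adjoin x q`_m & root q y].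

Definition is_trdeg (n : nat) : Prop :=
  exists x : 'I_n -> L, alg_independent x /\ algebraic_over_adjoin x.

End TrDeg.

Section EssentialDimension.
Variables (k : fieldType) (G : gfunctor k).

(* Intermediate fields of K / k are given as k-homomorphisms of fields
   j : L -> K. *)
Definition ed_torsor (K : fieldType) (iK : {rmorphism k -> K})
    (X : gspace G (CAlg iK)) : enat :=
  enat_min (fun n =>
    exists (L : fieldType) (iL : {rmorphism k -> L})
      (j : ahom (CAlg iL) (CAlg iK)),
    is_trdeg iL n /\
    exists Y : gspace G (CAlg iL),
      is_torsor Y /\ gspace_iso (base_change j Y) X).

Definition ed : enat :=
  enat_sup (fun e =>
    exists (K : fieldType) (iK : {rmorphism k -> K}) (X : gspace G (CAlg iK)),
      is_torsor X /\ e = ed_torsor X).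

End EssentialDimension.

(* Main.v *)
(* G has order m = dim k[G].  Over the function field E of the regular
   representation, k(x_1, ..., x_m), the coaction of k[G] makes Spec E a G-torsor
   over the field K of invariants, with [E : K] = m.  If this torsor descends to
   Spec A over a subfield L of K, then A spans E over K, and A^p lies in L
   because G has height one.  Counting dimensions over k(t^p), for t a
   transcendence basis of L, bounds the number of elements of A that are linearly
   independent over K (which contains k E^p) by p^(trdeg L); hence
   m <= p^(trdeg L).
   On the other side, V is the adjoint of the p-th power map of the dual algebra
   D of k[G].  Unipotency makes the augmentation ideal J of D nil, so if
   n > 1 is minimal with x^(p^n) = 0 on J, some x in J has
   1, x, ..., x^(p^(n-1)) linearly independent, and p^(n-1) < dim D = m.
   As m > 1, this inequality also holds for n = 1.
   The two bounds give n <= trdeg L. *)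
Require Import Defs.
From HB Require Import structures.
From mathcomp Require Import all_boot all_order all_algebra.
From mathcomp Require Import boolp mpoly ring zify.
From mathcomp Require classical_sets.

Set Implicit Arguments.
Unset Strict Implicit.
Unset Printing Implicit Defensive.

Import GRing.Theory.
Local Open Scope ring_scope.

(** The field k may be imperfect, so the scalars of the count must contain k besides p-th powers;
    hence k(t^p). What replaces perfectness is that E is purely transcendental, hence separable,
    over k: elements independent over k have p-th powers independent over k. Take a basis e_1, ...,
    e_D over k(t) of the ring generated by finitely many elements of A. The e_l^p lie in K and stay
    independent over k(t^p), so for a in a K-free family of these elements of A the products a e_l^p
    are independent inside a space of dimension at most D p^(trdeg L) over k(t^p), and D cancels.
    That A^p lies in L is descent: the two maps from A to A (x)_L A are points of the torsor above
    one point of Spec L, so they differ by a point of G, which Frobenius kills; thus a^p (x) 1 = 1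
    (x) a^p. Height one also serves to construct the torsor: an element of E (x) k[G] is a unit as
    soon as its value at the identity of G is one, so the coaction extends from polynomials to
    fractions. *)

Lemma row_dependent (K : fieldType) (N m : nat) (A : 'M[K]_(N, m)) : (m < N)%N ->
  exists2 u : 'rV[K]_N, u != 0 & u *m A = 0.
Proof.
move=> mN; have /rowV0Pn[u /sub_kermxP uA u0] : kermx A != 0.
  by rewrite kermx_eq0 -row_leq_rank -ltnNge (leq_ltn_trans (rank_leq_col A)).
by exists u.
Qed.

(** * Commutative algebras given by structure constants *)

(** [sc i j l] is the coefficient of e_l in e_i e_j, and [sc1] gives the unit. Since only constants
    of k occur, extension of scalars to any [calg] R is the free module R^m, without tensor
    products. *)
Record scons (k : fieldType) (m : nat) := SCons {
  sc :> 'I_m -> 'I_m -> 'I_m -> k;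
  sc1 : 'I_m -> k;
  scC : forall i j l, sc i j l = sc j i l;
  scA : forall i j o n,
    \sum_l sc i j l * sc l o n = \sum_l sc j o l * sc i l n;
  sc1l : forall j l, \sum_i sc1 i * sc i j l = (j == l)%:R }.

(** The parameter [g] is a phantom: it lets k[G] and its dual, which have the same rank, carry
    different ring structures on the same type of functions. *)
Definition salg_type (k : fieldType) (m : nat) (R : calg k)
  (g : scons k m) : Type := {ffun 'I_m -> R}.

HB.instance Definition _ (k : fieldType) (m : nat) (R : calg k)
  (g : scons k m) := GRing.Zmodule.copy (salg_type R g) {ffun 'I_m -> R}.

Section StructureAlgebra.
Variables (k : fieldType) (m : nat) (R : calg k) (g : scons k m).
Local Notation T := (salg_type R g).
Local Notation st := (calg_str R).

Definition salg_mul (a b : T) : T :=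
  [ffun l => \sum_i \sum_j a i * b j * st (g i j l)].
Definition salg_one : T := [ffun l => st (sc1 g l)].

Fact salg_mulC : commutative salg_mul.
Proof.
move=> a b; apply/ffunP=> l; rewrite !ffunE exchange_big /=.
by apply: eq_bigr => i _; apply: eq_bigr => j _; rewrite scC [a j * _]mulrC.
Qed.

Fact salg_mulDl : left_distributive salg_mul +%R.
Proof.
move=> a b c; apply/ffunP=> l; rewrite !ffunE -big_split /=.
apply: eq_bigr => i _; rewrite -big_split /=.
by apply: eq_bigr => j _; rewrite ffunE !mulrDl.
Qed.

Fact salg_mul1 : left_id salg_one salg_mul.
Proof.
move=> a; apply/ffunP=> l; rewrite !ffunE exchange_big /=.
rewrite (bigD1 l) //= [X in _ + X]big1 ?addr0 => [|j jl]; last first.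
  under eq_bigr => i _ do rewrite ffunE mulrAC -rmorphM /=.
  by rewrite -mulr_suml -rmorph_sum sc1l (negPf jl) rmorph0 mul0r.
under eq_bigr => i _ do rewrite ffunE mulrAC -rmorphM /=.
by rewrite -mulr_suml -rmorph_sum sc1l eqxx rmorph1 mul1r.
Qed.

Fact salg_mulA : associative salg_mul.
Proof.
have E (a b c : T) n : salg_mul (salg_mul a b) c n =
    \sum_i \sum_j \sum_o a i * b j * c o * st (\sum_l g i j l * g l o n).
  rewrite ffunE; transitivity (\sum_l \sum_o \sum_i \sum_j
      a i * b j * st (g i j l) * c o * st (g l o n)).
    apply: eq_bigr => l _; apply: eq_bigr => o _.
    rewrite ffunE mulr_suml mulr_suml; apply: eq_bigr => i _.
    by rewrite mulr_suml mulr_suml.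
  rewrite exchange_big; under eq_bigr => o _ do rewrite exchange_big.
  rewrite exchange_big; apply: eq_bigr => i _.
  under eq_bigr => o _ do rewrite exchange_big.
  rewrite exchange_big; apply: eq_bigr => j _; apply: eq_bigr => o _.
  rewrite rmorph_sum mulr_sumr; apply: eq_bigr => l _.
  by rewrite rmorphM mulrA; congr (_ * _); rewrite mulrAC.
(* Commutativity turns a(bc) into (bc)a, so the expansion [E] serves for both bracketings. *)
move=> a b c; apply/ffunP=> n; rewrite salg_mulC !E.
under eq_bigr => j _ do rewrite exchange_big /=.
rewrite exchange_big; apply: eq_bigr => i _.
apply: eq_bigr => j _; apply: eq_bigr => o _.
rewrite scA [_ * a i]mulrC mulrA; congr (_ * st _).
by apply: eq_bigr => l _; rewrite [g l i n]scC.
Qed.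

HB.instance Definition _ := GRing.Zmodule_isComPzRing.Build (salg_type R g)
  salg_mulA salg_mulC salg_mul1 salg_mulDl.

Lemma salgM (a b : T) l :
  (a * b) l = \sum_i \sum_j a i * b j * st (g i j l).
Proof. by rewrite [LHS]ffunE. Qed.
Lemma salg1 l : (1 : T) l = st (sc1 g l). Proof. by rewrite [LHS]ffunE. Qed.
Lemma salgD (a b : T) l : (a + b) l = a l + b l. Proof. by rewrite [LHS]ffunE. Qed.
Lemma salg0 l : (0 : T) l = 0. Proof. by rewrite [LHS]ffunE. Qed.
Definition salg_in_fun (r : R) : T := [ffun l => r * st (sc1 g l)].

Lemma salg_inM r (a : T) l : (salg_in_fun r * a) l = r * a l.
Proof.
rewrite -[in RHS](mul1r a) !salgM mulr_sumr; apply: eq_bigr => i _.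
rewrite mulr_sumr; apply: eq_bigr => j _.
by rewrite salg1 ffunE !mulrA.
Qed.

Fact salg_in_additive : nmod_morphism salg_in_fun.
Proof.
by split=> [|x y]; apply/ffunP=> l; rewrite !ffunE /= ?mul0r ?mulrDl.
Qed.
Fact salg_in_multiplicative : monoid_morphism salg_in_fun.
Proof.
split=> [|x y]; apply/ffunP=> l; rewrite ?salg_inM ffunE ?salg1 ?mul1r //.
by rewrite ffunE mulrA.
Qed.
HB.instance Definition _ :=
  GRing.isNmodMorphism.Build R T salg_in_fun salg_in_additive.
HB.instance Definition _ :=
  GRing.isMonoidMorphism.Build R T salg_in_fun salg_in_multiplicative.

Definition salg : calg k := @CAlg k T (salg_in_fun \o st).
Definition salg_in : ahom R salg := @AHom k R salg salg_in_fun (fun=> erefl).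

Definition sco (a : salg) (l : 'I_m) : R := (a : T) l.
Definition smk (f : 'I_m -> R) : salg := locked ([ffun l => f l] : T).

Lemma sco_ext (a b : salg) : sco a =1 sco b -> a = b.
Proof. by move=> ab; apply/ffunP. Qed.
Lemma scoK f : sco (smk f) =1 f.
Proof. by move=> l; rewrite /smk -lock [LHS]ffunE. Qed.
Lemma sco0 l : sco 0 l = 0. Proof. exact: salg0. Qed.
Lemma scoD a b l : sco (a + b) l = sco a l + sco b l.
Proof. exact: salgD. Qed.
Lemma sco_sum (I : Type) (r : seq I) (P : pred I) (F : I -> salg) l :
  sco (\sum_(i <- r | P i) F i) l = \sum_(i <- r | P i) sco (F i) l.
Proof. by elim/big_rec2: _ => [|i y1 y2 _ <-]; rewrite ?sco0 ?scoD. Qed.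
Lemma scoM a b l :
  sco (a * b) l = \sum_i \sum_j sco a i * sco b j * st (g i j l).
Proof. exact: salgM. Qed.
Lemma sco1 l : sco 1 l = st (sc1 g l). Proof. exact: salg1. Qed.
Lemma sco_in r l : sco (salg_in r) l = r * st (sc1 g l).
Proof. by rewrite [LHS]ffunE. Qed.
Lemma sco_inM r a l : sco (salg_in r * a) l = r * sco a l.
Proof. exact: salg_inM. Qed.
Lemma sco_in_funM r a l : sco (salg_in_fun r * a) l = r * sco a l.
Proof. exact: salg_inM. Qed.
Lemma sco_str c l : sco (calg_str salg c) l = st (c * sc1 g l).
Proof. by rewrite [LHS]ffunE rmorphM. Qed.
Lemma sco_strM c a l : sco (calg_str salg c * a) l = st c * sco a l.
Proof. exact: salg_inM. Qed.

Definition salg_bas (i : 'I_m) : salg := smk (fun l => (l == i)%:R).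

Lemma sco_bas i l : sco (salg_bas i) l = (l == i)%:R.
Proof. exact: scoK. Qed.

Lemma salg_decomp (a : salg) : a = \sum_i salg_in (sco a i) * salg_bas i.
Proof.
apply: sco_ext => l; rewrite sco_sum (bigD1 l) //= big1 ?addr0 => [|i il].
  by rewrite sco_inM sco_bas eqxx mulr1.
by rewrite sco_inM sco_bas eq_sym (negPf il) mulr0.
Qed.

Lemma salg_basM i j : salg_bas i * salg_bas j =
  \sum_l salg_in (st (g i j l)) * salg_bas l.
Proof.
rewrite [LHS]salg_decomp; apply: eq_bigr => l _; congr (salg_in _ * _).
rewrite scoM (bigD1 i) //= [X in _ + X]big1 ?addr0 => [|i' ii].
  rewrite (bigD1 j) //= big1 ?addr0 => [|j' jj].
    by rewrite !sco_bas !eqxx !mul1r.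
  by rewrite !sco_bas (negPf jj) mulr0 mul0r.
by apply: big1 => j' _; rewrite !sco_bas (negPf ii) !mul0r.
Qed.

Lemma salg_bas1 : \sum_l salg_in (st (sc1 g l)) * salg_bas l = 1.
Proof. by rewrite [RHS]salg_decomp; apply: eq_bigr => l _; rewrite sco1. Qed.

End StructureAlgebra.

Arguments salg_in {k m} R g.
Arguments salg_bas {k m} R g i.
Arguments smk {k m} R g f.

(** These are the equations satisfied by the images of the basis under an algebra homomorphism to S:
    [w] is an S-point of the spectrum of the algebra. *)
Definition sc_point (k : fieldType) (m : nat) (g : scons k m) (S : calg k)
    (w : 'I_m -> S) : Prop :=
  (forall i j, w i * w j = \sum_l calg_str S (g i j l) * w l) /\
  \sum_l calg_str S (sc1 g l) * w l = 1.

Section StructureAlgebraLift.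
Variables (k : fieldType) (m : nat) (g : scons k m) (R S : calg k).
Variables (s : ahom R S) (w : 'I_m -> S) (wP : sc_point g w).

(** Universal property of extension of scalars: a map on R and a point over S determine a map on the
    algebra with coefficients in R. *)
Definition salg_lift_fun (a : salg R g) : S := \sum_l s (sco a l) * w l.

Fact salg_lift_additive : nmod_morphism salg_lift_fun.
Proof.
split=> [|x y]; rewrite /salg_lift_fun.
  by apply: big1 => l _; rewrite sco0 rmorph0 mul0r.
by rewrite -big_split; apply: eq_bigr => l _; rewrite scoD rmorphD mulrDl.
Qed.
Fact salg_lift_multiplicative : monoid_morphism salg_lift_fun.
Proof.
case: wP => wM w1; split=> [|x y]; rewrite /salg_lift_fun.
  by rewrite -[RHS]w1; apply: eq_bigr => l _; rewrite sco1 ahomP.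
rewrite mulr_suml; under [RHS]eq_bigr => i _ do rewrite mulr_sumr.
transitivity (\sum_l \sum_i \sum_j s (sco x i) * s (sco y j) * (calg_str S (g i j l) * w l)).
  apply: eq_bigr => l _; rewrite scoM rmorph_sum mulr_suml.
  apply: eq_bigr => i _; rewrite rmorph_sum mulr_suml.
  by apply: eq_bigr => j _; rewrite !rmorphM /= ahomP !mulrA.
rewrite exchange_big; apply: eq_bigr => i _; rewrite exchange_big.
by apply: eq_bigr => j _; rewrite mulrACA wM mulr_sumr.
Qed.
HB.instance Definition _ := GRing.isNmodMorphism.Build (salg R g) S
  salg_lift_fun salg_lift_additive.
HB.instance Definition _ := GRing.isMonoidMorphism.Build (salg R g) S
  salg_lift_fun salg_lift_multiplicative.

Lemma salg_lift_in (r : R) : salg_lift_fun (salg_in R g r) = s r.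
Proof.
case: wP => wM w1; rewrite /salg_lift_fun -[RHS]mulr1 -w1 mulr_sumr.
by apply: eq_bigr => l _; rewrite sco_in rmorphM /= ahomP mulrA.
Qed.

Fact salg_lift_str c : salg_lift_fun (calg_str (salg R g) c) = calg_str S c.
Proof. by rewrite -(ahomP (salg_in R g)) salg_lift_in ahomP. Qed.

Definition salg_lift : ahom (salg R g) S :=
  @AHom k (salg R g) S salg_lift_fun salg_lift_str.

Lemma salg_liftE (a : salg R g) : salg_lift a = \sum_l s (sco a l) * w l.
Proof. by []. Qed.

Lemma salg_lift_bas i : salg_lift (salg_bas R g i) = w i.
Proof.
rewrite salg_liftE (bigD1 i) //= big1 ?addr0 => [|l li]; rewrite sco_bas.
  by rewrite eqxx rmorph1 mul1r.
by rewrite (negPf li) rmorph0 mul0r.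
Qed.

End StructureAlgebraLift.

Lemma salg_bas_point (k : fieldType) (m : nat) (g : scons k m) (R : calg k) :
  sc_point g (salg_bas R g).
Proof.
split=> [i j|].
  by rewrite salg_basM; apply: eq_bigr => l _; rewrite ahomP.
by rewrite -[RHS](salg_bas1 R g); apply: eq_bigr => l _; rewrite ahomP.
Qed.

(* G is presented by structure constants of its coordinate ring in a basis: a
   point is the family of its values on the basis. *)
Record coords (k : fieldType) (G : gfunctor k) := Coords {
  cdim : nat;
  cmul : scons k cdim;
  vec : forall R : calg k, G R -> 'I_cdim -> R;
  vec_map : forall (R S : calg k) (f : ahom R S) (x : G R) l,
    vec (kf_map G f x) l = f (vec x l);
  vec_inj : forall (R : calg k) (x y : G R), vec x =1 vec y -> x = y;
  vecP : forall (R : calg k) (x : G R), sc_point cmul (vec x);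
  vec_surj : forall (R : calg k) (w : 'I_cdim -> R),
    sc_point cmul w -> exists x : G R, vec x =1 w }.

(** * Existence of coordinates on a finite group functor *)

(** A generating family of least size is a basis: solving a nontrivial relation for one generator
    would give a smaller family. *)
Lemma module_finite_basis (k : fieldType) (H : calg k) : module_finite H ->
  exists (m : nat) (e : 'I_m -> H) (co : H -> 'I_m -> k),
    (forall x, x = \sum_i calg_str H (co x i) * e i) /\
    (forall a : 'I_m -> k, co (\sum_i calg_str H (a i) * e i) =1 a).
Proof.
case=> e0 e0P.
pose gen m := `[< exists e : 'I_m -> H, forall x : H, exists a : 'I_m -> k,
  x = \sum_i calg_str H (a i) * e i >].
have ex_gen : exists m, gen m.
  by exists (size e0); apply/asboolP; exists (fun i => e0`_i).
case: (ex_minnP ex_gen) => m /asboolP[e /choice[co coP]] m_min.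
have free (a : 'I_m -> k) : \sum_i calg_str H (a i) * e i = 0 -> a =1 fun=> 0.
  case: m e co coP m_min a => [|m] e co coP m_min a a0 i; first by case: i.
  apply/eqP; apply: contraT => ai0.
  suff: (m.+1 <= m)%N by rewrite ltnn.
  apply: m_min; apply/asboolP; exists (fun j => e (lift i j)) => x.
  exists (fun j => co x (lift i j) - co x i / a i * a (lift i j)).
  have ei : e i = - \sum_j calg_str H (a (lift i j) / a i) * e (lift i j).
    apply/eqP; rewrite -addr_eq0; apply/eqP.
    have := congr1 ( *%R (calg_str H (a i)^-1)) a0.
    rewrite mulr0 (bigD1_ord i) //= mulrDr mulrA -rmorphM mulVf // rmorph1 mul1r.
    move=> a0'; rewrite -[RHS]a0'; congr (_ + _); rewrite mulr_sumr; apply: eq_bigr => j _.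
    by rewrite [RHS]mulrA -rmorphM [_^-1 * _]mulrC.
  rewrite {1}[x](coP x) (bigD1_ord i) //= ei mulrN mulr_sumr -sumrN -big_split.
  apply: eq_bigr => j _ /=; rewrite mulrA -rmorphM -mulNr -mulrDl addrC.
  rewrite -rmorphN -rmorphD /=; congr (calg_str H (_ - _) * _).
  by rewrite mulrCA mulrC mulrAC.
exists m, e, co; split=> [//|a i]; apply/eqP; rewrite -subr_eq0; apply/eqP.
apply: (free (fun i => _ - a i)).
under eq_bigr => j _ do rewrite rmorphB mulrBl.
by rewrite sumrB -coP subrr.
Qed.

(** By Yoneda a point of G(R) is a homomorphism from the representing algebra H to R; its
    coordinates are its values on a basis of H. *)
Lemma finite_coords (k : fieldType) (G : gfunctor k) :
  finite_gf G -> exists C : coords G, True.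
Proof.
case=> H [/module_finite_basis[m [e [co [coP coK]]]]] [u uP].
have coE (x : H) (a : 'I_m -> k) :
    x = \sum_i calg_str H (a i) * e i -> co x =1 a by move=> ->; apply: coK.
pose sumE (w : 'I_m -> k) := \sum_i calg_str H (w i) * e i.
have co_sum (I : finType) (F : I -> k) (y : I -> H) :
    co (\sum_i calg_str H (F i) * y i) =1 fun l => \sum_i F i * co (y i) l.
  apply: coE; under [RHS]eq_bigr => l _ do rewrite rmorph_sum mulr_suml.
  rewrite exchange_big; apply: eq_bigr => i _; rewrite [in LHS](coP (y i)).
  by rewrite mulr_sumr; apply: eq_bigr => l _; rewrite rmorphM mulrA.
have co_e i : co (e i) =1 fun l => (i == l)%:R.
  apply: coE; rewrite (bigD1 i) //= big1 ?addr0 => [|l li].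
    by rewrite eqxx rmorph1 mul1r.
  by rewrite eq_sym (negPf li) rmorph0 mul0r.
have muC i j l : co (e i * e j) l = co (e j * e i) l by rewrite mulrC.
have muA i j o n : \sum_l co (e i * e j) l * co (e l * e o) n =
    \sum_l co (e j * e o) l * co (e i * e l) n.
  rewrite -!co_sum; congr co.
  under eq_bigr => l _ do rewrite mulrA.
  under [RHS]eq_bigr => l _ do rewrite mulrCA.
  by rewrite -mulr_suml -mulr_sumr -!coP mulrA.
have mu1 j l : \sum_i co 1 i * co (e i * e j) l = (j == l)%:R.
  rewrite -co_sum; under eq_bigr => i _ do rewrite mulrA.
  by rewrite -mulr_suml -coP mul1r co_e.
pose mu := SCons muC muA mu1.
pose hm R (x : G R) : ahom H R := projT1 (cid (uP R x)).
have hmP R (x : G R) : kf_map G (hm R x) u = x.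
  by rewrite /hm; case: cid => h [].
have hmK R (f : ahom H R) : hm R (kf_map G f u) = f.
  by rewrite /hm; case: cid => h [/= hu]; apply.
have hmE R (h : ahom H R) x : h x = \sum_i calg_str R (co x i) * h (e i).
  rewrite [in LHS](coP x) rmorph_sum; apply: eq_bigr => i _.
  by rewrite rmorphM /= ahomP.
unshelve eexists (@Coords k G m mu (fun R x l => hm R x (e l)) _ _ _ _) => //.
- move=> R S f x l /=; rewrite -{1}[x]hmP -kf_map_comp hmK //.
- move=> R x y xy; rewrite -[x]hmP -[y]hmP; congr kf_map.
  by apply: ahom_ext => h; rewrite hmE [RHS]hmE; apply: eq_bigr => i _; rewrite xy.
- move=> R x; split=> [i j|] /=; first by rewrite -rmorphM hmE.
  by rewrite -hmE rmorph1.
(* Conversely, a solution of the equations extends k-linearly to a homomorphism [h0] from H to R. *)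
move=> R w [wM w1].
pose h0 (x : H) := \sum_i calg_str R (co x i) * w i.
have h0_in (a : 'I_m -> k) : h0 (sumE a) = \sum_i calg_str R (a i) * w i.
  by apply: eq_bigr => i _; rewrite coK.
have h0D : nmod_morphism h0.
  split=> [|x y].
    have {1}-> : 0 = sumE (fun=> 0).
      by rewrite [RHS]big1 // => i _; rewrite rmorph0 mul0r.
    by rewrite h0_in big1 // => i _; rewrite rmorph0 mul0r.
  have {1}-> : x + y = sumE (fun i => co x i + co y i).
    rewrite {1}[x]coP {1}[y]coP -big_split; apply: eq_bigr => i _.
    by rewrite rmorphD mulrDl.
  rewrite h0_in -big_split; apply: eq_bigr => i _.
  by rewrite rmorphD mulrDl.
have h0M : monoid_morphism h0.
  split=> [//|x y].
  have {1}-> : x * y = sumE (fun l => \sum_i \sum_j co x i * co y j * mu i j l).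
    rewrite {1}[x]coP {1}[y]coP mulr_suml.
    under eq_bigr => i _ do rewrite mulr_sumr.
    transitivity (\sum_i \sum_j \sum_l
        calg_str H (co x i * co y j * mu i j l) * e l).
      apply: eq_bigr => i _; apply: eq_bigr => j _.
      rewrite mulrACA -rmorphM [e i * e j]coP mulr_sumr.
      by apply: eq_bigr => l _; rewrite mulrA -rmorphM.
    under eq_bigr => i _ do rewrite exchange_big.
    rewrite exchange_big; apply: eq_bigr => l _.
    rewrite rmorph_sum mulr_suml; apply: eq_bigr => i _.
    by rewrite rmorph_sum mulr_suml.
  rewrite h0_in mulr_suml; under [RHS]eq_bigr => i _ do rewrite mulr_sumr.
  transitivity (\sum_i \sum_j \sum_l
      calg_str R (co x i * co y j * mu i j l) * w l); last first.
    apply: eq_bigr => i _; apply: eq_bigr => j _.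
    rewrite mulrACA -rmorphM wM mulr_sumr.
    by apply: eq_bigr => l _; rewrite mulrA -rmorphM.
  under [RHS]eq_bigr => i _ do rewrite exchange_big.
  rewrite [RHS]exchange_big; apply: eq_bigr => l _.
  rewrite rmorph_sum mulr_suml; apply: eq_bigr => i _.
  by rewrite rmorph_sum mulr_suml.
pose Aa := GRing.isNmodMorphism.Build H R h0 h0D.
pose Am := GRing.isMonoidMorphism.Build H R h0 h0M.
pose h1 : {rmorphism H -> R} := HB.pack h0 Aa Am.
have h1P c : h1 (calg_str H c) = calg_str R c.
  rewrite -[calg_str H c]mulr1 [1]coP mulr_sumr /=.
  under eq_bigr => i _ do rewrite mulrA -rmorphM.
  rewrite [LHS]h0_in; under eq_bigr => i _ do rewrite rmorphM -mulrA.
  by rewrite -mulr_sumr w1 mulr1.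
exists (kf_map G (AHom h1P) u) => l; rewrite hmK /= /h0.
rewrite (bigD1 l) //= big1 ?addr0 => [|i il]; rewrite co_e.
  by rewrite eqxx rmorph1 mul1r.
by rewrite eq_sym (negPf il) rmorph0 mul0r.
Qed.

(** * Comultiplication, counit and the Cartier dual algebra *)

Definition base_calg (k : fieldType) : calg k := @CAlg k k idfun.
Definition calg_ini (k : fieldType) (R : calg k) : ahom (base_calg k) R :=
  @AHom k (base_calg k) R (calg_str R) (fun=> erefl).

(** The axioms of [gfunctor] state multiplicativity of the transition maps; the image of 1 is
    idempotent, hence 1. *)
Lemma gone_map (k : fieldType) (G : gfunctor k) (R S : calg k) (f : ahom R S) :
  kf_map G f (gone G R) = gone G S.
Proof.
set a := kf_map G f _.
have aa : gmul a a = a by rewrite /a -gmul_map gmul1.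
by rewrite -[a]gmul1 -(gmulV a) -gmulA aa.
Qed.

Section Comultiplication.
Variables (k : fieldType) (G : gfunctor k) (C : coords G).
Local Notation m := (cdim C).
Local Notation mu := (cmul C).
Local Notation vec := (@vec k G C _).
Local Notation kk := (base_calg k).

Definition point_of (R : calg k) (w : 'I_m -> R) (wP : sc_point mu w) : G R :=
  projT1 (cid (vec_surj wP)).
Lemma vec_point_of (R : calg k) (w : 'I_m -> R) (wP : sc_point mu w) :
  vec (point_of wP) =1 w.
Proof. by rewrite /point_of; case: cid. Qed.

(** The tautological point over R (x) k[G]: every point x over an R-algebra is its image under the
    map [clift] defined by x. *)
Definition upt (R : calg k) : G (salg R mu) := point_of (salg_bas_point mu R).
Lemma vec_upt (R : calg k) i : vec (upt R) i = salg_bas R mu i.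
Proof. exact: vec_point_of. Qed.

Definition clift (R S : calg k) (s : ahom R S) (x : G S) : ahom (salg R mu) S :=
  salg_lift s (vecP C x).

Lemma clift_upt (R S : calg k) (s : ahom R S) (x : G S) :
  kf_map G (clift s x) (upt R) = x.
Proof.
by apply: (@vec_inj _ _ C) => l; rewrite vec_map vec_upt /clift salg_lift_bas.
Qed.

Lemma clift_in (R S : calg k) (s : ahom R S) (x : G S) (r : R) :
  clift s x (salg_in R mu r) = s r.
Proof. exact: (salg_lift_in s (vecP C x)). Qed.

Lemma cliftE (R S : calg k) (s : ahom R S) (x : G S) (a : salg R mu) :
  clift s x a = \sum_l s (sco a l) * vec x l.
Proof. by []. Qed.

Lemma clift_in_map (X : kfunctor k) (R S : calg k) (s : ahom R S) (x : G S)
    (y : X R) :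
  kf_map X (clift s x) (kf_map X (salg_in R mu) y) = kf_map X s y.
Proof.
by rewrite -kf_map_comp; congr (kf_map X _ y); apply: ahom_ext => r; apply: clift_in.
Qed.

(** At the universal point the coordinates are a basis of R (x) k[G] over R, so equality at that
    single point compares coefficients. *)
Lemma coords_free (R : calg k) (a b : 'I_m -> R) :
  (forall (S : calg k) (s : ahom R S) (x : G S),
    \sum_l s (a l) * vec x l = \sum_l s (b l) * vec x l) -> a =1 b.
Proof.
move=> /(_ _ (salg_in R mu) (upt R)) ab i.
have E (d : 'I_m -> R) : d i = sco (\sum_l salg_in R mu (d l) * vec (upt R) l) i.
  rewrite -[LHS](scoK mu d) {1}[smk _ _ _]salg_decomp; congr (sco _ _).
  by apply: eq_bigr => l _; rewrite scoK vec_upt.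
by rewrite [LHS]E [RHS]E ab.
Qed.

(** [coords_free] is applied twice: in x over R, then in y over the algebra on which x is
    defined. *)
Lemma coords_free2 (R : calg k) (a b : 'I_m -> 'I_m -> R) :
  (forall (S : calg k) (s : ahom R S) (x y : G S),
    \sum_j \sum_l s (a j l) * vec x j * vec y l =
    \sum_j \sum_l s (b j l) * vec x j * vec y l) ->
  forall j l, a j l = b j l.
Proof.
move=> ab j l; apply: (@coords_free R (a^~ l) (b^~ l)) => S s x {j}.
apply: (@coords_free S (fun l => \sum_j s (a j l) * vec x j)
  (fun l => \sum_j s (b j l) * vec x j)) => T t y.
have E (d : 'I_m -> 'I_m -> R) :
  \sum_l0 t (\sum_j s (d j l0) * vec x j) * vec y l0 =
  \sum_j \sum_l0 ahom_comp t s (d j l0) * vec (kf_map G t x) j * vec y l0.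
  rewrite exchange_big; apply: eq_bigr => j _; rewrite rmorph_sum mulr_suml.
  by apply: eq_bigr => i _; rewrite rmorphM vec_map.
by rewrite [LHS]E [RHS]E.
Qed.

Lemma coords_free2k (a b : 'I_m -> 'I_m -> k) :
  (forall (R : calg k) (x y : G R),
    \sum_j \sum_l calg_str R (a j l) * vec x j * vec y l =
    \sum_j \sum_l calg_str R (b j l) * vec x j * vec y l) ->
  forall j l, a j l = b j l.
Proof.
move=> ab; apply: (@coords_free2 kk) => R s x y.
have sE c : s c = calg_str R c by rewrite -(ahomP s).
by under eq_bigr => j _ do under eq_bigr => l _ do rewrite sE;
   under [RHS]eq_bigr => j _ do under eq_bigr => l _ do rewrite sE.
Qed.

Lemma coords_free3 (a b : 'I_m -> 'I_m -> 'I_m -> k) :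
  (forall (R : calg k) (x y z : G R),
    \sum_i \sum_j \sum_l calg_str R (a i j l) * vec x i * vec y j * vec z l =
    \sum_i \sum_j \sum_l calg_str R (b i j l) * vec x i * vec y j * vec z l) ->
  forall i j l, a i j l = b i j l.
Proof.
move=> ab i j l.
apply: (@coords_free2k (fun i j => a i j l) (fun i j => b i j l)) => R x y {i j}.
apply: (@coords_free R
  (fun l => \sum_i \sum_j calg_str R (a i j l) * vec x i * vec y j)
  (fun l => \sum_i \sum_j calg_str R (b i j l) * vec x i * vec y j)) => S t z.
have E (d : 'I_m -> 'I_m -> 'I_m -> k) :
  \sum_l0 t (\sum_i \sum_j calg_str R (d i j l0) * vec x i * vec y j) * vec z l0 =
  \sum_i \sum_j \sum_l0 calg_str S (d i j l0) * vec (kf_map G t x) i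
    * vec (kf_map G t y) j * vec z l0.
  under eq_bigr => l0 _ do rewrite rmorph_sum mulr_suml.
  rewrite exchange_big; apply: eq_bigr => i _.
  under eq_bigr => l0 _ do rewrite rmorph_sum mulr_suml.
  rewrite exchange_big; apply: eq_bigr => j _; apply: eq_bigr => l0 _.
  by rewrite !rmorphM /= ahomP !vec_map.
by rewrite [LHS]E [RHS]E.
Qed.

(* [comul i j l] is the coefficient of e_j (x) e_l in the coproduct of e_i; it is
   read off the product of the two universal points. *)
Definition comul (i j l : 'I_m) : k :=
  sco (sco (vec (gmul (kf_map G (salg_in (salg kk mu) mu) (upt kk))
    (upt (salg kk mu))) i) l) j.
Definition counit (i : 'I_m) : k := vec (gone G kk) i.

(** Every pair of points is the image of the pair of universal points over k[G] (x) k[G], where the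
    formula holds by the choice of [comul]. *)
Lemma vecM (R : calg k) (x y : G R) i :
  vec (gmul x y) i = \sum_j \sum_l calg_str R (comul i j l) * vec x j * vec y l.
Proof.
pose f := clift (clift (calg_ini R) x) y.
have -> : gmul x y = kf_map G f
    (gmul (kf_map G (salg_in (salg kk mu) mu) (upt kk)) (upt (salg kk mu))).
  by rewrite gmul_map clift_in_map !clift_upt.
rewrite vec_map cliftE exchange_big; apply: eq_bigr => l _.
by rewrite cliftE mulr_suml.
Qed.

Lemma vec1 (R : calg k) i : vec (gone G R) i = calg_str R (counit i).
Proof. by rewrite -(gone_map _ (calg_ini R)) vec_map. Qed.

Lemma counitl i j : \sum_l comul i l j * counit l = (i == j)%:R.
Proof.
apply: (@coords_free kk (fun j => \sum_l comul i l j * counit l)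
  (fun j => (i == j)%:R)) => R s x.
have sE c : s c = calg_str R c by rewrite -(ahomP s).
transitivity (vec (gmul (gone G R) x) i).
  rewrite vecM exchange_big; apply: eq_bigr => l _; rewrite sE rmorph_sum mulr_suml.
  by apply: eq_bigr => j' _; rewrite vec1 -rmorphM.
rewrite gmul1 (bigD1 i) //= big1 ?addr0 => [|l li].
  by rewrite sE eqxx rmorph1 mul1r.
by rewrite sE eq_sym (negPf li) rmorph0 mul0r.
Qed.

Hypothesis commG : commutative_gf G.

Lemma comulC i j l : comul i j l = comul i l j.
Proof.
apply: (@coords_free2k (comul i) (fun j l => comul i l j)) => R x y.
rewrite -vecM commG vecM exchange_big.
by apply: eq_bigr => a _; apply: eq_bigr => b _; rewrite mulrAC.
Qed.

Lemma comulA i j o n :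
  \sum_l comul l i j * comul n l o = \sum_l comul l j o * comul n i l.
Proof.
apply: (@coords_free3 (fun i j o => \sum_l comul l i j * comul n l o)
  (fun i j o => \sum_l comul l j o * comul n i l)) => R x y z {i j o}.
have -> : \sum_i \sum_j \sum_o
    calg_str R (\sum_l comul l i j * comul n l o) * vec x i * vec y j * vec z o
    = vec (gmul (gmul x y) z) n.
  rewrite vecM [RHS]exchange_big.
  under [RHS]eq_bigr => o _.
    under eq_bigr => l _.
      rewrite vecM mulr_sumr mulr_suml.
      under eq_bigr => i _ do rewrite mulr_sumr mulr_suml.
      over.
    rewrite exchange_big; under eq_bigr => i _ do rewrite exchange_big.
    over.
  rewrite [RHS]exchange_big; apply: eq_bigr => i _.
  rewrite [RHS]exchange_big; apply: eq_bigr => j _; apply: eq_bigr => o _.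
  rewrite rmorph_sum !mulr_suml; apply: eq_bigr => l _.
  by rewrite rmorphM /= !mulrA;  do 3!congr (_ * _); rewrite mulrC.
symmetry; rewrite -gmulA vecM; apply: eq_bigr => i _.
under [RHS]eq_bigr => l _.
  rewrite vecM mulr_sumr.
  under eq_bigr => j _ do rewrite mulr_sumr.
  over.
rewrite [RHS]exchange_big; apply: eq_bigr => j _.
rewrite [RHS]exchange_big; apply: eq_bigr => o _.
rewrite rmorph_sum !mulr_suml; apply: eq_bigr => l _.
rewrite rmorphM /= !mulrA; do 2!congr (_ * _).
by rewrite mulrC mulrA mulrAC; congr (_ * _); rewrite mulrC.
Qed.

(** The dual algebra D in the dual basis d_i: its product is the transpose of the comultiplication
    and its unit is the counit of k[G]. *)
Definition dual_scons : scons k m.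
Proof.
refine (@SCons k m (fun j l i => comul i j l) counit _ _ _).
- by move=> i j l; apply: comulC.
- by move=> i j o n; apply: comulA.
by move=> j l; rewrite eq_sym -counitl; apply: eq_bigr => i _; rewrite mulrC.
Defined.

End Comultiplication.

(** * Construction of the Verschiebung from the p-th power map of the dual algebra *)

Lemma frob_sum (k : fieldType) (p : nat) (chp : p \in [pchar k]) (R : calg k)
    (I : Type) (r : seq I) (P : pred I) (F : I -> R) :
  (\sum_(i <- r | P i) F i) ^+ p = \sum_(i <- r | P i) F i ^+ p.
Proof.
have [f0 fD] := frob_additive chp R.
exact: (big_morph (@frob k p R) fD f0).
Qed.

Section Verschiebung.
Variables (k : fieldType) (G : gfunctor k) (C : coords G).
Hypothesis commG : commutative_gf G.
Variables (p : nat) (chp : p \in [pchar k]).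
Local Notation m := (cdim C).
Local Notation mu := (cmul C).
Local Notation vec := (@vec k G C _).
Local Notation kk := (base_calg k).
Local Notation c := (@comul k G C).
Local Notation gD := (dual_scons C commG).
Local Notation dk := (salg kk gD).
Local Notation bas := (salg_bas kk gD).

Lemma vecM_pair (R : calg k) (x y : G R) i : vec (gmul x y) i =
  \sum_(q : 'I_m * 'I_m) calg_str R (c i q.1 q.2) * vec x q.1 * vec y q.2.
Proof. by rewrite vecM pair_big. Qed.

(** The comultiplication is multiplicative: both sides are coefficients of the function e_a e_b
    evaluated at a product x y. *)
Lemma comul_cmul a b j l : \sum_i mu a b i * c i j l =
  \sum_(q : 'I_m * 'I_m) \sum_(r : 'I_m * 'I_m)
    mu q.1 r.1 j * mu q.2 r.2 l * (c a q.1 q.2 * c b r.1 r.2).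
Proof.
apply: (coords_free2k (C := C) (a := fun j l => \sum_i mu a b i * c i j l)
  (b := fun j l => \sum_(q : 'I_m * 'I_m) \sum_(r : 'I_m * 'I_m)
    mu q.1 r.1 j * mu q.2 r.2 l * (c a q.1 q.2 * c b r.1 r.2))) => R x y {j l}.
transitivity (vec (gmul x y) a * vec (gmul x y) b).
  rewrite (vecP C _).1.
  under [RHS]eq_bigr => i _.
    rewrite vecM mulr_sumr; under eq_bigr => j _ do rewrite mulr_sumr.
    over.
  rewrite [RHS]exchange_big; apply: eq_bigr => j _.
  rewrite [RHS]exchange_big; apply: eq_bigr => l _.
  rewrite rmorph_sum !mulr_suml; apply: eq_bigr => i _.
  by rewrite rmorphM /= !mulrA.
rewrite !vecM_pair big_distrlr /=.
transitivity (\sum_(q : 'I_m * 'I_m) \sum_(r : 'I_m * 'I_m) \sum_j \sum_l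
    calg_str R (mu q.1 r.1 j * mu q.2 r.2 l * (c a q.1 q.2 * c b r.1 r.2))
      * vec x j * vec y l).
  apply: eq_bigr => q _; apply: eq_bigr => r _.
  transitivity (calg_str R (c a q.1 q.2 * c b r.1 r.2) *
    (vec x q.1 * vec x r.1) * (vec y q.2 * vec y r.2)).
    by rewrite rmorphM /=; ring.
  rewrite !(vecP C _).1 -mulrA big_distrlr mulr_sumr; apply: eq_bigr => j _.
  rewrite mulr_sumr; apply: eq_bigr => l _.
  by rewrite !rmorphM /=; ring.
symmetry.
under eq_bigr => j _.
  under eq_bigr => l _.
    rewrite rmorph_sum !mulr_suml.
    under eq_bigr => q _ do rewrite rmorph_sum !mulr_suml.
    over.
  rewrite exchange_big; over.
rewrite exchange_big; apply: eq_bigr => q _ /=.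
under eq_bigr => j _ do rewrite exchange_big.
by rewrite exchange_big.
Qed.

Lemma comul_cmul4 a b j l : \sum_i mu a b i * c i j l =
  \sum_b2 \sum_b1 \sum_a1 \sum_a2
    mu a1 b1 j * mu a2 b2 l * (c a a1 a2 * c b b1 b2).
Proof.
rewrite comul_cmul exchange_big [RHS]exchange_big [RHS]pair_big.
by apply: eq_bigr => r _; rewrite [RHS]pair_big.
Qed.

(** The family is the comultiplication of D, which sends d_i to the sum of the [mu a b i] d_a (x)
    d_b. That it respects products is the bialgebra identity [comul_cmul] read transposed. *)
Lemma dual_comul_point :
  sc_point gD (fun i => smk dk gD (fun b => smk kk gD (fun a => mu a b i))).
Proof.
split=> [j l|].
  apply: sco_ext => b; apply: sco_ext => a; rewrite !sco_sum.
  under [RHS]eq_bigr => i _ do rewrite sco_strM scoK sco_strM scoK mulrC.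
  rewrite [RHS]comul_cmul4 scoM exchange_big sco_sum.
  apply: eq_bigr => b2 _; rewrite sco_sum; apply: eq_bigr => b1 _.
  rewrite mulrC sco_strM !scoK. rewrite scoM mulr_sumr.
  apply: eq_bigr => a1 _; rewrite mulr_sumr; apply: eq_bigr => a2 _.
  by rewrite !scoK /=; ring.
apply: sco_ext => b; apply: sco_ext => a; rewrite !sco_sum.
under eq_bigr => i _ do rewrite sco_strM scoK sco_strM scoK mulrC.
rewrite sco1 sco_str /=.
by rewrite [RHS]mulrC (vecP C (gone G kk)).1; apply: eq_bigr => i _; rewrite mulrC.
Qed.

(** The counit of D is evaluation of functionals at 1 in k[G]. It respects products because the
    constant function 1 is multiplicative on G. *)
Lemma dual_counit_point : sc_point gD (fun i => sc1 mu i : kk).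
Proof.
split=> [j l|].
  pose f i j : k := \sum_l c l i j * sc1 mu l.
  apply: (coords_free2k (C := C) (a := fun j l => sc1 mu j * sc1 mu l)
     (b := f)) => R x y.
  transitivity (1 : R).
    rewrite -[RHS]mulr1 -{1}(vecP C x).2 -(vecP C y).2 big_distrlr.
    apply: eq_bigr => i _; apply: eq_bigr => j' _.
    by rewrite rmorphM /=; ring.
  rewrite -(vecP C (gmul x y)).2.
  under eq_bigr => i _.
    rewrite vecM mulr_sumr; under eq_bigr => j' _ do rewrite mulr_sumr.
    over.
  rewrite exchange_big; apply: eq_bigr => i _.
  rewrite exchange_big; apply: eq_bigr => j' _.
  rewrite rmorph_sum !mulr_suml; apply: eq_bigr => l' _.
  by rewrite rmorphM /=; ring.
by rewrite -[RHS](vecP C (gone G kk)).2; apply: eq_bigr => i _; rewrite mulrC.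
Qed.

Definition dual_comul : ahom dk (salg dk gD) :=
  salg_lift (calg_ini _) dual_comul_point.
Definition dual_counit : ahom dk kk := salg_lift (calg_ini _) dual_counit_point.

Lemma dual_comulE (phi : dk) a b :
  sco (sco (dual_comul phi) b) a = \sum_i sco phi i * mu a b i.
Proof.
rewrite salg_liftE !sco_sum; apply: eq_bigr => i _.
by rewrite sco_strM scoK sco_strM scoK.
Qed.

Lemma dual_counitE (phi : dk) :
  dual_counit phi = \sum_i sco phi i * sc1 mu i.
Proof. by []. Qed.

Definition salg_scale (R : calg k) : ahom dk (salg R gD) :=
  salg_lift (calg_ini _) (salg_bas_point gD R).

Lemma sco_scale (R : calg k) (phi : dk) l :
  sco (salg_scale R phi) l = calg_str R (sco phi l).
Proof.
rewrite salg_liftE sco_sum (bigD1 l) //= big1 ?addr0 => [|i il].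
  by rewrite sco_strM sco_bas eqxx mulr1.
by rewrite sco_strM sco_bas eq_sym (negPf il) mulr0.
Qed.

(** The matrix of the p-th power map of D. That map is only semilinear, so coordinates enter
    [dual_frobE] through their p-th powers. *)
Definition frobD i l : k := sco (bas i ^+ p) l.

Lemma dual_frobE (phi : dk) n : sco (phi ^+ p) n = \sum_i sco phi i ^+ p * frobD i n.
Proof.
rewrite {1}[phi]salg_decomp (frob_sum chp) sco_sum; apply: eq_bigr => i _.
by rewrite exprMn -rmorphXn sco_inM.
Qed.

(** The comultiplication of D is a ring homomorphism, so it commutes with p-th powers. This is what
    makes V x satisfy the equations of G. *)
Lemma frobD_mul i a b : \sum_l frobD i l * mu a b l =
  \sum_j \sum_l mu j l i ^+ p * frobD j a * frobD l b.
Proof.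
rewrite -dual_comulE rmorphXn /= (salg_lift_bas _ dual_comul_point).
have -> : smk dk gD (fun b => smk kk gD (fun a => mu a b i)) =
    \sum_j \sum_l calg_str _ (mu j l i) * (salg_in dk gD (bas j) * salg_bas dk gD l).
  apply: sco_ext => b'; apply: sco_ext => a'; rewrite !scoK !sco_sum.
  rewrite (bigD1 a') //= [X in _ + X]big1 ?addr0 => [|j ja].
    rewrite !sco_sum (bigD1 b') //= [X in _ + X]big1 ?addr0 => [|l lb].
      by rewrite !sco_in_funM sco_bas eqxx mulr1 sco_bas eqxx mulr1.
    by rewrite !sco_in_funM sco_bas eq_sym (negPf lb) mulr0 sco0 mulr0.
  rewrite !sco_sum big1 // => l _.
  rewrite !sco_in_funM sco_bas; case: eqP => _; rewrite ?mulr1 ?mulr0 ?sco0 ?mulr0 //.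
  by rewrite sco_bas eq_sym (negPf ja) mulr0.
rewrite (frob_sum chp (R := salg dk gD)) !sco_sum; apply: eq_bigr => j _.
rewrite (frob_sum chp (R := salg dk gD)) !sco_sum; apply: eq_bigr => l _.
rewrite !exprMn -!rmorphXn sco_strM sco_strM /= sco_inM.
have -> : salg_bas dk gD l ^+ p = salg_scale dk (bas l ^+ p).
  rewrite rmorphXn; congr (_ ^+ p); symmetry.
  exact: (salg_lift_bas _ (salg_bas_point gD dk)).
by rewrite sco_scale -mulrA; congr (_ * _); rewrite mulrC sco_strM mulrC.
Qed.

(** Two computations of (d_j d_l)^p. The identity makes V a homomorphism of groups. *)
Lemma frobD_comul j l n : \sum_i c i j l ^+ p * frobD i n =
  \sum_a \sum_b c n a b * frobD j a * frobD l b.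
Proof.
transitivity (sco ((bas j * bas l) ^+ p) n).
  rewrite dual_frobE; apply: eq_bigr => i _; congr (_ ^+ p * _).
  by rewrite salg_basM sco_sum (bigD1 i) //= big1 ?addr0 => [|i' ii];
     rewrite sco_inM sco_bas ?eqxx ?mulr1 // eq_sym (negPf ii) mulr0.
rewrite exprMn scoM; apply: eq_bigr => a _; apply: eq_bigr => b _.
by rewrite mulrC mulrA.
Qed.

(* V is the semilinear extension of the p-th power map of the dual algebra: it
   sends \sum_i x_i d_i, for d the dual basis, to \sum_i x_i d_i ^+ p. *)
Definition ver_fun (R : calg k) (x : G (twist chp R)) (n : 'I_m) : R :=
  \sum_i calg_str R (frobD i n) * (vec x i : R).

(** Over [twist chp R] the structure constants act through their p-th powers, exactly those that
    occur in [frobD_mul]. The unit equation uses in the same way that the counit of D commutes with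
    p-th powers. *)
Lemma ver_point (R : calg k) (x : G (twist chp R)) : sc_point mu (ver_fun x).
Proof.
case: (vecP C x) => xM x1; split=> [a b|].
  transitivity (\sum_i \sum_l calg_str R (frobD i l * mu a b l) * (vec x i : R)).
    rewrite big_distrlr /=.
    transitivity (\sum_j \sum_l calg_str R (frobD j a * frobD l b) *
        \sum_i calg_str R (mu j l i ^+ p) * (vec x i : R)).
      apply: eq_bigr => j _; apply: eq_bigr => l _.
      rewrite mulrACA -rmorphM; congr (_ * _); exact: xM.
    under [RHS]eq_bigr => i _ do rewrite -mulr_suml -rmorph_sum frobD_mul rmorph_sum mulr_suml.
    rewrite [RHS]exchange_big; apply: eq_bigr => j _.
    under [RHS]eq_bigr => i _ do rewrite rmorph_sum mulr_suml.
    rewrite [RHS]exchange_big; apply: eq_bigr => l _; rewrite mulr_sumr.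
    by apply: eq_bigr => i _; rewrite !rmorphM /=; ring.
  rewrite exchange_big; apply: eq_bigr => l _; rewrite mulr_sumr.
  by apply: eq_bigr => i _; rewrite mulrA -rmorphM [mu a b l * _]mulrC.
transitivity (\sum_i calg_str R (sc1 mu i ^+ p) * (vec x i : R)); last exact: x1.
under eq_bigr => l _ do rewrite mulr_sumr.
rewrite exchange_big; apply: eq_bigr => i _ /=.
under eq_bigr => l _ do rewrite mulrA -rmorphM mulrC.
rewrite -mulr_sumr -rmorph_sum mulrC; congr (calg_str R _ * _).
transitivity (dual_counit (bas i ^+ p)).
  by rewrite dual_counitE; apply: eq_bigr => l _; rewrite mulrC.
by rewrite rmorphXn /= (salg_lift_bas _ dual_counit_point).
Qed.

Definition ver_point_of (R : calg k) (x : G (twist chp R)) : G R :=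
  point_of (ver_point x).

Lemma vec_ver (R : calg k) (x : G (twist chp R)) : vec (ver_point_of x) =1 ver_fun x.
Proof. exact: vec_point_of. Qed.

Fact ver_map (R S : calg k) (f : ahom R S) (x : twist_gfunctor chp G R) :
  ver_point_of (kf_map (twist_gfunctor chp G) f x) = kf_map G f (ver_point_of x).
Proof.
apply: (@vec_inj _ _ C) => n; rewrite vec_map !vec_ver /ver_fun rmorph_sum.
apply: eq_bigr => i _; rewrite rmorphM /= ahomP; congr (_ * _).
exact: (@vec_map k G C (twist chp R) (twist chp S) (twist_hom chp f) x i).
Qed.

Fact ver_mul (R : calg k) (x y : twist_gfunctor chp G R) :
  ver_point_of (gmul x y) = gmul (ver_point_of x) (ver_point_of y).
Proof.
apply: (@vec_inj _ _ C) => n; rewrite vecM vec_ver /ver_fun.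
have E i : vec (gmul x y : G (twist chp R)) i = \sum_j \sum_l
    calg_str R (c i j l ^+ p) * (vec (x : G (twist chp R)) j : R) *
    (vec (y : G (twist chp R)) l : R) := @vecM k G C (twist chp R) x y i.
transitivity (\sum_j \sum_l (vec (x : G (twist chp R)) j : R) *
   (vec (y : G (twist chp R)) l : R) *
    calg_str R (\sum_i c i j l ^+ p * frobD i n)).
  under eq_bigr => i _.
    rewrite [X in _ * X]E mulr_sumr.
    under eq_bigr => j _ do rewrite mulr_sumr.
    over.
  rewrite exchange_big; apply: eq_bigr => j _.
  rewrite exchange_big; apply: eq_bigr => l _.
  rewrite rmorph_sum mulr_sumr; apply: eq_bigr => i _.
  by rewrite rmorphM /=; ring.
under eq_bigr => j _ do under eq_bigr => l _ do rewrite frobD_comul rmorph_sum mulr_sumr.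
under [RHS]eq_bigr => a _ do under eq_bigr => b _ do
  rewrite !vec_ver /ver_fun -mulrA big_distrlr mulr_sumr.
under [RHS]eq_bigr => a _ do rewrite exchange_big.
rewrite [RHS]exchange_big; apply: eq_bigr => j _.
under [RHS]eq_bigr => a _ do under eq_bigr => b _ do rewrite mulr_sumr.
under [RHS]eq_bigr => a _ do rewrite exchange_big.
rewrite [RHS]exchange_big; apply: eq_bigr => l _.
apply: eq_bigr => a _; rewrite rmorph_sum mulr_sumr; apply: eq_bigr => b _.
by rewrite !rmorphM /=; ring.
Qed.

Definition verschiebung : ghom (twist_gfunctor chp G) G := GHom ver_map ver_mul.

End Verschiebung.

(** * Characters, nilpotency of the augmentation ideal and the V-order *)

(** The one-sided inverses are recorded because they survive extension of scalars from the field to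
    arbitrary algebras. *)
Lemma full_rank_factorization (K : fieldType) (m n : nat) (A : 'M[K]_(m, n)) :
  exists (s : nat) (B : 'M_(m, s)) (B0 : 'M_(s, n)) (B' : 'M_(s, m)) (B0' : 'M_(n, s)),
  [/\ s = \rank A, B *m B0 = A, B' *m B = 1%:M & B0 *m B0' = 1%:M].
Proof.
have [B' B'B] := row_fullP (col_base_full A).
have [B0' B0B0'] := row_freeP (row_base_free A).
exists (\rank A), (col_base A), (row_base A), B', B0'.
by split=> //; apply: mulmx_base.
Qed.

Section VerschiebungTheory.
Variables (k : fieldType) (G : gfunctor k) (C : coords G).
Hypothesis commG : commutative_gf G.
Variables (p : nat) (chp : p \in [pchar k]).
Local Notation m := (cdim C).
Local Notation mu := (cmul C).
Local Notation vec := (@vec k G C _).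
Local Notation kk := (base_calg k).
Local Notation c := (@comul k G C).
Local Notation gD := (dual_scons C commG).
Local Notation dk := (salg kk gD).
Local Notation bas := (salg_bas kk gD).
Local Notation aug := (dual_counit C commG).
Local Notation V := (verschiebung C commG chp).

(** A character over R is a function on G over R; these are its coefficients in R (x) k[G]. *)
Definition char_coord (R : calg k) (chi : character G R) (l : 'I_m) : R :=
  sco (chi _ (salg_in R mu) (upt C R)) l.

Lemma charE (R S : calg k) (chi : character G R) (s : ahom R S) (y : G S) :
  chi S s y = \sum_l s (char_coord chi l) * vec y l.
Proof.
rewrite -(cliftE s) -char_map clift_upt; congr (chi _ _ _).
by apply: ahom_ext => r /=; rewrite (clift_in C s y).
Qed.

(** Cartier duality: multiplicativity of a character says that its coefficients define an algebra
    map from D to R. *)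
Lemma char_coord_point (R : calg k) (chi : character G R) :
  sc_point gD (char_coord chi).
Proof.
split=> [j l|].
  apply: (@coords_free2 k G C R (fun j l => char_coord chi j * char_coord chi l)
    (fun j l => \sum_i calg_str R (c i j l) * char_coord chi i)) => S s x y.
  transitivity (chi S s (gmul x y)).
    rewrite char_mul !charE big_distrlr; apply: eq_bigr => i _.
    by apply: eq_bigr => i' _; rewrite rmorphM /=; ring.
  rewrite charE; under eq_bigr => i _.
    rewrite vecM mulr_sumr; under eq_bigr => i' _ do rewrite mulr_sumr.
    over.
  rewrite exchange_big; apply: eq_bigr => i _.
  rewrite exchange_big; apply: eq_bigr => i' _.
  rewrite rmorph_sum !mulr_suml; apply: eq_bigr => n _.
  by rewrite rmorphM /= ahomP; ring.
rewrite -(char_one chi (ahom_id R)) charE; apply: eq_bigr => i _.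
by rewrite vec1 mulrC.
Qed.

(** Let ev : D -> R be the algebra map defined by chi. Both pairings equal sum_i ev(d_i)^p x_i, the
    left one because ev commutes with p-th powers. *)
Lemma verschiebungP : is_verschiebung V.
Proof.
move=> R chi x; rewrite /pairing charE /= /dual_map /= charE /=.
pose ev := salg_lift (calg_ini R) (char_coord_point chi).
transitivity (\sum_i ev (bas i ^+ p) * (vec x i : R)); last first.
  apply: eq_bigr => i _; congr (_ * _).
  by rewrite rmorphXn /= (salg_lift_bas _ (char_coord_point chi)).
under eq_bigr => l _ do rewrite vec_ver mulr_sumr.
rewrite exchange_big; apply: eq_bigr => i _; rewrite /= mulr_suml.
by apply: eq_bigr => l _; rewrite mulrCA mulrA.
Qed.

(** Viewing x as the element sum_l x_l d_l of R (x) D, this says that x - 1 is an R-combination of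
    p^a-th powers of elements of the augmentation ideal J. Each application of V raises a by one. *)
Definition aug_span (a : nat) (R : calg k) (x : G R) : Prop :=
  exists (N : nat) (s : 'I_N -> R) (phi : 'I_N -> dk),
    (forall t, aug (phi t) = 0) /\
    forall l, vec x l = calg_str R (counit l) +
      \sum_t s t * calg_str R (sco (phi t ^+ (p ^ a)) l).

Lemma aug_span0 (R : calg k) (x : G R) : aug_span 0 x.
Proof.
(* The elements d_l - aug(d_l) lie in J, and sum_l x_l aug(d_l) = 1 is the unit equation of x. *)
exists m, (vec x), (fun l => bas l - calg_str dk (sc1 mu l)); split=> [t|l].
  rewrite rmorphB ahomP /= (salg_lift_bas _ (dual_counit_point C commG)) //.
  exact: subrr.
under eq_bigr => t _ do
  rewrite expn0 expr1 -mulN1r -[-1](rmorphN1 (calg_str dk)) -rmorphM scoD sco_bas sco_str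
  mulN1r mulNr rmorphB mulrBr.
rewrite sumrB (bigD1 l) //= big1 ?addr0 => [|i il].
  rewrite eqxx rmorph1 mulr1.
  under eq_bigr => t _ do rewrite rmorphM mulrA.
  rewrite -mulr_suml; under eq_bigr => t _ do rewrite mulrC.
  by rewrite (vecP C x).2 mul1r addrC subrK.
by rewrite eq_sym (negPf il) rmorph0 mulr0.
Qed.

Lemma aug_spanS (a : nat) (R : calg k) (x : G (twist chp R)) :
  aug_span a x -> aug_span a.+1 (V R x).
Proof.
case=> N [s [phi [phi0 xE]]]; exists N, s, phi; split=> // n.
rewrite [LHS]vec_ver /ver_fun.
under eq_bigr => i _ do rewrite xE mulrDr.
rewrite big_split; congr (_ + _).
  under eq_bigr => i _ do rewrite -rmorphM mulrC.
  rewrite -rmorph_sum; congr (calg_str R _).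
  rewrite -[RHS](sco1 kk gD) -[1](expr1n dk p) (dual_frobE chp).
  by apply: eq_bigr => i _; rewrite sco1.
under eq_bigr => i _ do rewrite mulr_sumr.
rewrite exchange_big; apply: eq_bigr => t _.
rewrite expnS mulnC exprM (dual_frobE chp) rmorph_sum mulr_sumr.
by apply: eq_bigr => i _; rewrite rmorphM /= mulrC -mulrA [_ * calg_str R (frobD _ _ _ _)]mulrC.
Qed.

Lemma aug_span_iter (n a : nat) (R : calg k) (x : G (twistn chp n R)) :
  aug_span a x -> aug_span (a + n) (V_iter V x).
Proof.
elim: n a x => [|n IHn] a x /= ax; first by rewrite addn0.
by rewrite addnS -addSn; apply: IHn; apply: aug_spanS.
Qed.

Lemma V_iter_trivial (n : nat) :
  (forall phi : dk, aug phi = 0 -> phi ^+ (p ^ n) = 0) ->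
  forall (R : calg k) (x : G (twistn chp n R)), V_iter V x = gone G R.
Proof.
move=> nil R x; apply: (@vec_inj _ _ C) => l.
have [N [s [phi [phi0 ->]]]] := @aug_span_iter n 0 R x (aug_span0 x).
rewrite vec1 add0n big1 ?addr0 // => t _.
by rewrite nil // sco0 rmorph0 mulr0.
Qed.

(** A single coordinate is determined by the unit equation. Nontriviality enters here: the trivial
    group has V-order 1 and essential dimension 0. *)
Lemma mul_coords_nontrivial : nontrivial_gf G -> (1 < m)%N.
Proof.
case=> R [x x1]; rewrite ltnNge; apply/negP => m1; apply: x1.
apply: (@vec_inj _ _ C) => l.
have one (y : G R) : calg_str R (sc1 mu l) * vec y l = 1.
  rewrite -[RHS](vecP C y).2 (bigD1 l) //= big1 ?addr0 // => i /eqP[].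
  apply/val_inj; case: i l m1 => i im [l lm] /= m1.
  by move: (leq_trans im m1) (leq_trans lm m1); rewrite !ltnS !leqn0 => /eqP-> /eqP->.
by rewrite -[LHS]mul1r -{1}(one (gone G R)) mulrAC one mul1r.
Qed.

Definition mulmat (R : calg k) (v : salg R gD) : 'M[R]_m :=
  \matrix_(i, j) sco (v * salg_bas R gD j) i.

Lemma mulmatE (R : calg k) (v w : salg R gD) i :
  sco (v * w) i = \sum_j mulmat v i j * sco w j.
Proof.
rewrite {1}[w]salg_decomp mulr_sumr sco_sum; apply: eq_bigr => j _.
by rewrite mulrCA sco_inM mxE mulrC.
Qed.

Lemma mulmatM (R : calg k) (v w : salg R gD) : mulmat (v * w) = mulmat v *m mulmat w.
Proof.
apply/matrixP=> i j; rewrite !mxE -mulrA mulmatE.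
by apply: eq_bigr => l _; rewrite [mulmat w _ _]mxE.
Qed.

Lemma mulmat1 (R : calg k) : mulmat 1 = 1%:M :> 'M[R]_m.
Proof. by apply/matrixP=> i j; rewrite !mxE mul1r sco_bas. Qed.

Lemma mulmat_coord (R : calg k) (v : salg R gD) i j :
  mulmat v i j = \sum_a sco v a * calg_str R (c i a j).
Proof.
rewrite mxE scoM; apply: eq_bigr => a _.
rewrite (bigD1 j) //= big1 ?addr0 => [|b bj]; rewrite sco_bas ?eqxx ?mulr1 //.
by rewrite (negPf bj) mulr0 mul0r.
Qed.

Lemma mulmat_scale (R : calg k) (phi : dk) :
  mulmat (salg_scale C commG R phi) = map_mx (calg_ini R) (mulmat phi).
Proof.
apply/matrixP=> i j; rewrite [RHS]mxE !mulmat_coord rmorph_sum.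
by apply: eq_bigr => a _; rewrite sco_scale rmorphM.
Qed.

(** The point x as a group-like element of R (x) D. Multiplication by it makes D a representation of
    G, in which ideals are subrepresentations. *)
Definition dvec (R : calg k) (x : G R) : salg R gD := smk R gD (vec x).

Lemma dvecM (R : calg k) (x y : G R) : dvec (gmul x y) = dvec x * dvec y.
Proof.
apply: sco_ext => i; rewrite scoM scoK vecM.
by apply: eq_bigr => j _; apply: eq_bigr => l _; rewrite !scoK /=; ring.
Qed.

Lemma dvec1 (R : calg k) : dvec (gone G R) = 1.
Proof. by apply: sco_ext => i; rewrite scoK sco1 vec1. Qed.

Lemma dvec_map (R S : calg k) (f : ahom R S) (x : G R) :
  mulmat (dvec (kf_map G f x)) = map_mx f (mulmat (dvec x)).
Proof.
apply/matrixP=> i j; rewrite [RHS]mxE !mulmat_coord rmorph_sum.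
by apply: eq_bigr => a _; rewrite !scoK vec_map rmorphM /= ahomP.
Qed.

(** Fixedness reads sum_a x_a (d_a w) = (sum_a aug(d_a) x_a) w for all points x; comparing
    coefficients of the x_a gives the claim for each d_a. *)
Lemma fixed_aug (w : dk) :
  (forall R (x : G R), dvec x * salg_scale C commG R w = salg_scale C commG R w) ->
  forall phi : dk, phi * w = calg_str dk (aug phi) * w.
Proof.
move=> fixw phi; apply: sco_ext => i; rewrite sco_strM dual_counitE mulr_suml scoM.
apply: eq_bigr => a _.
have key : (fun a => \sum_j sco w j * c i a j) =1 (fun a => sc1 mu a * sco w i).
  apply: (@coords_free k G C kk) => R s x.
  have sE b : s b = calg_str R b by rewrite -(ahomP s).
  transitivity (sco (salg_scale C commG R w) i).
    rewrite -[in RHS](fixw R x) mulmatE.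
    under eq_bigr => j _ do rewrite sE rmorph_sum mulr_suml.
    rewrite exchange_big; apply: eq_bigr => j _.
    rewrite mulmat_coord sco_scale mulr_suml; apply: eq_bigr => b _.
    by rewrite scoK rmorphM /=; ring.
  rewrite sco_scale -[LHS]mul1r -(vecP C x).2 mulr_suml.
  by apply: eq_bigr => b _; rewrite sE rmorphM /= mulrAC.
rewrite -[RHS]mulrA -[sc1 mu a * _]key mulr_sumr.
by apply: eq_bigr => j _; rewrite -mulrA.
Qed.

Section SubRep.
Variables (s : nat) (B : 'M[k]_(m, s)) (B' : 'M[k]_(s, m)).
Hypothesis B'B : B' *m B = 1%:M.
Hypothesis stableB : forall (R : calg k) (x : G R),
  exists A : 'M[R]_s, mulmat (dvec x) *m map_mx (calg_str R) B = map_mx (calg_str R) B *m A.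

Definition sub_rep_fun (R : calg k) (x : G R) : 'M[R]_s :=
  map_mx (calg_str R) B' *m mulmat (dvec x) *m map_mx (calg_str R) B.

Lemma sub_repE (R : calg k) (x : G R) :
  mulmat (dvec x) *m map_mx (calg_str R) B = map_mx (calg_str R) B *m sub_rep_fun x.
Proof.
rewrite /sub_rep_fun -mulmxA; have [A ->] := stableB x; congr (_ *m _).
by rewrite mulmxA -map_mxM B'B map_mx1 mul1mx.
Qed.

Definition sub_rep : lin_rep G s.
Proof.
refine (@LinRep k G s sub_rep_fun _ _ _).
- move=> R S f x; rewrite /sub_rep_fun dvec_map !map_mxM -!map_mx_comp.
  by congr (_ *m _ *m _); apply/matrixP=> i j; rewrite !mxE /= ahomP.
- by move=> R; rewrite /sub_rep_fun dvec1 mulmat1 mulmx1 -map_mxM B'B map_mx1.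
move=> R x y; rewrite [LHS]/sub_rep_fun dvecM mulmatM -mulmxA -mulmxA sub_repE.
by rewrite mulmxA mulmxA.
Defined.
End SubRep.

Hypothesis unipG : unipotent G.

(* If phi were not nilpotent, the eventual image of multiplication by phi would be
   a nonzero subrepresentation on which phi acts injectively, while phi kills its
   fixed vectors. *)
Lemma aug_nilpotent (phi : dk) : aug phi = 0 -> exists N, phi ^+ N = 0.
Proof.
move=> phi0.
pose A N : 'M[k]_m := mulmat (phi ^+ N).
(* A power of phi of least rank has the eventual image of phi as its image. *)
have exr : exists r, `[< exists N, \rank (A N) = r >].
  by exists (\rank (A 0%N)); apply/asboolP; exists 0%N.
case: (ex_minnP exr) => r /asboolP[N rN] r_min.
have {}r_min N' : (r <= \rank (A N'))%N.
  by apply: r_min; apply/asboolP; exists N'.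
exists N; case: (posnP r) => [r0|r_gt0].
  move: rN; rewrite r0 => /eqP; rewrite mxrank_eq0 => /eqP A0.
  rewrite -[_ ^+ N]mulr1; apply: sco_ext => i; rewrite mulmatE sco0.
  by apply: big1 => j _; rewrite -[mulmat _]/(A N) A0 mxE mul0r.
exfalso.
have [s [B [B0 [B' [B0' [sE AE B'B B0B0']]]]]] := full_rank_factorization (A N).
have stableB (R : calg k) (x : G R) : exists A' : 'M[R]_s,
    mulmat (dvec x) *m map_mx (calg_str R) B = map_mx (calg_str R) B *m A'.
  (* The image of phi^N is an ideal of the commutative ring D, so multiplication by x preserves
     it. *)
  exists (map_mx (calg_ini R) B0 *m (mulmat (dvec x) *m map_mx (calg_ini R) B0')).
  have BE : B = A N *m B0' by rewrite -AE -mulmxA B0B0' mulmx1.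
  rewrite -[calg_str R]/(ahom_fun (calg_ini R)) [in RHS]mulmxA -map_mxM AE.
  rewrite BE map_mxM -!mulmat_scale !mulmxA -!mulmatM.
  by rewrite mulrC.
have s_gt0 : (0 < s)%N by rewrite sE rN.
have [v [v0 vfix]] := unipG (sub_rep B'B stableB) s_gt0.
pose w : dk := smk kk gD (fun i => (B *m v) i 0).
have wE (R : calg k) i : sco (salg_scale C commG R w) i =
    (map_mx (calg_str R) B *m map_mx (calg_str R) v) i 0.
  by rewrite sco_scale scoK -map_mxM [RHS]mxE.
have /fixed_aug/(_ phi) : forall R (x : G R),
    dvec x * salg_scale C commG R w = salg_scale C commG R w.
  move=> R x; apply: sco_ext => i; rewrite mulmatE wE.
  rewrite -[in RHS](vfix R x) mulmxA -(sub_repE B'B stableB) -mulmxA [RHS]mxE.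
  by apply: eq_bigr => j _; rewrite wE.
rewrite phi0 rmorph0 mul0r => phiw.
(* By minimality phi^(N+1) still has rank r, so phi is injective on the image; as it kills w, this
   forces v = 0. *)
have /row_fullP[D' D'B] : row_full (mulmat phi *m B).
  rewrite /row_full eqn_leq rank_leq_col /=.
  apply: leq_trans (mxrankM_maxl _ B0); rewrite -mulmxA AE.
  have <- : A N.+1 = mulmat phi *m A N by rewrite /A exprS mulmatM.
  by rewrite sE rN r_min.
case: v0; rewrite -[v]mul1mx -D'B -!mulmxA.
suff -> : mulmat phi *m (B *m v) = 0 by rewrite mulmx0.
apply/matrixP=> i j; rewrite ord1 [RHS]mxE -[RHS](sco0 kk gD i) -phiw mulmatE mxE.
by apply: eq_bigr => l _; rewrite scoK.
Qed.

(** If N is the nilpotency index of phi, then 1, phi, ..., phi^(N-1) are independent in D, so q < N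
    <= m. *)
Lemma nilpotent_exponent (phi : dk) (q : nat) :
  aug phi = 0 -> phi ^+ q != 0 -> (q < m)%N.
Proof.
move=> /aug_nilpotent exN q0.
have exN' : exists N, phi ^+ N == 0 by case: exN => N /eqP; exists N.
case: (ex_minnP exN') => N /eqP N0 N_min.
have qN : (q < N)%N.
  rewrite ltnNge; apply/negP => Nq; move/negP: q0; apply.
  by rewrite -(subnK Nq) exprD N0 mulr0.
apply: leq_trans qN _; rewrite leqNgt; apply/negP => mN.
have [u u0 uA] := row_dependent (\matrix_(i < N, j < m) sco (phi ^+ i) j) mN.
have uphi : \sum_(i < N) calg_str dk (u 0 i) * phi ^+ i = 0.
  apply: sco_ext => j; rewrite sco_sum sco0.
  move/matrixP/(_ 0 j): uA; rewrite !mxE => uAj; rewrite -[RHS]uAj.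
  by apply: eq_bigr => i _; rewrite sco_strM mxE.
have exi : exists i, [exists j : 'I_N, (j == i :> nat) && (u 0 j != 0)].
  case/rV0Pn: u0 => j uj; exists j; apply/existsP; exists j; exact/andP.
case: (ex_minnP exi) => i /existsP[j /andP[/eqP ji uj]] i_min.
have jN := ltn_ord j.
have : calg_str dk (u 0 j) * phi ^+ N.-1 = 0.
  (* Here j is the least index with a nonzero coefficient; multiplication by phi^(N-1-j) kills all
     later terms. *)
  have := congr1 ( *%R^~ (phi ^+ (N.-1 - j))) uphi.
  rewrite mul0r mulr_suml (bigD1 j) //= big1 ?addr0 => [|l lj].
    by rewrite -mulrA -exprD subnKC // -ltnS prednK // (leq_trans _ jN).
  case: (ltnP l j) => [lt_lj | ].
    case: (eqVneq (u 0 l) 0) => [->|ul]; first by rewrite rmorph0 !mul0r.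
    suff: (i <= l)%N by rewrite -ji leqNgt lt_lj.
    by apply: i_min; apply/existsP; exists l; rewrite eqxx.
  rewrite leq_eqVlt eq_sym (negPf (_ : l != j :> nat)) //= => jl.
  rewrite -mulrA -exprD; suff: (N <= l + (N.-1 - j))%N.
    by move=> /subnK <-; rewrite exprD N0 !mulr0.
  have N_gt0 : (0 < N)%N by apply: leq_ltn_trans jN.
  by move: jl jN N_gt0; clear; lia.
move=> /(congr1 ( *%R (calg_str dk (u 0 j)^-1))).
rewrite mulrA -rmorphM mulVf // rmorph1 mul1r mulr0 => /eqP /N_min.
by rewrite -ltnS prednK ?ltnn // (leq_ltn_trans _ jN).
Qed.

Lemma aug_height : nontrivial_gf G -> exists n, [/\ (0 < n)%N,
  forall phi : dk, aug phi = 0 -> phi ^+ (p ^ n) = 0 & (p ^ n.-1 < m)%N].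
Proof.
move=> ntG; have m1 := mul_coords_nontrivial ntG.
have p1 : (1 < p)%N := prime_gt1 (pcharf_prime chp).
pose P n := (0 < n)%N && `[< forall phi : dk, aug phi = 0 -> phi ^+ (p ^ n) = 0 >].
have exP : exists n, P n.
  (* The exponent m is admissible because m < p^m. *)
  exists m; apply/andP; split; first exact: ltnW.
  apply/asboolP=> phi phi0; apply/eqP; apply: contraT => /(nilpotent_exponent phi0).
  by rewrite ltnNge ltnW // ltn_expl.
case: (ex_minnP exP) => n /andP[n0 /asboolP nP] n_min; exists n; split=> //.
case: n n0 nP n_min => [//|[|n]] _ _ n_min /=; first by rewrite expn0.
rewrite ltnNge; apply/negP => mn.
suff /n_min : P n.+1 by rewrite ltnn.
apply/andP; split=> //; apply/asboolP => phi phi0; apply/eqP; apply: contraT.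
by move=> /(nilpotent_exponent phi0); rewrite ltnNge mn.
Qed.

End VerschiebungTheory.

Lemma enat_min_le (P : nat -> Prop) n : P n -> enat_le (enat_min P) (Some n).
Proof.
move=> Pn; rewrite /enat_min; case: pselect => [exP|[]]; last by exists n.
by case: ex_minnP => j _ /(_ n); apply; apply/asboolP.
Qed.

(** The exponent n of J bounds the V-order from above, the direction that the final comparison
    uses. *)
Lemma V_order_bound (k : fieldType) (G : gfunctor k) (C : coords G) (p : nat)
    (chp : p \in [pchar k]) :
  commutative_gf G -> unipotent G -> nontrivial_gf G ->
  exists n, [/\ (0 < n)%N, enat_le (V_order chp G) (Some n)
    & (p ^ n.-1 < cdim C)%N].
Proof.
move=> commG unipG ntG; have [n [n0 nP pn]] := aug_height C commG chp unipG ntG.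
exists n; split=> //; apply: enat_min_le; split=> //.
exists (verschiebung C commG chp); split; first exact: verschiebungP.
exact: V_iter_trivial.
Qed.

(** * Subfields, fraction fields and the rational function field over k *)

(** [sfpV] includes division by 0, whose value is 0; the closure proofs below treat that case
    apart. *)
Record subfield_pred (E : fieldType) := SubfieldPred {
  sfp :> E -> Prop;
  sfp1 : sfp 1;
  sfpB : forall x y, sfp x -> sfp y -> sfp (x - y);
  sfpV : forall x y, sfp x -> sfp y -> sfp (x / y) }.

Definition sf_mem (E : fieldType) (F : subfield_pred E) : {pred E} :=
  fun x => `[< F x >].

Fact sf_divring_closed (E : fieldType) (F : subfield_pred E) :
  divring_closed (sf_mem F).
Proof.
split=> [|x y /asboolP Fx /asboolP Fy|x y /asboolP Fx /asboolP Fy]; apply/asboolP.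
- exact: sfp1.
- exact: sfpB.
exact: sfpV.
Qed.
HB.instance Definition _ (E : fieldType) (F : subfield_pred E) :=
  GRing.isDivringClosed.Build E (sf_mem F) (sf_divring_closed F).

Record sf_type (E : fieldType) (F : subfield_pred E) :=
  SfType { sf_val :> E; _ : sf_val \in sf_mem F }.
HB.instance Definition _ (E : fieldType) (F : subfield_pred E) :=
  [isSub of sf_type F for @sf_val E F].
HB.instance Definition _ (E : fieldType) (F : subfield_pred E) :=
  [Choice of sf_type F by <:].
HB.instance Definition _ (E : fieldType) (F : subfield_pred E) :=
  [SubChoice_isSubIntegralDomain of sf_type F by <:].
HB.instance Definition _ (E : fieldType) (F : subfield_pred E) :=
  [SubIntegralDomain_isSubField of sf_type F by <:].

Lemma sf_valP (E : fieldType) (F : subfield_pred E) (x : sf_type F) : F (val x).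
Proof. by case: x => x /= /asboolP. Qed.

Definition sf_inj (E : fieldType) (F : subfield_pred E) : {rmorphism sf_type F -> E} :=
  (val : sf_type F -> E).

Lemma sf_lift (E : fieldType) (F : subfield_pred E) (x : E) :
  F x -> exists y : sf_type F, sf_inj F y = x.
Proof. by move=> /asboolP Fx; exists (SfType Fx). Qed.

Section SubfieldClosure.
Variables (E : fieldType) (F : subfield_pred E).
Lemma sfp0 : F 0. Proof. by rewrite -(subrr 1); apply: sfpB; apply: sfp1. Qed.
Lemma sfpN x : F x -> F (- x).
Proof. by rewrite -[- x]add0r; apply: sfpB; apply: sfp0. Qed.
Lemma sfpD x y : F x -> F y -> F (x + y).
Proof. by move=> Fx Fy; rewrite -[y]opprK; apply: sfpB => //; apply: sfpN. Qed.
Lemma sfp_inv x : F x -> F x^-1.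
Proof. by rewrite -[x^-1]mul1r; apply: sfpV; apply: sfp1. Qed.
Lemma sfpM x y : F x -> F y -> F (x * y).
Proof. by move=> Fx Fy; rewrite -[y]invrK; apply: sfpV => //; apply: sfp_inv. Qed.
Lemma sfpX x n : F x -> F (x ^+ n).
Proof.
by move=> Fx; elim: n => [|n IH]; [exact: sfp1 | rewrite exprS; exact: sfpM].
Qed.
Lemma sfp_sum (I : Type) (r : seq I) (P : pred I) (f : I -> E) :
  (forall i, P i -> F (f i)) -> F (\sum_(i <- r | P i) f i).
Proof. by move=> Ff; elim/big_ind: _ => //; [exact: sfp0 | exact: sfpD]. Qed.
End SubfieldClosure.

Lemma fraction_repr (P : idomainType) (x : {fraction P}) :
  exists a b : P, b != 0 /\ x = FracField.tofrac a / FracField.tofrac b.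
Proof.
have [a [b [b0 xE]]] : exists a b : P, b != 0 /\
    x * FracField.tofrac b = FracField.tofrac a; last first.
  exists a, b; split=> //; rewrite -xE mulfK //.
  by rewrite tofrac_eq0.
elim/generic_quotient.quotW: x => -[[a b] /= b0]; exists a, b; split=> //.
rewrite /FracField.tofrac; unlock FracField.tofrac.
rewrite -[_ * _]FracField.pi_mul; apply/generic_quotient.eqmodP.
rewrite /= FracField.equivfE /FracField.mulf /= !numden_Ratio ?oner_eq0 ?mulr1 //.
  by rewrite mulrC.
Qed.

Lemma fraction_ext (P : idomainType) (S : comPzRingType)
    (f g : {rmorphism {fraction P} -> S}) :
  (forall a, f (FracField.tofrac a) = g (FracField.tofrac a)) -> f =1 g.
Proof.
move=> fg x; have [a [b [b0 ->]]] := fraction_repr x.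
have tb0 : FracField.tofrac b != 0 by rewrite tofrac_eq0.
have gb : g (FracField.tofrac b) * g (FracField.tofrac b)^-1 = 1.
  by rewrite -rmorphM mulfV // rmorph1.
rewrite -[LHS]mulr1 -gb -fg mulrA -rmorphM divfK //.
by rewrite fg -rmorphM.
Qed.

(** The target need not be a field, so the value y at a / b is characterised by y f(b) = f(a); it is
    unique because f(b) is a unit. *)
Lemma fraction_lift (P : idomainType) (S : comPzRingType) (f : {rmorphism P -> S}) :
  (forall b, b != 0 -> exists u, f b * u = 1) ->
  exists g : {rmorphism {fraction P} -> S},
    forall a, g (FracField.tofrac a) = f a.
Proof.
move=> f_unit; pose t : {rmorphism P -> {fraction P}} := @FracField.tofrac P.
have t0 b : b != 0 -> t b != 0 by rewrite tofrac_eq0.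
have gex (x : {fraction P}) : exists y, forall a b, b != 0 -> x * t b = t a -> y * f b = f a.
  have [a [b [b0 ->]]] := fraction_repr x; have [u bu] := f_unit _ b0.
  exists (f a * u) => a' b' b'0 e.
  have : a * b' = a' * b.
    apply/eqP; rewrite -tofrac_eq !rmorphM /=; apply/eqP.
    by rewrite -[X in _ = X * _]e mulrAC divfK ?t0.
  move=> /(congr1 f); rewrite !rmorphM => e'.
  by rewrite mulrAC e' -mulrA bu mulr1.
pose g x := projT1 (cid (gex x)).
have gP x a b : b != 0 -> x * t b = t a -> g x * f b = f a.
  by rewrite /g; case: cid => y yP; apply: yP.
have reg b x y : b != 0 -> x * f b = y * f b -> x = y.
  move=> /f_unit[u bu] /(congr1 ( *%R^~ u)).
  by rewrite -!mulrA bu !mulr1.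
have gt a : g (t a) = f a.
  by have := gP (t a) a 1 (oner_neq0 _); rewrite !rmorph1 !mulr1; apply.
have g_add : nmod_morphism g.
  split=> [|x y]; first by rewrite -[0](rmorph0 t) gt rmorph0.
  have [a [b [b0 xE]]] := fraction_repr x; have [c [d [d0 yE]]] := fraction_repr y.
  have gx := gP x a b b0; have gy := gP y c d d0.
  have bd0 : b * d != 0 by rewrite mulf_neq0.
  apply: (reg (b * d)) => //; rewrite (gP _ (a * d + c * b)) //.
    rewrite rmorphD !rmorphM -gx ?xE ?divfK ?t0 // -gy ?yE ?divfK ?t0 //.
    by ring.
  by rewrite xE yE rmorphD !rmorphM addf_div ?t0 // divfK // mulf_neq0 ?t0.
have g_mul : monoid_morphism g.
  split=> [|x y]; first by rewrite -[1](rmorph1 t) gt rmorph1.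
  have [a [b [b0 xE]]] := fraction_repr x; have [c [d [d0 yE]]] := fraction_repr y.
  have gx := gP x a b b0; have gy := gP y c d d0.
  have bd0 : b * d != 0 by rewrite mulf_neq0.
  apply: (reg (b * d)) => //; rewrite (gP _ (a * c)) //.
    rewrite !rmorphM -gx ?xE ?divfK ?t0 // -gy ?yE ?divfK ?t0 //.
    by ring.
  by rewrite xE yE !rmorphM mulf_div divfK // mulf_neq0 ?t0.
pose Aa := GRing.isNmodMorphism.Build _ _ g g_add.
pose Am := GRing.isMonoidMorphism.Build _ _ g g_mul.
by exists (HB.pack g Aa Am : {rmorphism _ -> _}) => a; apply: gt.
Qed.

Lemma mpoly_lift (k : fieldType) (n : nat) (S : calg k) (v : 'I_n -> S) :
  (1 : S) <> 0 -> exists f : {rmorphism {mpoly k[n]} -> S},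
    (forall c, f c%:MP = calg_str S c) /\ forall i, f 'X_i = v i.
Proof.
move=> /eqP S1.
pose S' : comNzRingType := HB.pack (GRing.ComPzRing.sort S) (GRing.PzSemiRing_isNonZero.Build S S1).
pose i : {rmorphism k -> S'} := calg_str S.
exists (mmap i (v : 'I_n -> S') : {rmorphism {mpoly k[n]} -> S'}).
by split=> [c|j]; rewrite /= ?mmapC // mmapX mmap1U.
Qed.

Lemma mpoly_ext (k : fieldType) (n : nat) (S : comPzRingType)
    (f g : {rmorphism {mpoly k[n]} -> S}) :
  (forall c, f c%:MP = g c%:MP) -> (forall i, f 'X_i = g 'X_i) -> f =1 g.
Proof.
move=> fgC fgX P; rewrite (mpolyE P) !rmorph_sum; apply: eq_bigr => e _.
rewrite -mul_mpolyC !rmorphM fgC; congr (_ * _).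
by rewrite mpolyXE_id !rmorph_prod; apply: eq_bigr => i _; rewrite !rmorphXn fgX.
Qed.

Lemma mcoeff_frob (k : fieldType) (p : nat) (chp : p \in [pchar k]) (n : nat)
    (P : {mpoly k[n]}) (e : 'X_{1..n}) :
  (P ^+ p)@_(e *+ p)%MM = (P@_e) ^+ p.
Proof.
have p_gt0 : (0 < p)%N := prime_gt0 (pcharf_prime chp).
have chP : p \in [pchar {mpoly k[n]}].
  by rewrite (rmorph_pchar (@mpolyC n k)).
have sumX (I : Type) (r : seq I) (F : I -> {mpoly k[n]}) :
    (\sum_(i <- r) F i) ^+ p = \sum_(i <- r) F i ^+ p.
  exact: (rmorph_sum (pFrobenius_aut chP) r xpredT F).
rewrite {1}(mpolyE P) sumX raddf_sum /=.
have E a : ((P@_a *: 'X_[a]) ^+ p)@_(e *+ p)%MM = P@_a ^+ p * (a == e)%:R.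
  rewrite exprZn mcoeffZ mpolyXn mcoeffX; congr (_ * (_ : bool)%:R).
  apply/eqP/eqP=> [/mnmP ae|-> //]; apply/mnmP => i.
  by have := ae i; rewrite !mulmnE => /eqP; rewrite eqn_pmul2r // => /eqP.
under eq_bigr => a _ do rewrite E.
have [eP|eP] := boolP (e \in msupp P); last first.
  rewrite memN_msupp_eq0 // expr0n gtn_eqF // big_seq big1 // => a aP.
  by case: eqP aP eP => [-> ->//|_]; rewrite mulr0.
rewrite (bigD1_seq e) ?msupp_uniq //= eqxx mulr1 big1 ?addr0 // => a /negPf->.
by rewrite mulr0.
Qed.

(** The relation makes the rows of the coefficient matrix dependent after its entries are raised to
    the p-th power. Frobenius is a field embedding of k in itself and preserves rank, so the P_i are
    dependent; the c_i need not be p-th powers. *)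
Lemma mpoly_frob_free (k : fieldType) (p : nat) (chp : p \in [pchar k]) (n N : nat)
    (P : 'I_N -> {mpoly k[n]}) (c : 'I_N -> k) :
  \sum_i c i *: P i ^+ p = 0 -> (exists i, c i != 0) ->
  exists d : 'I_N -> k, (exists i, d i != 0) /\ \sum_i d i *: P i = 0.
Proof.
move=> cP [i0 ci0].
pose b := \max_i msize (P i).
pose A : 'M[k]_(N, #|{: 'X_{1..n < b}}|) := \matrix_(i, j) (P i)@_(enum_val j : 'X_{1..n < b}).
have AN : ~~ row_free (map_mx (pFrobenius_aut chp) A).
  apply/negP => /row_freeP[B AB]; move/negP: ci0; apply.
  have : (\row_i c i) *m map_mx (pFrobenius_aut chp) A = 0.
    apply/rowP => j; rewrite !mxE; move/(congr1 (mcoeff ((enum_val j : 'X_{1..n < b}) *+ p)%MM)): cP.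
    rewrite raddf_sum /= mcoeff0 => {2}<-; apply: eq_bigr => i _.
    by rewrite !mxE mcoeffZ (mcoeff_frob chp) pFrobenius_autE.
  move=> /(congr1 (mulmx^~ B)); rewrite -mulmxA AB mulmx1 mul0mx.
  by move/rowP/(_ i0); rewrite !mxE => ->.
move: AN; rewrite row_free_map -kermx_eq0 => /rowV0Pn[d /sub_kermxP dA d0].
exists (fun i => d 0 i); split.
  by case/rV0Pn: d0 => i di; exists i.
apply/mpolyP => e; rewrite raddf_sum /= mcoeff0.
case: (ltnP (mdeg e) b) => [eb|be]; last first.
  apply: big1 => i _; rewrite mcoeffZ memN_msupp_eq0 ?mulr0 //.
  by apply: msize_mdeg_ge; apply: leq_trans be; apply: (leq_bigmax i).
move/rowP/(_ (enum_rank (BMultinom eb))): dA; rewrite !mxE => {2}<-.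
by apply: eq_bigr => i _; rewrite mxE mcoeffZ enum_rankK.
Qed.

(** The properties of k(x_1, ..., x_n) on which the torsor rests. [gf_frob_free] is Mac Lane's
    criterion for separability over k. *)
Record generic_field (k : fieldType) (n : nat) := GenericField {
  gf_sort :> fieldType;
  gf_str : {rmorphism k -> gf_sort};
  gf_poly : {rmorphism {mpoly k[n]} -> gf_sort};
  gf_polyC : forall c, gf_poly c%:MP = gf_str c;
  gf_poly_inj : forall P, gf_poly P = 0 -> P = 0;
  gf_frob_free : forall (p : nat) (chp : p \in [pchar k]) (N : nat)
      (v : 'I_N -> gf_sort) (c : 'I_N -> k),
    \sum_i gf_str (c i) * v i ^+ p = 0 -> (exists i, c i != 0) ->
    exists d : 'I_N -> k, (exists i, d i != 0) /\ \sum_i gf_str (d i) * v i = 0;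
  gf_lift : forall (S : calg k) (f : {rmorphism {mpoly k[n]} -> S}),
    (forall c, f c%:MP = calg_str S c) ->
    (forall P, P != 0 -> exists u, f P * u = 1) ->
    exists g : ahom (CAlg gf_str) S, forall P, g (gf_poly P) = f P;
  gf_ext : forall (S : calg k) (f g : ahom (CAlg gf_str) S),
    (forall i, f (gf_poly 'X_i) = g (gf_poly 'X_i)) -> f = g }.

Lemma generic_field_exists (k : fieldType) (n : nat) :
  exists E : generic_field k n, True.
Proof.
pose P := {mpoly k[n]}.
pose t : {rmorphism P -> {fraction P}} := @FracField.tofrac P.
pose s : {rmorphism k -> {fraction P}} := t \o @mpolyC n k.
unshelve eexists (@GenericField k n {fraction P} s t _ _ _ _ _) => //.
- by move=> a /eqP; rewrite tofrac_eq0 => /eqP.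
- move=> p chp N v c vc c0.
  (* A common denominator q turns the v_i into polynomials; the relation is multiplied by q^p. *)
  have [Q [q [q0 vE]]] : exists (Q : 'I_N -> P) (q : P), q != 0 /\
      forall i, v i * t q = t (Q i).
    have /choice[num /choice[den vE]] : forall i, exists a b : P,
        b != 0 /\ v i = t a / t b by move=> i; apply: fraction_repr.
    exists (fun i => num i * \prod_(j | j != i) den j), (\prod_j den j); split.
      by rewrite prodf_seq_neq0; apply/allP => j _; case: (vE j).
    move=> i; rewrite (bigD1 i) //= !rmorphM /=; case: (vE i) => d0 ->.
    by rewrite mulrA divfK // tofrac_eq0.
  have tq0 : t q != 0 by rewrite tofrac_eq0.
  have [|d [d0 dQ]] := mpoly_frob_free chp (P := Q) (c := c) _ c0.
    apply/eqP; rewrite -tofrac_eq0; apply/eqP.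
    transitivity ((\sum_i s (c i) * v i ^+ p) * t q ^+ p); last by rewrite vc mul0r.
    rewrite (rmorph_sum t) mulr_suml; apply: eq_bigr => i _.
    by rewrite -mul_mpolyC rmorphM rmorphXn -vE exprMn mulrA.
  exists d; split=> //; apply: (mulIf tq0); rewrite mul0r mulr_suml.
  transitivity (t (\sum_i d i *: Q i)); last by rewrite dQ rmorph0.
  rewrite (rmorph_sum t); apply: eq_bigr => i _.
  by rewrite -mul_mpolyC rmorphM -vE mulrA.
- move=> S f fC f_unit; have [g gt] := fraction_lift f_unit.
  have gP c : g (s c) = calg_str S c by rewrite -fC -gt.
  by exists (@AHom k (CAlg s) S g gP).
move=> S f g fg; apply: ahom_ext; apply: fraction_ext => a.
pose f' : {rmorphism P -> S} := f \o t; pose g' : {rmorphism P -> S} := g \o t.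
apply: (mpoly_ext (f := f') (g := g')) => // c.
by have := ahomP f c; rewrite -(ahomP g c).
Qed.

(** * Spans over subfields and dimension counts with Frobenius *)

Section Span.
Variables (F E : fieldType) (f : {rmorphism F -> E}).

Definition in_span (I : finType) (z : I -> E) (x : E) : Prop :=
  exists a : I -> F, x = \sum_i f (a i) * z i.
Definition free_fam (I : finType) (z : I -> E) : Prop :=
  forall a : I -> F, \sum_i f (a i) * z i = 0 -> forall i, a i = 0.
Definition ring_span (I : finType) (z : I -> E) : Prop :=
  in_span z 1 /\ forall x y, in_span z x -> in_span z y -> in_span z (x * y).
(** The element b is a root of a monic polynomial of degree n over F, not necessarily of least
    degree. *)
Definition integral_deg (b : E) (n : nat) : Prop :=
  in_span (fun i : 'I_n => b ^+ i) (b ^+ n).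

Section OneFamily.
Variables (I : finType) (z : I -> E).

Lemma in_span0 : in_span z 0.
Proof. by exists (fun=> 0); rewrite big1 // => i _; rewrite rmorph0 mul0r. Qed.

Lemma in_spanD x y : in_span z x -> in_span z y -> in_span z (x + y).
Proof.
case=> a -> [b ->]; exists (fun i => a i + b i); rewrite -big_split.
by apply: eq_bigr => i _; rewrite rmorphD mulrDl.
Qed.

Lemma in_spanZ c x : in_span z x -> in_span z (f c * x).
Proof.
case=> a ->; exists (fun i => c * a i); rewrite mulr_sumr.
by apply: eq_bigr => i _; rewrite rmorphM mulrA.
Qed.

Lemma in_span_sum (J : Type) (r : seq J) (P : pred J) (g : J -> E) :
  (forall j, P j -> in_span z (g j)) -> in_span z (\sum_(j <- r | P j) g j).
Proof. by move=> zg; elim/big_ind: _ => //; [exact: in_span0 | exact: in_spanD]. Qed.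

Lemma in_span_gen i : in_span z (z i).
Proof.
exists (fun j => (j == i)%:R); rewrite (bigD1 i) //= eqxx rmorph1 mul1r big1 ?addr0 //.
by move=> j /negPf ->; rewrite rmorph0 mul0r.
Qed.
End OneFamily.

Lemma in_span_trans (I J : finType) (z : I -> E) (w : J -> E) x :
  (forall i, in_span w (z i)) -> in_span z x -> in_span w x.
Proof. by move=> zw [a ->]; apply: in_span_sum => i _; apply: in_spanZ. Qed.

Lemma in_span_mul (I J Q : finType) (z : I -> E) (w : J -> E) (y : Q -> E) a b :
  (forall i j, in_span y (z i * w j)) -> in_span z a -> in_span w b ->
  in_span y (a * b).
Proof.
move=> zwy [c ->] [d ->]; rewrite big_distrlr /=; apply: in_span_sum => i _.
apply: in_span_sum => j _; rewrite mulrACA -rmorphM; exact: in_spanZ.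
Qed.

Lemma free_span_card (I J : finType) (w : I -> E) (z : J -> E) :
  free_fam w -> (forall i, in_span z (w i)) -> (#|I| <= #|J|)%N.
Proof.
move=> w_free /choice[c wE]; rewrite leqNgt; apply/negP => JI.
have [u u0 uC] := row_dependent (\matrix_(i < #|I|, j < #|J|)
  c (enum_val i) (enum_val j)) JI.
case/rV0Pn: u0 => i /eqP[].
have := w_free (fun x => u 0 (enum_rank x)) _ (enum_val i).
rewrite enum_valK; apply.
under eq_bigr => x _ do rewrite wE mulr_sumr.
rewrite exchange_big big1 // => y _.
transitivity (f (\sum_x u 0 (enum_rank x) * c x y) * z y).
  by rewrite rmorph_sum mulr_suml; apply: eq_bigr => x _; rewrite rmorphM mulrA.
move/rowP/(_ (enum_rank y)): uC; rewrite !mxE.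
rewrite (reindex (@enum_rank I)) /=; last by apply: onW_bij; apply: enum_rank_bij.
under eq_bigr => x _ do rewrite mxE !enum_rankK.
by move=> ->; rewrite rmorph0 mul0r.
Qed.

Lemma span_basis (I : finType) (z : I -> E) :
  exists (D : nat) (s : 'I_D -> I), free_fam (z \o s) /\
    forall x, in_span (z \o s) x <-> in_span z x.
Proof.
pose gen D := `[< exists s : 'I_D -> I, forall i, in_span (z \o s) (z i) >].
have ex_gen : exists D, gen D.
  exists #|I|; apply/asboolP; exists enum_val => i.
  by rewrite -[i]enum_rankK; exact: (in_span_gen (z \o enum_val)).
case: (ex_minnP ex_gen) => D /asboolP[s zs] D_min.
exists D, s; split; last first.
  by move=> x; split; apply: in_span_trans => // i; apply: (in_span_gen z).
case: D s zs D_min => [|D] s zs D_min a a0 i; first by case: i.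
apply/eqP; apply: contraT => ai0; suff: (D.+1 <= D)%N by rewrite ltnn.
apply: D_min; apply/asboolP; exists (s \o lift i) => i'.
apply: in_span_trans (zs i') => l.
case: (unliftP i l) => [l' ->|->]; first exact: (in_span_gen (z \o (s \o lift i))).
have -> : (z \o s) i = \sum_j f (- (a (lift i j) / a i)) * (z \o (s \o lift i)) j.
  apply: (mulfI (_ : f (a i) != 0)); first by rewrite fmorph_eq0.
  apply/eqP; rewrite -subr_eq0; apply/eqP; rewrite -[RHS]a0 (bigD1_ord i) //=.
  congr (_ + _); rewrite mulr_sumr -sumrN; apply: eq_bigr => j _.
  by rewrite mulrA -rmorphM mulrN mulrCA mulfV // mulr1 rmorphN mulNr opprK.
by exists (fun j => - (a (lift i j) / a i)).
Qed.

Lemma ring_spanX (I : finType) (z : I -> E) x n :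
  ring_span z -> in_span z x -> in_span z (x ^+ n).
Proof.
case=> z1 zM zx; elim: n => [|n IHn]; rewrite ?expr0 ?exprS //; exact: zM.
Qed.

Lemma integral_deg_gt0 b n : integral_deg b n -> (0 < n)%N.
Proof.
case: n => // -[a]; rewrite big_ord0 expr0 => /eqP.
by rewrite oner_eq0.
Qed.

Lemma integral_pow b n l : integral_deg b n ->
  in_span (fun i : 'I_n => b ^+ i) (b ^+ l).
Proof.
move=> bn; have n0 := integral_deg_gt0 bn; elim: l => [|l [a lE]].
  exact: (in_span_gen (fun i : 'I_n => b ^+ i) (Ordinal n0)).
rewrite exprS lE mulr_sumr; apply: in_span_sum => i _; rewrite mulrCA -exprS.
apply: in_spanZ; have := ltn_ord i; rewrite leq_eqVlt => /orP[/eqP-> //|lt_in].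
exact: (in_span_gen (fun i : 'I_n => b ^+ i) (Ordinal lt_in)).
Qed.

Lemma ring_span_adjoin (I : finType) (z : I -> E) b n :
  ring_span z -> integral_deg b n ->
  let z' (q : I * 'I_n) := z q.1 * b ^+ q.2 in
  [/\ ring_span z', in_span z' b & forall x, in_span z x -> in_span z' x].
Proof.
move=> [z1 zM] bn z'; have n0 := integral_deg_gt0 bn.
have zb x l : in_span z x -> in_span z' (x * b ^+ l).
  move=> zx; apply: (in_span_mul _ zx (integral_pow l bn)) => i j.
  exact: (in_span_gen z' (i, j)).
have zz' x : in_span z x -> in_span z' x by move=> /(zb _ 0%N); rewrite mulr1.
split=> //; last by rewrite -[b]mul1r -[b in _ * b]expr1; apply: zb.
split=> [|x y zx zy]; first exact: zz'.
apply: (in_span_mul _ zx zy) => -[i j] [i' j'] /=.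
by rewrite mulrACA -exprD; apply: zb; apply: zM; apply: in_span_gen.
Qed.

(** The cardinality is recorded because [frac_field_span] adjoins r elements of degree p and needs
    exactly p^r generators. *)
Lemma ring_span_adjoin_seq (bs : seq (E * nat)) :
  (forall q, q \in bs -> integral_deg q.1 q.2) ->
  exists (I : finType) (z : I -> E), [/\ #|I| = \prod_(q <- bs) q.2,
    ring_span z & forall q, q \in bs -> in_span z q.1].
Proof.
elim: bs => [|[b n] bs IHbs] bsP.
  exists unit, (fun=> 1); split=> //; first by rewrite big_nil card_unit.
  have sE x : in_span (fun _ : unit => 1) x <-> exists a, x = f a.
    have big_tt (g : unit -> E) : \sum_i g i = g tt.
      by rewrite (bigD1 tt) //= big1 ?addr0 // => -[].
    by split=> [[a ->]|[a ->]]; [exists (a tt) | exists (fun=> a)];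
       rewrite big_tt mulr1.
  split; first by apply/sE; exists 1; rewrite rmorph1.
  by move=> x y /sE[a ->] /sE[c ->]; apply/sE; exists (a * c); rewrite rmorphM.
have [|I [z [cI zr zb]]] := IHbs.
  by move=> q qbs; apply: bsP; rewrite inE qbs orbT.
have bn : integral_deg b n by apply: (bsP (b, n)); rewrite inE eqxx.
have [z'r z'b zz'] := ring_span_adjoin zr bn.
eexists; eexists; split; [|exact: z'r|].
  by rewrite big_cons card_prod card_ord cI mulnC.
by move=> q; rewrite inE => /orP[/eqP-> //|/zb/zz'].
Qed.

End Span.

Section FractionSubfield.
Variables (k E : fieldType) (i : {rmorphism k -> E}) (r : nat) (u : 'I_r -> E).

Definition frac_of (x : E) : Prop :=
  exists P Q : {mpoly k[r]}, mmap i u Q != 0 /\ x = mmap i u P / mmap i u Q.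

Lemma frac_of_poly P : frac_of (mmap i u P).
Proof. by exists P, 1; rewrite rmorph1 oner_eq0 divr1. Qed.

Fact frac_of1 : frac_of 1.
Proof. by rewrite -(rmorph1 (mmap i u)); apply: frac_of_poly. Qed.
Fact frac_ofB x y : frac_of x -> frac_of y -> frac_of (x - y).
Proof.
case=> [P [Q [Q0 ->]]] [P' [Q' [Q'0 ->]]]; exists (P * Q' - P' * Q), (Q * Q').
rewrite rmorphB !rmorphM mulf_neq0 //; split=> //.
by rewrite -[X in _ + X = _]mulNr addf_div // mulNr.
Qed.
Fact frac_ofV x y : frac_of x -> frac_of y -> frac_of (x / y).
Proof.
case=> [P [Q [Q0 ->]]] [P' [Q' [Q'0 ->]]].
have [P'0|P'0] := eqVneq (mmap i u P') 0.
  by rewrite P'0 mul0r invr0 mulr0 -(rmorph0 (mmap i u)); apply: frac_of_poly.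
exists (P * Q'), (Q * P'); rewrite !rmorphM mulf_neq0 //; split=> //.
by rewrite invf_div mulf_div.
Qed.
Definition frac_field := SubfieldPred frac_of1 frac_ofB frac_ofV.

Lemma frac_field_min (K : subfield_pred E) :
  (forall c, K (i c)) -> (forall n, K (u n)) -> forall x, frac_field x -> K x.
Proof.
move=> Kk Ku; have KP P : K (mmap i u P).
  apply: sfp_sum => e _; apply: sfpM => //.
  by rewrite /mmap1; elim/big_ind: _ => [|x y|n _]; [exact: sfp1|exact: sfpM|exact: sfpX].
by move=> x [P [Q [_ ->]]]; apply: sfpV.
Qed.

Lemma frac_field_str c : frac_field (i c).
Proof. by have := frac_of_poly c%:MP; rewrite mmapC. Qed.
Lemma frac_field_var n : frac_field (u n).
Proof. by have := frac_of_poly 'X_n; rewrite mmapX mmap1U. Qed.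
End FractionSubfield.

Section FrobeniusCount.
Variables (k : fieldType) (p : nat) (chp : p \in [pchar k]).
Variables (E : fieldType) (i : {rmorphism k -> E}).
Hypothesis frob_free : forall (N : nat) (v : 'I_N -> E) (c : 'I_N -> k),
  \sum_l i (c l) * v l ^+ p = 0 -> (exists l, c l != 0) ->
  exists d : 'I_N -> k, (exists l, d l != 0) /\ \sum_l i (d l) * v l = 0.

Let p_gt0 : (0 < p)%N := prime_gt0 (pcharf_prime chp).

Fact frob_sum_field (I : Type) (s : seq I) (P : pred I) (g : I -> E) :
  (\sum_(l <- s | P l) g l) ^+ p = \sum_(l <- s | P l) g l ^+ p.
Proof.
have chE : p \in [pchar E] by rewrite (fmorph_pchar i).
exact: (rmorph_sum (pFrobenius_aut chE) s P g).
Qed.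

Lemma frob_free_fin (I : finType) (v : I -> E) (c : I -> k) :
  \sum_l i (c l) * v l ^+ p = 0 -> (exists l, c l != 0) ->
  exists d : I -> k, (exists l, d l != 0) /\ \sum_l i (d l) * v l = 0.
Proof.
move=> cv [l cl].
have [||d [[n dn] dv]] := @frob_free #|I| (fun n => v (enum_val n)) (fun n => c (enum_val n)).
- by rewrite -[RHS]cv [RHS](reindex (@enum_val I I)) //; apply: onW_bij; apply: enum_val_bij.
- by exists (enum_rank l); rewrite enum_rankK.
exists (fun l => d (enum_rank l)); split.
  by exists (enum_val n); rewrite enum_valK.
rewrite -[RHS]dv (reindex (@enum_val I I)); last by apply: onW_bij; apply: enum_val_bij.
by apply: eq_bigr => n' _; rewrite enum_valK.
Qed.

Section Generators.
Variables (r : nat) (u : 'I_r -> E).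
Local Notation F := (frac_field i u).
Local Notation F' := (frac_field i (fun n => u n ^+ p)).

Lemma frac_field_frob x : F x -> F' (x ^+ p).
Proof.
have FP P : F' (mmap i u P ^+ p).
  rewrite /mmap frob_sum_field; apply: sfp_sum => e _.
  rewrite exprMn -rmorphXn; apply: sfpM; first exact: frac_field_str.
  rewrite /mmap1 -prodrXl; elim/big_ind: _ => [|x' y|n _]; [exact: sfp1|exact: sfpM|].
  by rewrite exprAC; apply: sfpX; apply: (frac_field_var i (fun n => u n ^+ p)).
by case=> P [Q [_ ->]]; rewrite expr_div_n; apply: sfpV.
Qed.

Lemma frac_field_span : exists (J : finType) (w : J -> E),
  #|J| = (p ^ r)%N /\ forall x, F x -> in_span (sf_inj F') w x.
Proof.
have int_u n : integral_deg (sf_inj F') (u n) p.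
  have /sf_lift[y yE] : F' (u n ^+ p) by apply: (frac_field_var i (fun n => u n ^+ p)).
  rewrite /integral_deg -yE -[sf_inj _ y]mulr1; apply: in_spanZ.
  exact: (in_span_gen _ (fun l : 'I_p => u n ^+ l) (Ordinal p_gt0)).
have [|J [w [cJ wr wu]]] := @ring_span_adjoin_seq _ _ (sf_inj F') [seq (u n, p) | n <- enum 'I_r].
  by move=> q /mapP[n _ ->]; apply: int_u.
exists J, w; split.
  by rewrite cJ big_map big_enum /= prod_nat_const card_ord.
have wF' x : F' x -> in_span (sf_inj F') w x.
  by move=> /sf_lift[y <-]; rewrite -[sf_inj _ y]mulr1; apply: in_spanZ; exact: wr.1.
have wP P : in_span (sf_inj F') w (mmap i u P).
  apply: in_span_sum => e _; apply: wr.2; first by apply: wF'; apply: frac_field_str.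
  rewrite /mmap1; elim/big_ind: _ => [|x y|n _]; [exact: wr.1|exact: wr.2|].
  apply: ring_spanX => //; apply: (wu (u n, p)); apply/mapP; exists n => //.
  by rewrite mem_enum.
move=> x [P [Q [Q0 ->]]].
(* The denominator becomes Q^p, which lies in k(u^p); the numerator P Q^(p-1) is a polynomial in
   u. *)
have -> : mmap i u P / mmap i u Q =
    mmap i u P * (mmap i u Q ^+ p.-1 * (mmap i u Q ^+ p)^-1).
  congr (_ * _); apply: (mulIf (expf_neq0 p Q0)); rewrite divfK ?expf_neq0 //.
  by rewrite -{1}(prednK p_gt0) exprS mulKf.
apply: wr.2; first exact: wP; apply: wr.2; first exact: ring_spanX.
by apply: wF'; apply: sfp_inv; apply: frac_field_frob; exists Q, 1;
   rewrite rmorph1 oner_eq0 divr1.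
Qed.

Hypothesis u_free : alg_independent i u.

(** Cleared of denominators, a relation over k(u^p) between the e_n^p is a k-linear relation between
    p-th powers of products u^g e_n. Separability gives a relation between these products
    themselves, that is, one over k(u) between the e_n; it is nontrivial because u is algebraically
    independent. *)
Lemma frac_field_frob_free (D : nat) (e : 'I_D -> E) :
  free_fam (sf_inj F) e -> free_fam (sf_inj F') (fun n => e n ^+ p).
Proof.
move=> e_free c ce.
have [P [Q [Q0 PQ]]] : exists (P : 'I_D -> {mpoly k[r]}) (Q : {mpoly k[r]}),
    mmap i (fun n => u n ^+ p) Q != 0 /\ forall n, sf_inj F' (c n) *
      mmap i (fun n => u n ^+ p) Q = mmap i (fun n => u n ^+ p) (P n).
  have /choice[num /choice[den nd]] : forall n, frac_of i (fun n => u n ^+ p) (sf_inj F' (c n)).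
    by move=> n; exact: (sf_valP (c n)).
  exists (fun n => num n * \prod_(l | l != n) den l), (\prod_l den l); split.
    rewrite rmorph_prod prodf_seq_neq0; apply/allP => l _ /=; exact: (nd l).1.
  move=> n; have [d0 ->] := nd n.
  by rewrite (bigD1 n) //= !rmorphM /= mulrA divfK.
suff P0 n : P n = 0.
  move=> n; have := PQ n; rewrite P0 rmorph0 => /eqP; rewrite mulf_eq0 (negPf Q0) orbF.
  by rewrite fmorph_eq0 => /eqP.
apply/eqP; apply: contraT => /eqP Pn0; exfalso.
pose b := \max_l msize (P l).
have bP l : (msize (P l) <= b)%N by apply: (leq_bigmax l).
pose I := ('I_D * 'X_{1..r < b})%type.
pose v (q : I) := mmap1 u q.2 * e q.1.
have mm1 (g : 'X_{1..r}) : mmap1 (fun n => u n ^+ p) g = mmap1 u g ^+ p.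
  by rewrite /mmap1 -prodrXl; apply: eq_bigr => l _; rewrite exprAC.
have [||d [[q dq] dv]] := @frob_free_fin I v (fun q => (P q.1)@_q.2).
- transitivity (\sum_l mmap i (fun n => u n ^+ p) (P l) * e l ^+ p); last first.
    transitivity (mmap i (fun n => u n ^+ p) Q * \sum_l sf_inj F' (c l) * e l ^+ p).
      by rewrite mulr_sumr; apply: eq_bigr => l _; rewrite -PQ mulrA [_ * sf_inj _ _]mulrC.
    by rewrite ce mulr0.
  rewrite -(pair_big xpredT xpredT (fun l (g : 'X_{1..r < b}) => i (P l)@_g * (mmap1 u g * e l) ^+ p)) /=.
  apply: eq_bigr => l _; rewrite (mmapE b) // mulr_suml.
  by apply: eq_bigr => g _; rewrite exprMn mm1 mulrA.
- have [g gP] : exists g, (P n)@_g != 0.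
    apply/not_existsP => P0; apply: Pn0; apply/mpolyP => g; rewrite mcoeff0.
    by apply/eqP; apply: contraT => /P0.
  have gb : (mdeg g < b)%N.
    by apply: leq_trans (bP n); apply: msize_mdeg_lt; rewrite mcoeff_msupp.
  by exists (n, BMultinom gb).
pose Dp l : {mpoly k[r]} := \sum_(g : 'X_{1..r < b}) d (l, g) *: 'X_[g].
have DpE l : mmap i u (Dp l) = \sum_(g : 'X_{1..r < b}) i (d (l, g)) * mmap1 u g.
  by rewrite rmorph_sum; apply: eq_bigr => g _; rewrite /= mmapZ mmapX.
have /choice[a aE] l : exists y, sf_inj F y = mmap i u (Dp l).
  by apply: sf_lift; apply: frac_of_poly.
have a0 : forall l, a l = 0.
  apply: e_free; rewrite -[RHS]dv.
  transitivity (\sum_l \sum_(g : 'X_{1..r < b}) i (d (l, g)) * v (l, g)); last first.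
    by rewrite pair_big; apply: eq_bigr => -[].
  apply: eq_bigr => l _; rewrite aE DpE mulr_suml.
  by apply: eq_bigr => g _; rewrite mulrA.
have : Dp q.1 = 0 by apply: u_free; rewrite -aE a0 rmorph0.
move/(congr1 (mcoeff q.2)); rewrite mcoeff0 raddf_sum /= (bigD1 q.2) //=.
rewrite mcoeffZ mcoeffX eqxx mulr1 big1 ?addr0 => [|g gq]; last first.
  by rewrite mcoeffZ mcoeffX (_ : (_ == _) = false) ?mulr0 //; apply: negPf.
by rewrite -surjective_pairing => d0; rewrite d0 eqxx in dq.
Qed.

End Generators.

Variable K : subfield_pred E.
Hypotheses (kK : forall c, K (i c)) (EpK : forall x, K (x ^+ p)).
Variables (L : fieldType) (iL : {rmorphism k -> L}) (j : {rmorphism L -> E}).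
Hypothesis jiL : forall c, j (iL c) = i c.

Lemma frobenius_count (r : nat) (N : nat) (a : 'I_N -> E) :
  is_trdeg iL r -> free_fam (sf_inj K) a -> (forall n, exists y, a n ^+ p = j y) ->
  (N <= p ^ r)%N.
Proof.
case=> t [t_free t_alg] a_free aL.
pose u n := j (t n).
have mmapj P : j (mmap iL t P) = mmap i u P.
  pose g1 : {rmorphism {mpoly k[r]} -> E} := j \o mmap iL t.
  pose g2 : {rmorphism {mpoly k[r]} -> E} := mmap i u.
  apply: (mpoly_ext (f := g1) (g := g2)) => [c|n] /=; first by rewrite !mmapC jiL.
  by rewrite !mmapX !mmap1U.
have u_free : alg_independent i u.
  move=> P; rewrite -mmapj => /eqP; rewrite fmorph_eq0 => /eqP; exact: t_free.
pose F := frac_field i u; pose F' := frac_field i (fun n => u n ^+ p).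
have a_int n : exists d, integral_deg (sf_inj F) (a n) d.
  have [y ay] := aL n; have [q [q0 qF /rootP qy]] := t_alg y.
  have lq0 : lead_coef q != 0 by rewrite lead_coef_eq0.
  (* The element y = a_n^p satisfies an equation of degree d over k(t), so a_n satisfies one of
     degree p d over k(u). *)
  pose d := (size q).-1; exists (p * d)%N.
  have Fq l : F (j q`_l).
    have [P [Q [Q0 ->]]] := qF l; exists P, Q.
    rewrite fmorph_div !mmapj; split=> //; rewrite -mmapj fmorph_eq0; exact/eqP.
  have yd : a n ^+ (p * d) = \sum_(l < d) j (- q`_l / lead_coef q) * a n ^+ (p * l).
    rewrite exprM ay -rmorphXn; transitivity (j (\sum_(l < d) (- q`_l / lead_coef q) * y ^+ l)).
      congr (j _); apply: (mulfI lq0); apply/eqP; rewrite -subr_eq0; apply/eqP.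
      rewrite -[RHS]qy horner_coef (_ : size q = d.+1); last first.
        by rewrite prednK // lt0n size_poly_eq0.
      rewrite big_ord_recr /= addrC; congr (_ + _).
      rewrite mulr_sumr -sumrN; apply: eq_bigr => l _.
      by rewrite mulrA mulrCA mulfV // mulr1 mulNr opprK.
    by rewrite rmorph_sum; apply: eq_bigr => l _; rewrite rmorphM rmorphXn exprM ay.
  rewrite /integral_deg yd; apply: in_span_sum => l _.
  have /sf_lift[c <-] : F (j (- q`_l / lead_coef q)).
    by rewrite fmorph_div rmorphN; apply: sfpV; [apply: sfpN|]; apply: Fq.
  apply: in_spanZ; have pl : (p * l < p * d)%N by rewrite ltn_pmul2l.
  exact: (in_span_gen _ (fun l : 'I_(p * d) => a n ^+ l) (Ordinal pl)).
have [d a_d] := choice a_int.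
have [|I [z [_ zr za]]] := @ring_span_adjoin_seq _ _ (sf_inj F) [seq (a n, d n) | n <- enum 'I_N].
  by move=> q /mapP[n _ ->]; apply: a_d.
have {}za n : in_span (sf_inj F) z (a n).
  by apply: (za (a n, d n)); apply/mapP; exists n; rewrite ?mem_enum.
have [D [s [e_free ez]]] := span_basis (sf_inj F) z; pose e := z \o s.
have [J [w [cJ wF]]] := frac_field_span u.
have ep_free := frac_field_frob_free u_free e_free.
have FK x : F' x -> K x.
  by apply: frac_field_min => // n; apply: EpK.
(* The products a_n e_l^p are independent over k(u^p): grouped by n, their coefficients lie in K,
   over which the a_n are free. *)
have : (#|{: 'I_N * 'I_D}| <= #|{: J * 'I_D}|)%N.
  apply: (@free_span_card _ _ (sf_inj F') _ _ (fun q : 'I_N * 'I_D => a q.1 * e q.2 ^+ p)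
    (fun q : J * 'I_D => w q.1 * e q.2)).
    move=> c ca [n l].
    have /choice[b bE] n' : exists y, sf_inj K y = \sum_l sf_inj F' (c (n', l)) * e l ^+ p.
      apply: sf_lift; apply: sfp_sum => l' _; apply: sfpM => //.
      by apply: FK; exact: (sf_valP (c (n', l'))).
    suff b0 n' : b n' = 0.
      by apply: (ep_free (fun l => c (n, l))); rewrite -bE b0 rmorph0.
    apply: a_free; rewrite -[RHS]ca.
    transitivity (\sum_n \sum_l sf_inj F' (c (n, l)) * (a n * e l ^+ p)); last first.
      by rewrite pair_big; apply: eq_bigr => -[].
    by apply: eq_bigr => n1 _; rewrite bE mulr_suml; apply: eq_bigr => l' _; ring.
  move=> [n l] /=.
  have /ez : in_span (sf_inj F) z (a n * e l ^+ p).
    apply: zr.2 => //; apply: ring_spanX => //; exact: (in_span_gen _ z).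
  case=> c ->; apply: in_span_sum => l' _.
  have [g ->] : in_span (sf_inj F') w (sf_inj F (c l')) := wF _ (sf_valP (c l')).
  rewrite mulr_suml; apply: in_span_sum => l1 _; rewrite -mulrA; apply: in_spanZ.
  exact: (in_span_gen _ (fun q : J * 'I_D => w q.1 * e q.2) (l1, l')).
rewrite !card_prod !card_ord cJ leq_pmul2r //.
(* D can be cancelled: it is positive since 1 lies in the span. *)
case: (D) s @e e_free ez ep_free => // s e _ /(_ 1)[_ /(_ zr.1)[c]] /eqP.
by rewrite big_ord0 oner_eq0.
Qed.

End FrobeniusCount.

(** * Separating functionals, the bicommutant and descent of p-th powers *)

Section SeparatingFunctional.
Variables (L : fieldType) (A : comPzRingType) (f : {rmorphism L -> A}) (c : A).
Hypotheses (A1 : (1 : A) <> 0) (cL : forall l, f l <> c).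

Let subspace (W : A -> Prop) : Prop :=
  [/\ W 0, forall x y, W x -> W y -> W (x + y), forall l x, W x -> W (f l * x),
      forall l, W (f l) & ~ W c].

Let scalars (x : A) : Prop := exists l, f l = x.

Let scalars_subspace : subspace scalars.
Proof.
split=> [|x y [l <-] [l' <-]|l x [l' <-]|l|[l /cL//]].
- by exists 0; rewrite rmorph0.
- by exists (l + l'); rewrite rmorphD.
- by exists (l * l'); rewrite rmorphM.
by exists l.
Qed.

Lemma maximal_subspace : exists W : A -> Prop,
  subspace W /\ forall W', subspace W' -> (forall x, W x -> W' x) -> forall x, W' x -> W x.
Proof.
pose T := {W : A -> Prop | subspace W}.
pose R (U V : T) := `[< forall x, sval U x -> sval V x >].
have [||S T' |chain tot|W Wmax] := @classical_sets.Zorn T R.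
- by move=> U; apply/asboolP.
- by move=> U V W /asboolP UV /asboolP VW; apply/asboolP=> x /UV/VW.
- move=> /asboolP ST /asboolP TS; case: S ST TS => S Sp; case: T' => T' T'p /= ST TS.
  have E : S = T' by apply: funext => x; apply: propext; split; [apply: ST | apply: TS].
  by subst T'; congr exist; apply: Prop_irrelevance.
- have [[U0 cU0]|chain0] := pselect (exists U, chain U); last first.
    by exists (exist _ _ scalars_subspace) => U cU; case: chain0; exists U.
  pose M x := exists U : T, chain U /\ sval U x.
  have Mp : subspace M.
    split.
    - by exists U0; split=> //; case: (svalP U0).
    - move=> x y [U [cU Ux]] [V [cV Vy]].
      case: (tot U V cU cV) => /asboolP UV.
        by exists V; split=> //; case: (svalP V) => _ VD _ _ _; apply: VD => //; apply: UV.
      by exists U; split=> //; case: (svalP U) => _ UD _ _ _; apply: UD => //; apply: UV.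
    - move=> l x [U [cU Ux]]; exists U; split=> //.
      by case: (svalP U) => _ _ UZ _ _; apply: UZ.
    - by move=> l; exists U0; split=> //; case: (svalP U0).
    by case=> U [_ Uc]; case: (svalP U).
  exists (exist _ M Mp) => U cU; apply/asboolP => x Ux /=.
  by exists U.
exists (sval W); split=> [|W' W'p WW' x W'x]; first exact: svalP.
have : R W (exist _ W' W'p) by apply/asboolP.
by move=> /Wmax <-.
Qed.

(** Modulo a maximal subspace W every x is a unique L-multiple of c, and lam x is the multiplier. *)
Lemma separating_functional : exists lam : A -> L,
  [/\ forall x y, lam (x + y) = lam x + lam y,
      forall l x, lam (f l * x) = l * lam x, lam 1 = 0 & lam c = 1].
Proof.
have [W [[W0 WD WZ Wf Wc] Wmax]] := maximal_subspace.
have WN x : W x -> W (- x) by move=> /(WZ (-1)); rewrite rmorphN1 mulN1r.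
have Wuniq x l l' : W (x - f l * c) -> W (x - f l' * c) -> l = l'.
  move=> /WN Wl Wl'; have := WD _ _ Wl' Wl.
  have -> : x - f l' * c + - (x - f l * c) = f (l - l') * c by rewrite rmorphB; ring.
  move=> Wll; apply/eqP; rewrite -subr_eq0; apply: contraT => ll'; case: Wc.
  by have := WZ (l - l')^-1 _ Wll; rewrite mulrA -rmorphM mulVf // rmorph1 mul1r.
have Wex x : exists l, W (x - f l * c).
  have [Wx|Wx] := pselect (W x); first by exists 0; rewrite rmorph0 mul0r subr0.
  (* W' is W + L x. If it contains c, the relation is solved for x; otherwise maximality puts x in
     W. *)
  pose W' y := exists w l, W w /\ y = w + f l * x.
  have [[w [l [Ww cE]]]|W'c] := pselect (W' c).
    have l0 : l != 0.
      by apply/eqP => l0; case: Wc; rewrite cE l0 rmorph0 mul0r addr0.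
    exists l^-1; have -> : x - f l^-1 * c = - (f l^-1 * w).
      rewrite {1}cE mulrDr mulrA -rmorphM mulVf // rmorph1 mul1r; ring.
    by apply: WN; apply: WZ.
  case: Wx; apply: (Wmax W').
  - split=> //.
    + by exists 0, 0; rewrite rmorph0 mul0r addr0.
    + move=> _ _ [w [l [Ww ->]]] [w' [l' [Ww' ->]]]; exists (w + w'), (l + l').
      by split; [exact: WD | rewrite rmorphD; ring].
    + move=> l _ [w [l' [Ww ->]]]; exists (f l * w), (l * l').
      by split; [exact: WZ | rewrite rmorphM; ring].
    by move=> l; exists (f l), 0; rewrite rmorph0 mul0r addr0.
  - by move=> w Ww; exists w, 0; rewrite rmorph0 mul0r addr0.
  by exists 0, 1; rewrite rmorph1 mul1r add0r.
have [lam lamP] := choice Wex; exists lam; split.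
- move=> x y; apply: (Wuniq (x + y)) => //.
  by have := WD _ _ (lamP x) (lamP y); congr W; rewrite rmorphD; ring.
- move=> l x; apply: (Wuniq (f l * x)) => //.
  by have := WZ l _ (lamP x); congr W; rewrite rmorphM; ring.
- by apply: (Wuniq 1) => //; rewrite rmorph0 mul0r subr0 -(rmorph1 f).
by apply: (Wuniq c) => //; rewrite rmorph1 mul1r subrr.
Qed.
End SeparatingFunctional.

(* The commuting left and right actions of A on Hom_L(A, A) factor through
   A (x)_L A; their bicommutant is a commutative ring that can play the role of
   this tensor product. *)
Section Bicommutant.
Variables (L : fieldType) (A : comPzRingType) (f : {rmorphism L -> A}).

Record lin_endo := LinEndo {
  le_fun :> A -> A;
  le_add : forall x y, le_fun (x + y) = le_fun x + le_fun y;
  le_lin : forall l x, le_fun (f l * x) = f l * le_fun x }.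

Lemma lin_endo_ext (u v : lin_endo) : u =1 v -> u = v.
Proof.
case: u v => [u u1 u2] [v v1 v2] /= /funext uv; subst v.
by congr LinEndo; apply: Prop_irrelevance.
Qed.

HB.instance Definition _ := gen_eqMixin lin_endo.
HB.instance Definition _ := gen_choiceMixin lin_endo.

Definition le_zero : lin_endo.
Proof. by refine (@LinEndo (fun=> 0) _ _) => *; rewrite ?addr0 ?mulr0. Defined.
Definition le_plus (u v : lin_endo) : lin_endo.
Proof.
by refine (@LinEndo (fun x => u x + v x) _ _) => *; rewrite ?le_add ?le_lin; ring.
Defined.
Definition le_opp (u : lin_endo) : lin_endo.
Proof. by refine (@LinEndo (fun x => - u x) _ _) => *; rewrite ?le_add ?le_lin; ring. Defined.

Fact le_plusA : associative le_plus.
Proof. by move=> u v w; apply: lin_endo_ext => x /=; rewrite addrA. Qed.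
Fact le_plusC : commutative le_plus.
Proof. by move=> u v; apply: lin_endo_ext => x /=; rewrite addrC. Qed.
Fact le_plus0 : left_id le_zero le_plus.
Proof. by move=> u; apply: lin_endo_ext => x /=; rewrite add0r. Qed.
Fact le_plusN : left_inverse le_zero le_opp le_plus.
Proof. by move=> u; apply: lin_endo_ext => x /=; rewrite addNr. Qed.
HB.instance Definition _ := GRing.isZmodule.Build lin_endo
  le_plusA le_plusC le_plus0 le_plusN.

Definition pre_act (a : A) (u : lin_endo) : lin_endo.
Proof.
refine (@LinEndo (fun x => u (a * x)) _ _) => [x y|l x].
  by rewrite mulrDr le_add.
by rewrite mulrCA le_lin.
Defined.
Definition post_act (a : A) (u : lin_endo) : lin_endo.
Proof.
refine (@LinEndo (fun x => a * u x) _ _) => [x y|l x].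
  by rewrite le_add mulrDr.
by rewrite le_lin mulrCA.
Defined.

Definition additive_op (t : lin_endo -> lin_endo) := forall u v, t (u + v) = t u + t v.
Definition commuting_op (t : lin_endo -> lin_endo) := [/\ additive_op t,
  forall a u, t (pre_act a u) = pre_act a (t u)
  & forall a u, t (post_act a u) = post_act a (t u)].

Record bicomm := Bicomm {
  bi_fun :> lin_endo -> lin_endo;
  bi_add : additive_op bi_fun;
  biP : forall t, commuting_op t -> forall u, bi_fun (t u) = t (bi_fun u) }.

Lemma bicomm_ext (s t : bicomm) : s =1 t -> s = t.
Proof.
case: s t => [u u1 u2] [v v1 v2] /= /funext uv; subst v.
by congr Bicomm; apply: Prop_irrelevance.
Qed.

HB.instance Definition _ := gen_eqMixin bicomm.
HB.instance Definition _ := gen_choiceMixin bicomm.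

Lemma additive_op0 t : additive_op t -> t 0 = 0.
Proof. by move=> tD; apply: (addrI (t 0)); rewrite -tD !addr0. Qed.
Lemma additive_opN t u : additive_op t -> t (- u) = - t u.
Proof.
by move=> tD; apply: (addrI (t u)); rewrite -tD !subrr additive_op0.
Qed.

Fact pre_act_commuting a : commuting_op (pre_act a).
Proof.
split=> [u v|b u|b u]; apply: lin_endo_ext => x //=.
by rewrite mulrCA.
Qed.
Fact post_act_commuting a : commuting_op (post_act a).
Proof.
split=> [u v|b u|b u]; apply: lin_endo_ext => x //=; first by rewrite mulrDr.
by rewrite mulrCA.
Qed.

(** As A is commutative, the operators of both actions commute with one another and so lie in the
    commutant. Hence the bicommutant commutes with them and is itself contained in the commutant,
    which makes it commutative. *)
Lemma bicomm_commuting (s : bicomm) : commuting_op s.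
Proof.
split; [exact: bi_add| |] => a u; apply: biP.
  exact: pre_act_commuting.
exact: post_act_commuting.
Qed.

Definition bi_zero : bicomm.
Proof.
refine (@Bicomm (fun=> 0) _ _) => [u v|t [tD _ _] u]; first by rewrite addr0.
by rewrite additive_op0.
Defined.
Definition bi_plus (s t : bicomm) : bicomm.
Proof.
refine (@Bicomm (fun u => s u + t u) _ _) => [u v|r rP u].
  by rewrite !bi_add addrACA.
by rewrite !(biP _ rP); case: rP => rD _ _; rewrite rD.
Defined.
Definition bi_opp (s : bicomm) : bicomm.
Proof.
refine (@Bicomm (fun u => - s u) _ _) => [u v|r rP u]; first by rewrite bi_add opprD.
by rewrite (biP _ rP); case: rP => rD _ _; rewrite additive_opN.
Defined.
Definition bi_one : bicomm.
Proof. by refine (@Bicomm id _ _). Defined.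
Definition bi_mul (s t : bicomm) : bicomm.
Proof.
refine (@Bicomm (s \o t) _ _) => [u v|r rP u] /=; first by rewrite !bi_add.
by rewrite !(biP _ rP).
Defined.

Fact bi_plusA : associative bi_plus.
Proof. by move=> u v w; apply: bicomm_ext => x /=; rewrite addrA. Qed.
Fact bi_plusC : commutative bi_plus.
Proof. by move=> u v; apply: bicomm_ext => x /=; rewrite addrC. Qed.
Fact bi_plus0 : left_id bi_zero bi_plus.
Proof. by move=> u; apply: bicomm_ext => x /=; rewrite add0r. Qed.
Fact bi_plusN : left_inverse bi_zero bi_opp bi_plus.
Proof. by move=> u; apply: bicomm_ext => x /=; rewrite addNr. Qed.
HB.instance Definition _ := GRing.isZmodule.Build bicomm
  bi_plusA bi_plusC bi_plus0 bi_plusN.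

Fact bi_mulA : associative bi_mul.
Proof. by move=> u v w; apply: bicomm_ext. Qed.
Fact bi_mulC : commutative bi_mul.
Proof.
by move=> s t; apply: bicomm_ext => u; exact: (biP s (bicomm_commuting t) u).
Qed.
Fact bi_mul1 : left_id bi_one bi_mul.
Proof. by move=> u; apply: bicomm_ext. Qed.
Fact bi_mulDl : left_distributive bi_mul +%R.
Proof. by move=> u v w; apply: bicomm_ext. Qed.
HB.instance Definition _ := GRing.Zmodule_isComPzRing.Build bicomm
  bi_mulA bi_mulC bi_mul1 bi_mulDl.

Definition bi_pre (a : A) : bicomm.
Proof.
refine (@Bicomm (pre_act a) _ _); first by case: (pre_act_commuting a).
by move=> t [_ tP _] u; rewrite tP.
Defined.
Definition bi_post (a : A) : bicomm.
Proof.
refine (@Bicomm (post_act a) _ _); first by case: (post_act_commuting a).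
by move=> t [_ _ tP] u; rewrite tP.
Defined.

Fact bi_pre_additive : nmod_morphism bi_pre.
Proof.
split=> [|a b]; apply: bicomm_ext => u; apply: lin_endo_ext => x /=.
  by have := le_lin u 0 0; rewrite rmorph0 !mul0r.
by rewrite mulrDl le_add.
Qed.
Fact bi_pre_multiplicative : monoid_morphism bi_pre.
Proof.
split=> [|a b]; apply: bicomm_ext => u; apply: lin_endo_ext => x /=.
  by rewrite mul1r.
by rewrite mulrA [b * a]mulrC.
Qed.
HB.instance Definition _ :=
  GRing.isNmodMorphism.Build A bicomm bi_pre bi_pre_additive.
HB.instance Definition _ :=
  GRing.isMonoidMorphism.Build A bicomm bi_pre bi_pre_multiplicative.

Fact bi_post_additive : nmod_morphism bi_post.
Proof.
split=> [|a b]; apply: bicomm_ext => u; apply: lin_endo_ext => x /=.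
  by rewrite mul0r.
by rewrite mulrDl.
Qed.
Fact bi_post_multiplicative : monoid_morphism bi_post.
Proof.
split=> [|a b]; apply: bicomm_ext => u; apply: lin_endo_ext => x /=.
  by rewrite mul1r.
by rewrite mulrA.
Qed.
HB.instance Definition _ :=
  GRing.isNmodMorphism.Build A bicomm bi_post bi_post_additive.
HB.instance Definition _ :=
  GRing.isMonoidMorphism.Build A bicomm bi_post bi_post_multiplicative.

Lemma bi_pre_post (l : L) : bi_pre (f l) = bi_post (f l).
Proof.
by apply: bicomm_ext => u; apply: lin_endo_ext => x /=; rewrite le_lin.
Qed.

(** The analogue of: c (x) 1 = 1 (x) c forces c into L. Otherwise take lam with lam(1) = 0 and
    lam(c) = 1; applied to the endomorphism f o lam and evaluated at 1, the two operators give 1 and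
    0. *)
Lemma bi_pre_post_eq (c : A) : (1 : A) <> 0 -> bi_pre c = bi_post c ->
  exists l, f l = c.
Proof.
move=> A1 cc; apply: contrapT => cL.
have [|lam [lamD lamZ lam1 lamc]] := @separating_functional L A f c.
  by move=> l lc; apply: cL; exists l.
have uD x y : f (lam (x + y)) = f (lam x) + f (lam y) by rewrite lamD rmorphD.
have uL l x : f (lam (f l * x)) = f l * f (lam x) by rewrite lamZ rmorphM.
have /(congr1 (fun s : bicomm => s (LinEndo uD uL) 1)) := cc.
by rewrite /= mulr1 lamc lam1 rmorph1 rmorph0 mulr0.
Qed.
End Bicommutant.

Lemma torsor_frob (k : fieldType) (p : nat) (chp : p \in [pchar k]) (G : gfunctor k)
    (heightG : height_one chp G) (L : fieldType) (iL : {rmorphism k -> L})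
    (Y : gspace G (CAlg iL)) (A : calg k) (u : Y A) :
  is_torsor Y -> (1 : A) <> 0 ->
  (forall (R : calg k) (x : Y R), exists! h : ahom A R, kf_map Y h u = x) ->
  forall a : A, exists l : L, gs_pr Y u l = a ^+ p.
Proof.
move=> [_ Y_act _] A1 uP a; pose f : {rmorphism L -> A} := gs_pr Y u.
apply: (bi_pre_post_eq (f := f)) => //.
pose pre : {rmorphism A -> bicomm f} := bi_pre f.
pose post : {rmorphism A -> bicomm f} := bi_post f.
pose R : calg k := @CAlg k (bicomm f) (pre \o calg_str A).
pose h1 : ahom A R := @AHom k A R pre (fun=> erefl).
(* Both actions induce the same structure of k-algebra because k acts through L. *)
have post_str c : post (calg_str A c) = calg_str R c.
  by rewrite -(ahomP (gs_pr Y u)) /= -(ahomP (gs_pr Y u)) /= bi_pre_post.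
pose h2 : ahom A R := @AHom k A R post post_str.
have [|g [gE _]] := Y_act R (kf_map Y h1 u) (kf_map Y h2 u).
  by rewrite !gs_pr_map; apply: ahom_ext => l /=; apply: bi_pre_post.
(* Frobenius sends g to 1, so the two points coincide after it; universality of u turns this into an
   equality of maps on A. *)
have : kf_map Y (frob_hom chp R) (kf_map Y h1 u) =
    kf_map Y (frob_hom chp R) (kf_map Y h2 u).
  rewrite -gE gs_act_map.
  by have := heightG R g; rewrite /rel_frob => ->; rewrite gs_act1.
rewrite -!kf_map_comp => fh.
have [h [_ hP]] := uP _ (kf_map Y (ahom_comp (frob_hom chp R) h1) u).
have := etrans (esym (hP _ erefl)) (hP _ (esym fh)); move=> /(congr1 (fun h : ahom _ _ => h a)) /=.
by rewrite /frob -!rmorphXn /= => ->.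
Qed.

(** * The generic torsor over the field of invariants *)

Lemma sf_corestrict (A : comPzRingType) (E : fieldType) (F : subfield_pred E)
    (f : {rmorphism A -> E}) : (forall a, F (f a)) ->
  exists g : {rmorphism A -> sf_type F}, forall a, sf_inj F (g a) = f a.
Proof.
move=> Ff; pose g a : sf_type F := SfType (introT (asboolP _) (Ff a)).
have gE a : val (g a) = f a by [].
have gD : nmod_morphism g.
  by split=> [|a b]; apply: val_inj; rewrite ?raddf0 ?raddfD /= ?rmorph0 ?rmorphD.
have gM : monoid_morphism g.
  by split=> [|a b]; apply: val_inj; rewrite ?rmorph1 ?rmorphM /= ?rmorph1 ?rmorphM.
pose Aa := GRing.isNmodMorphism.Build _ _ g gD.
pose Am := GRing.isMonoidMorphism.Build _ _ g gM.
by exists (HB.pack g Aa Am : {rmorphism _ -> _}).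
Qed.

Section GenericTorsor.
Variables (k : fieldType) (G : gfunctor k) (C : coords G).
Hypothesis commG : commutative_gf G.
Variables (p : nat) (chp : p \in [pchar k]).
Hypothesis heightG : height_one chp G.
Local Notation m := (cdim C).
Local Notation mu := (cmul C).
Local Notation vec := (@vec k G C _).
Local Notation c := (@comul k G C).
Local Notation gD := (dual_scons C commG).
Local Notation dvec := (@dvec k G C commG _).

Lemma height_one_vec (R : calg k) (x : G R) l :
  vec x l ^+ p = calg_str R (counit l ^+ p).
Proof.
have := congr1 (fun y : G (twist chp R) => vec y l) (heightG x).
by rewrite /rel_frob vec_map => e; rewrite [LHS]e; exact: (vec1 (twist chp R) l).
Qed.

Definition salg_counit (R : calg k) : ahom (salg R mu) R :=
  clift C (ahom_id R) (gone G R).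

(** In height one each e_l^p is the constant e_l(1)^p, so t^p only depends on the value of t at the
    identity. *)
Lemma salg_pth_power (R : calg k) (t : salg R mu) :
  t ^+ p = salg_in R mu (salg_counit R t ^+ p).
Proof.
rewrite {1}[t]salg_decomp (frob_sum chp) cliftE (frob_sum chp) rmorph_sum.
apply: eq_bigr => l _; rewrite !exprMn -vec_upt height_one_vec vec1.
by rewrite rmorphM !rmorphXn; congr (_ * _ ^+ p).
Qed.

Variable E : generic_field k m.
Local Notation cE := (CAlg (gf_str E)).
Local Notation TE := (salg cE mu).
Local Notation Xg i := (gf_poly E 'X_i).

(** The comultiplication of e_i with its first factor e_j replaced by the variable X_j, so that the
    X_i span a copy of the regular representation. *)
Definition generic_vec (i : 'I_m) : TE :=
  smk cE mu (fun l => \sum_j gf_str E (c i j l) * Xg j).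

Lemma counit_generic_vec i : salg_counit cE (generic_vec i) = Xg i.
Proof.
rewrite cliftE.
under eq_bigr => l _ do rewrite /= scoK vec1 mulr_suml.
rewrite exchange_big (bigD1 i) //= [X in _ + X]big1 ?addr0 => [|j ji].
  under eq_bigr => l _ do rewrite mulrAC -rmorphM comulC //.
  by rewrite -mulr_suml -rmorph_sum counitl eqxx rmorph1 mul1r.
under eq_bigr => l _ do rewrite mulrAC -rmorphM comulC //.
by rewrite -mulr_suml -rmorph_sum counitl eq_sym (negPf ji) rmorph0 mul0r.
Qed.

Lemma TE_neq0 : (1 : TE) <> 0.
Proof.
move/(congr1 (salg_counit cE)); rewrite rmorph1 rmorph0 => /eqP.
by rewrite oner_eq0.
Qed.

(** Followed by the counit, the coaction on polynomials is the inclusion in E. The image of P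
    nonzero therefore has a nonzero value at the identity, and its p-th power is an invertible
    scalar by [salg_pth_power]. *)
Lemma coaction_exists : exists r : ahom cE TE, forall i, r (Xg i) = generic_vec i.
Proof.
have [f0 [fC fX]] := mpoly_lift generic_vec TE_neq0.
have f0E P : salg_counit cE (f0 P) = gf_poly E P.
  pose g : {rmorphism {mpoly k[m]} -> E} := salg_counit cE \o f0.
  apply: (mpoly_ext (f := g) (g := gf_poly E)) => [a|i].
    rewrite gf_polyC; transitivity (salg_counit cE (f0 a%:MP)) => //.
    by rewrite fC; exact: (ahomP (salg_counit cE)).
  by transitivity (salg_counit cE (f0 'X_i)); rewrite // fX counit_generic_vec.
have [|r rP] := @gf_lift _ _ E TE f0 fC.
  move=> P P0; have E0 : gf_poly E P ^+ p != 0.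
    by rewrite expf_neq0 //; apply: contraNneq P0 => /gf_poly_inj ->.
  exists (f0 P ^+ p.-1 * salg_in cE mu ((gf_poly E P ^+ p)^-1)).
  rewrite mulrA -exprS prednK ?prime_gt0 ?(pcharf_prime chp) //.
  by rewrite salg_pth_power f0E -rmorphM mulfV // rmorph1.
by exists r => i; rewrite rP fX.
Qed.

Definition coaction : ahom cE TE := projT1 (cid coaction_exists).
Local Notation rho := coaction.

Lemma coactionX i l : sco (rho (Xg i)) l = \sum_j gf_str E (c i j l) * Xg j.
Proof. by rewrite /coaction; case: cid => r rX /=; rewrite rX scoK. Qed.

Definition gen_act (R : calg k) (g : G R) (y : ahom cE R) : ahom cE R :=
  ahom_comp (clift C y g) rho.

Lemma gen_actE (R : calg k) (g : G R) (y : ahom cE R) b :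
  gen_act g y b = \sum_l y (sco (rho b) l) * vec g l.
Proof. by []. Qed.

(** This embeds the R-points of Spec E in R (x) D. By [gen_vec_act] the action of g becomes
    multiplication by [dvec g], so the action axioms follow from ring identities. *)
Definition gen_vec (R : calg k) (y : ahom cE R) : salg R gD :=
  smk R gD (fun i => y (Xg i)).

Lemma gen_vec_inj (R : calg k) (y z : ahom cE R) : gen_vec y = gen_vec z -> y = z.
Proof.
move=> yz; apply: gf_ext => i.
by have := congr1 (fun t => sco t i) yz; rewrite !scoK.
Qed.

Lemma gen_vec_act (R : calg k) (g : G R) (y : ahom cE R) :
  gen_vec (gen_act g y) = gen_vec y * dvec g.
Proof.
apply: sco_ext => i; rewrite scoK gen_actE scoM exchange_big.
apply: eq_bigr => l _; rewrite coactionX rmorph_sum mulr_suml.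
apply: eq_bigr => j _; rewrite rmorphM !scoK.
have -> : y (gf_str E (c i j l)) = calg_str R (c i j l) by exact: (ahomP y).
by rewrite /=; ring.
Qed.

Lemma gen_act1 (R : calg k) (y : ahom cE R) : gen_act (gone G R) y = y.
Proof. by apply: gen_vec_inj; rewrite gen_vec_act dvec1 mulr1. Qed.

Lemma gen_actM (R : calg k) (g h : G R) (y : ahom cE R) :
  gen_act (gmul g h) y = gen_act g (gen_act h y).
Proof.
by apply: gen_vec_inj; rewrite !gen_vec_act dvecM -mulrA [dvec h * _]mulrC.
Qed.

Lemma gen_act_map (R S : calg k) (f : ahom R S) (g : G R) (y : ahom cE R) :
  ahom_comp f (gen_act g y) = gen_act (kf_map G f g) (ahom_comp f y).
Proof.
apply: ahom_ext => b; rewrite [LHS]/= !gen_actE rmorph_sum.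
by apply: eq_bigr => l _; rewrite rmorphM vec_map.
Qed.

Definition invariant (b : E) : Prop := rho b = salg_in cE mu b.

Fact invariant1 : invariant 1.
Proof. by rewrite /invariant !rmorph1. Qed.
Fact invariantB x y : invariant x -> invariant y -> invariant (x - y).
Proof. by rewrite /invariant !rmorphB => -> ->. Qed.
Fact invariantV x y : invariant x -> invariant y -> invariant (x / y).
Proof.
rewrite /invariant !rmorphM => -> yK; congr (_ * _).
have [->|y0] := eqVneq y 0; first by rewrite invr0 !rmorph0.
have e : salg_in cE mu y * salg_in cE mu y^-1 = 1 by rewrite -rmorphM mulfV // rmorph1.
rewrite -[LHS]mulr1 -e -yK mulrA -rmorphM mulVf // rmorph1 mul1r //.
Qed.
Definition invariant_field := SubfieldPred invariant1 invariantB invariantV.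

Local Notation K := invariant_field.

Lemma counit_coaction b : salg_counit cE (rho b) = b.
Proof.
by have := congr1 (fun y : ahom cE cE => y b) (gen_act1 (ahom_id cE)).
Qed.

Lemma invariant_pth_power b : K (b ^+ p).
Proof. by rewrite /= /invariant rmorphXn salg_pth_power counit_coaction. Qed.

Lemma invariant_str a : K (gf_str E a).
Proof.
by have := ahomP rho a; rewrite /= /invariant => ->; exact: esym (ahomP (salg_in cE mu) a).
Qed.

Definition coaction_mx : 'M[E]_m := \matrix_(i, l) sco (rho (Xg i)) l.
Local Notation N := coaction_mx.

Lemma coaction_mxE i l : N i l = sco (rho (Xg i)) l.
Proof. exact: mxE. Qed.

(** Specialising X_j to the counit of e_j turns this matrix of linear forms into the identity, so
    its determinant is a nonzero polynomial. *)
Lemma coaction_mx_unit : N \in unitmx.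
Proof.
pose N0 : 'M[{mpoly k[m]}]_m := \matrix_(i, l) \sum_j (c i j l)%:MP * 'X_j.
have -> : N = map_mx (gf_poly E) N0.
  apply/matrixP => i l; rewrite !mxE coactionX rmorph_sum.
  by apply: eq_bigr => j _; rewrite rmorphM gf_polyC.
rewrite unitmxE det_map_mx unitfE; apply/eqP => /gf_poly_inj N00.
have : \det (map_mx (meval (@counit k G C)) N0) = 0 by rewrite det_map_mx N00 rmorph0.
have -> : map_mx (meval (@counit k G C)) N0 = 1%:M.
  apply/matrixP => i l; rewrite !mxE -counitl raddf_sum /=.
  by apply: eq_bigr => j _; rewrite mevalM mevalC mevalXU.
by rewrite det1 => /eqP; rewrite oner_eq0.
Qed.

Lemma coaction_invl (f : 'I_m -> E) (i : 'I_m) :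
  \sum_l (\sum_j f j * N j l) * invmx N l i = f i.
Proof.
have /rowP/(_ i) := mulmxK coaction_mx_unit (\row_j f j).
rewrite [LHS]mxE [RHS]mxE => e; rewrite -[RHS]e; apply: eq_bigr => l _.
congr (_ * _); rewrite [RHS]mxE; apply: eq_bigr => j _; congr (_ * _).
by rewrite [RHS]mxE.
Qed.

Lemma coaction_invr i i' : \sum_l N i l * invmx N l i' = (i == i')%:R.
Proof. by have /matrixP/(_ i i') := mulmxV coaction_mx_unit; rewrite [LHS]mxE [RHS]mxE. Qed.

Lemma coaction_invr' i i' : \sum_l invmx N i l * N l i' = (i == i')%:R.
Proof. by have /matrixP/(_ i i') := mulVmx coaction_mx_unit; rewrite [LHS]mxE [RHS]mxE. Qed.

(* The coordinates kap of rho b in the basis rho (X_i) are invariant: in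
   (g y)(b) = \sum_i y (kap_i) * (g y)(X_i), replacing (y, g) by (h y, g h^-1) only
   changes the values y (kap_i) into (h y)(kap_i). *)
Lemma generic_span b : in_span (sf_inj K) (fun i => Xg i) b.
Proof.
pose kap i := \sum_l sco (rho b) l * invmx N l i.
have kapE l : sco (rho b) l = \sum_i kap i * N i l.
  have /rowP/(_ l) := mulmxKV coaction_mx_unit (\row_l sco (rho b) l).
  rewrite [LHS]mxE [RHS]mxE => e; rewrite -[LHS]e; apply: eq_bigr => i _.
  congr (_ * _); rewrite [LHS]mxE; apply: eq_bigr => j _; congr (_ * _).
  by rewrite [LHS]mxE.
have actE (R : calg k) (y : ahom cE R) (g : G R) :
    gen_act g y b = \sum_i y (kap i) * gen_act g y (Xg i).
  rewrite gen_actE; under eq_bigr => l _ do rewrite kapE rmorph_sum mulr_suml.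
  rewrite exchange_big; apply: eq_bigr => i _; rewrite gen_actE mulr_sumr.
  by apply: eq_bigr => l _; rewrite rmorphM mxE mulrA.
(* The universal case over E (x) k[G] (x) k[G]: y0 is the generic point, h and g are independent
   universal points of G. *)
pose S := salg TE mu; pose inS := salg_in TE mu.
pose y0 : ahom cE S := ahom_comp inS (salg_in cE mu).
pose h := kf_map G inS (upt C cE); pose g := upt C TE.
have y1E : gen_act h y0 = ahom_comp inS rho.
  rewrite /y0 /h -gen_act_map; congr ahom_comp; apply: ahom_ext => b'.
  by rewrite gen_actE [RHS]salg_decomp; apply: eq_bigr => l _; rewrite vec_upt.
have gE : gen_act (gmul g (ginv h)) (gen_act h y0) = gen_act g y0.
  by rewrite -gen_actM -gmulA gmulV commG gmul1.
have := actE _ (gen_act h y0) (gmul g (ginv h)); rewrite gE actE y1E => /eqP.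
rewrite -subr_eq0 -sumrB => /eqP diff.
have gX i : gen_act g y0 (Xg i) =
    \sum_l' inS (salg_in cE mu (N i l')) * salg_bas TE mu l'.
  rewrite gen_actE.
  apply: eq_bigr => l' _.
  rewrite /g.
  rewrite vec_upt.
  rewrite [N i l']mxE.
  by [].
(* These are the coefficients in the last factor k[G]; the inverse of N then isolates each kap_i -
   rho(kap_i). *)
have diffl l : \sum_i (salg_in cE mu (kap i) - rho (kap i)) * salg_in cE mu (N i l) = 0.
  rewrite -[RHS](sco0 TE mu l) -diff sco_sum; apply: eq_bigr => i _.
  rewrite gX -mulrBl.
  have -> : y0 (kap i) - ahom_comp inS rho (kap i) =
    inS (salg_in cE mu (kap i) - rho (kap i)) by rewrite rmorphB.
  rewrite sco_inM sco_sum (bigD1 l) //= big1 ?addr0 => [|l' ll].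
    by rewrite sco_in_funM sco_bas eqxx mulr1.
  by rewrite sco_in_funM sco_bas eq_sym (negPf ll) mulr0.
have kapK i : K (kap i).
  apply/eqP; rewrite eq_sym -subr_eq0; apply/eqP.
  transitivity (\sum_l (\sum_j (salg_in cE mu (kap j) - rho (kap j)) *
      salg_in cE mu (N j l)) * salg_in cE mu (invmx N l i)).
    under [RHS]eq_bigr => l _ do rewrite mulr_suml.
    rewrite exchange_big /=.
    under [RHS]eq_bigr => j _ do under eq_bigr => l _ do rewrite -mulrA -rmorphM.
    under [RHS]eq_bigr => j _ do rewrite -mulr_sumr -rmorph_sum coaction_invr.
    rewrite (bigD1 i) //= big1 ?addr0 => [|j /negPf ->]; first by rewrite eqxx rmorph1 mulr1.
    by rewrite rmorph0 mulr0.
  by rewrite big1 // => l _; rewrite diffl mul0r.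
have /choice[a aE] i : exists a, sf_inj K a = kap i by apply: sf_lift.
(* At the identity of G the expansion reads b = sum_i kap_i X_i. *)
exists a; under eq_bigr => i _ do rewrite aE.
by have := actE cE (ahom_id cE) (gone G cE); rewrite gen_act1.
Qed.

(** The coaction keeps the invariant coefficients of a relation, so they form a row vector killed by
    the invertible matrix N. *)
Lemma generic_free : free_fam (sf_inj K) (fun i => Xg i).
Proof.
move=> a a0 i; apply/eqP; rewrite -(fmorph_eq0 (sf_inj K)); apply/eqP.
rewrite -[LHS](coaction_invl (fun i => sf_inj K (a i))) big1 // => l _.
rewrite [X in X * _](_ : _ = 0) ?mul0r //.
have := congr1 (fun b => sco (rho b) l) a0; rewrite rmorph0 sco0 => e.
rewrite -[RHS]e rmorph_sum sco_sum; apply: eq_bigr => j _.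
have aK : K (sf_inj K (a j)) := sf_valP (a j).
by rewrite rmorphM aK sco_inM mxE.
Qed.

Definition inv_str : {rmorphism k -> sf_type K} :=
  projT1 (cid (sf_corestrict invariant_str)).
Lemma inv_strE a : sf_inj K (inv_str a) = gf_str E a.
Proof. by rewrite /inv_str; case: cid. Qed.
Local Notation cK := (CAlg inv_str).

Definition inv_inc : ahom cK cE := @AHom k cK cE (sf_inj K) inv_strE.

Fact gen_map_id (R : calg k) (x : ahom cE R) : ahom_comp (ahom_id R) x = x.
Proof. exact: ahom_ext. Qed.
Fact gen_map_comp (R S T : calg k) (g : ahom S T) (f : ahom R S) (x : ahom cE R) :
  ahom_comp (ahom_comp g f) x = ahom_comp g (ahom_comp f x).
Proof. exact: ahom_ext. Qed.
Definition gen_functor : kfunctor k :=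
  @KFunctor k (fun R => ahom cE R) (fun R S f x => ahom_comp f x)
    gen_map_id gen_map_comp.

Fact gen_pr_map (R S : calg k) (f : ahom R S) (x : gen_functor R) :
  ahom_comp (kf_map gen_functor f x : ahom cE S) inv_inc =
  ahom_comp f (ahom_comp (x : ahom cE R) inv_inc).
Proof. exact: ahom_ext. Qed.
Fact gen_pr_act (R : calg k) (g : G R) (x : gen_functor R) :
  ahom_comp (gen_act g x) inv_inc = ahom_comp (x : ahom cE R) inv_inc.
Proof.
apply: ahom_ext => b; have bK : K (sf_inj K b) := sf_valP b.
transitivity (clift C x g (rho (sf_inj K b))) => //.
by rewrite bK clift_in.
Qed.

Definition gen_space : gspace G cK :=
  @GSpace k G cK gen_functor (fun R x => ahom_comp (x : ahom cE R) inv_inc)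
    gen_act gen_pr_map gen_act_map gen_pr_act gen_act1 gen_actM.

Lemma coaction_mx_cancel (R : calg k) (y : ahom cE R) (v w : 'I_m -> R) :
  (forall i, \sum_l y (N i l) * v l = \sum_l y (N i l) * w l) -> v =1 w.
Proof.
move=> vw l.
have expand (t : 'I_m -> R) :
    t l = \sum_i y (invmx N l i) * \sum_l' y (N i l') * t l'.
  under eq_bigr => i _ do rewrite mulr_sumr.
  rewrite exchange_big (bigD1 l) //= [X in _ + X]big1 ?addr0 => [|l' ll].
    under eq_bigr => i _ do rewrite mulrA -rmorphM.
    by rewrite -mulr_suml -rmorph_sum coaction_invr' eqxx rmorph1 mul1r.
  under eq_bigr => i _ do rewrite mulrA -rmorphM.
  by rewrite -mulr_suml -rmorph_sum coaction_invr' eq_sym (negPf ll) rmorph0 mul0r.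
by rewrite [LHS]expand [RHS]expand; apply: eq_bigr => i _; rewrite vw.
Qed.

(** The coordinates w of g solve a linear system with matrix y(N). Let T be the y-linear map on E
    (x) k[G] with T(e_l) = w_l. It satisfies T(rho b) = y'(b), and the e_l are E-combinations of the
    rho (X_i), so T is multiplicative and w is a point of G. *)
Lemma gen_transitive (R : calg k) (y y' : ahom cE R) :
  ahom_comp y inv_inc = ahom_comp y' inv_inc -> exists! g : G R, gen_act g y = y'.
Proof.
move=> yK.
have {}yK a : y (sf_inj K a) = y' (sf_inj K a).
  by have := congr1 (fun f : ahom cK R => f a) yK.
pose w l := \sum_i y (invmx N l i) * y' (Xg i).
pose T (t : TE) := \sum_l y (sco t l) * w l.
have T_sum (I : finType) (e : I -> E) (t : I -> TE) :
    T (\sum_i salg_in cE mu (e i) * t i) = \sum_i y (e i) * T (t i).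
  under [RHS]eq_bigr => i _ do rewrite mulr_sumr.
  rewrite [RHS]exchange_big; apply: eq_bigr => l _.
  rewrite sco_sum rmorph_sum mulr_suml; apply: eq_bigr => i _.
  by rewrite sco_inM rmorphM mulrA.
have T_X i : T (rho (Xg i)) = y' (Xg i).
  rewrite /T; under eq_bigr => l _ do rewrite mulr_sumr.
  rewrite exchange_big (bigD1 i) //= [X in _ + X]big1 ?addr0 => [|j ji].
    under eq_bigr => l _ do rewrite mulrA -rmorphM -coaction_mxE.
    by rewrite -mulr_suml -rmorph_sum coaction_invr eqxx rmorph1 mul1r.
  under eq_bigr => l _ do rewrite mulrA -rmorphM -coaction_mxE.
  by rewrite -mulr_suml -rmorph_sum coaction_invr eq_sym (negPf ji) rmorph0 mul0r.
(* The agreement of y and y' on K enters through the expansion of b in the X_i over K. *)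
have T_rho b : T (rho b) = y' b.
  have [a ->] := generic_span b; rewrite !rmorph_sum.
  under eq_bigr => i _ do rewrite rmorphM (sf_valP (a i) : K (sf_inj K (a i))).
  rewrite T_sum; apply: eq_bigr => i _.
  by rewrite T_X rmorphM yK.
have T_bas l : T (salg_bas cE mu l) = w l.
  rewrite /T (bigD1 l) //= big1 ?addr0 => [|l' ll]; rewrite sco_bas.
    by rewrite eqxx rmorph1 mul1r.
  by rewrite (negPf ll) rmorph0 mul0r.
have basE l : salg_bas cE mu l = \sum_i salg_in cE mu (invmx N l i) * rho (Xg i).
  apply: sco_ext => l'; rewrite sco_bas sco_sum eq_sym -coaction_invr'.
  by apply: eq_bigr => i _; rewrite sco_inM [N i l']mxE.
have wP : sc_point mu w.
  split=> [a b|].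
    transitivity (T (salg_bas cE mu a * salg_bas cE mu b)).
      have -> : salg_bas cE mu a * salg_bas cE mu b = \sum_(q : 'I_m * 'I_m)
          salg_in cE mu (invmx N a q.1 * invmx N b q.2) * rho (Xg q.1 * Xg q.2).
        rewrite (basE a) (basE b) big_distrlr pair_big; apply: eq_bigr => q _.
        by rewrite !rmorphM mulrACA.
      rewrite T_sum big_distrlr pair_big; apply: eq_bigr => q _.
      by rewrite T_rho !rmorphM mulrACA.
    rewrite salg_basM T_sum; apply: eq_bigr => l _; rewrite T_bas; congr (_ * _).
    exact: (ahomP y).
  rewrite -(rmorph1 y') -T_rho rmorph1 -(salg_bas1 cE mu) T_sum.
  by apply: eq_bigr => l _; rewrite T_bas; congr (_ * _); exact: esym (ahomP y _).
exists (point_of wP); split.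
  apply: ahom_ext => b; rewrite gen_actE -T_rho.
  by apply: eq_bigr => l _; rewrite vec_point_of.
move=> g gy; apply: (@vec_inj _ _ C); apply: (coaction_mx_cancel (y := y)) => i.
transitivity (y' (Xg i)); last first.
  by rewrite -gy gen_actE; apply: eq_bigr => l _; rewrite [N i l]mxE.
by rewrite -T_X; apply: eq_bigr => l _; rewrite vec_point_of [N i l]mxE.
Qed.

Lemma gen_space_torsor : is_torsor gen_space.
Proof.
split.
- exists cE, (ahom_id cE) => R x; exists x; split.
    by apply: ahom_ext.
  by move=> h <-; apply: ahom_ext.
- by move=> R x y; apply: gen_transitive.
(* Spec E itself is the covering: it carries the tautological point. *)
exists cE, (ahom_id cE); split; first by apply/eqP; apply: oner_neq0.
exists [seq Xg i | i <- enum 'I_m] => P PK PX PD PM b.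
have [a ->] := generic_span b.
apply: (big_ind P) => //.
  by have := PK 0; rewrite rmorph0.
move=> i _; apply: PM; first exact: (PK (a i)).
by apply: PX; apply/mapP; exists i; rewrite ?mem_enum.
Qed.

End GenericTorsor.

(** * Descent of the generic torsor and the final comparison *)

Section SpannedSubfield.
Variables (E : fieldType) (K : subfield_pred E) (p : nat).
Hypotheses (p_gt0 : (0 < p)%N) (EpK : forall x, K (x ^+ p)).
Variables (A : comPzRingType) (f : {rmorphism A -> E}).

(** The K-span of the image of A. It is a field because y^-1 = y^(p-1) / y^p and y^p lies in K. *)
Definition spanned (x : E) : Prop :=
  exists (I : finType) (a : I -> A), in_span (sf_inj K) (f \o a) x.

Lemma spannedM x y : spanned x -> spanned y -> spanned (x * y).
Proof.
case=> I [a xa] [J [b yb]].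
exists (I * J)%type, (fun q => a q.1 * b q.2); apply: (in_span_mul _ xa yb) => i j.
rewrite /= -rmorphM.
exact: (in_span_gen _ (f \o (fun q : I * J => a q.1 * b q.2)) (i, j)).
Qed.

Lemma spannedD x y : spanned x -> spanned y -> spanned (x + y).
Proof.
case=> I [a xa] [J [b yb]].
pose ab (q : I + J) := match q with inl i => a i | inr j => b j end.
exists (I + J)%type, ab; apply: in_spanD.
  apply: in_span_trans xa => i; exact: (in_span_gen _ (f \o ab) (inl i)).
apply: in_span_trans yb => j; exact: (in_span_gen _ (f \o ab) (inr j)).
Qed.

Lemma spanned_in a : spanned (f a).
Proof. exists unit, (fun=> a); exact: (in_span_gen _ (f \o fun _ : unit => a) tt). Qed.

Lemma spannedK x : K x -> spanned x.
Proof.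
move=> /sf_lift[y <-]; exists unit, (fun=> 1); rewrite -[sf_inj _ _]mulr1.
apply: in_spanZ; rewrite -(rmorph1 f).
exact: (in_span_gen _ (f \o fun _ : unit => 1) tt).
Qed.

Lemma spannedX x n : spanned x -> spanned (x ^+ n).
Proof.
move=> xs; elim: n => [|n IHn]; last by rewrite exprS; exact: spannedM.
by apply: spannedK; apply: sfp1.
Qed.

Fact spanned1 : spanned 1. Proof. by apply: spannedK; apply: sfp1. Qed.
Fact spannedB x y : spanned x -> spanned y -> spanned (x - y).
Proof.
move=> xs ys; rewrite -mulN1r; apply: spannedD => //; apply: spannedM => //.
by apply: spannedK; apply: sfpN; apply: sfp1.
Qed.
Fact spannedV x y : spanned x -> spanned y -> spanned (x / y).
Proof.
move=> xs ys; apply: spannedM => //.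
have -> : y^-1 = y ^+ p.-1 * (y ^+ p)^-1.
  have [->|y0] := eqVneq y 0; first by rewrite [0 ^+ p]expr0n gtn_eqF // invr0 mulr0.
  apply: (mulIf (expf_neq0 p y0)); rewrite divfK ?expf_neq0 //.
  by rewrite -{1}(prednK p_gt0) exprS mulKf.
apply: spannedM; first exact: spannedX.
by apply: spannedK; apply: sfp_inv; apply: EpK.
Qed.
Definition spanned_field := SubfieldPred spanned1 spannedB spannedV.
End SpannedSubfield.

Section Descent.
Variables (k : fieldType) (G : gfunctor k) (C : coords G).
Hypothesis commG : commutative_gf G.
Variables (p : nat) (chp : p \in [pchar k]).
Hypothesis heightG : height_one chp G.
Local Notation m := (cdim C).
Variable E : generic_field k m.
Local Notation cE := (CAlg (gf_str E)).
Local Notation K := (@invariant_field k G C commG p chp heightG E).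
Local Notation cK := (CAlg (@inv_str k G C commG p chp heightG E)).
Local Notation inc := (@inv_inc k G C commG p chp heightG E).

Lemma generic_descent_bound (L : fieldType) (iL : {rmorphism k -> L})
    (jj : ahom (CAlg iL) cK) (Y : gspace G (CAlg iL)) (r : nat) :
  is_torsor Y -> gspace_iso (base_change jj Y) (gen_space commG heightG E) ->
  is_trdeg iL r -> (m <= p ^ r)%N.
Proof.
move=> Yt [f [f_bij f_map f_pr _]] trL.
have p_gt0 : (0 < p)%N := prime_gt0 (pcharf_prime chp).
have [A [u uP]] : exists A, represents A Y by case: Yt.
have [Q fQ] : exists Q : base_change jj Y cE, f cE Q = ahom_id cE.
  by case: (f_bij cE) => g fK gK; exists (g (ahom_id cE)); rewrite gK.
have [al [alP _]] := uP _ (bc_fst Q).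
have sQ : bc_snd Q = inc.
  by have := f_pr _ Q; rewrite fQ => /= <-; apply: ahom_ext.
have alpi l : al (gs_pr Y u l) = sf_inj K (jj l).
  have := bc_eq Q; rewrite -alP gs_pr_map sQ.
  by move=> /(congr1 (fun h : ahom (CAlg iL) cE => h l)).
have A1 : (1 : A) <> 0.
  by move=> /(congr1 al); rewrite rmorph1 rmorph0 => /eqP; rewrite oner_eq0.
have EpK := @invariant_pth_power k G C commG p chp heightG E.
pose alr : {rmorphism A -> E} := al.
pose S := spanned_field p_gt0 EpK alr.
(* The point Q, which corresponds to the identity of E, consists of maps from A and K with values in
   the subfield S, so it comes from a point over S. By naturality the identity of E factors through
   S. *)
have Sall b : S b.
  have [sS sSE] := @sf_corestrict k E S (gf_str E)
    (fun a => spannedK alr (invariant_str commG heightG E a)).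
  have [al' al'E] := @sf_corestrict A E S alr (spanned_in K alr).
  have [inc' inc'E] := @sf_corestrict (sf_type K) E S (sf_inj K)
    (fun x => spannedK alr (sf_valP x)).
  have al'_str a : al' (calg_str A a) = sS a.
    by apply: (fmorph_inj (sf_inj S)); rewrite al'E sSE; exact: (ahomP al).
  have inc'_str a : inc' (calg_str cK a) = sS a.
    by apply: (fmorph_inj (sf_inj S)); rewrite inc'E sSE; exact: inv_strE.
  pose cS : calg k := CAlg sS.
  pose alS : ahom A cS := @AHom k A cS al' al'_str.
  pose incS : ahom cK cS := @AHom k cK cS inc' inc'_str.
  pose jS : ahom cS cE := @AHom k cS cE (sf_inj S) sSE.
  have Q'eq : gs_pr Y (kf_map Y alS u) = ahom_comp incS jj.
    rewrite gs_pr_map; apply: ahom_ext => l; apply: (fmorph_inj (sf_inj S)).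
    transitivity (al (gs_pr Y u l)); first exact: al'E.
    by rewrite alpi; exact: esym (inc'E _).
  pose Q' : base_change jj Y cS := BCPoint Q'eq.
  have QE : kf_map (base_change jj Y) jS Q' = Q.
    apply: bc_ext => /=.
      by rewrite -kf_map_comp -alP; congr kf_map; apply: ahom_ext => a; apply: al'E.
    by rewrite sQ; apply: ahom_ext => x; apply: inc'E.
  have := f_map _ _ jS Q'; rewrite QE fQ => /(congr1 (fun h : ahom cE cE => h b)).
  move=> bE; rewrite [b]bE; exact: (sf_valP (f cS Q' b)).
(* Each X_i lies in the span of finitely many elements of A. A basis extracted from all of these has
   at least m members, since the X_i are free over K. *)
have /choice[d dP] : forall i : 'I_m, exists d : {I : finType & I -> A},
    in_span (sf_inj K) (alr \o projT2 d) (gf_poly E 'X_i).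
  by move=> i; have [I [a ia]] := Sall (gf_poly E 'X_i); exists (existT _ I a).
pose z (q : {i : 'I_m & projT1 (d i)}) := alr (projT2 (d (tag q)) (tagged q)).
have zX i : in_span (sf_inj K) z (gf_poly E 'X_i).
  apply: in_span_trans (dP i) => q.
  exact: (in_span_gen _ z (Tagged (fun i => projT1 (d i)) q)).
have [D [s [zs_free zs_span]]] := span_basis (sf_inj K) z.
apply: (@leq_trans D).
  have := @free_span_card _ _ (sf_inj K) _ _ _ (z \o s) (@generic_free k G C commG p chp heightG E).
  by rewrite !card_ord; apply => i; apply/zs_span.
pose j : {rmorphism L -> E} := sf_inj K \o jj.
apply: (@frobenius_count k p chp E (gf_str E) (gf_frob_free chp) K
  (invariant_str commG heightG E) EpK L iL j _ r D (z \o s) trL zs_free).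
  move=> a; have jja := ahomP jj a.
  by rewrite [LHS]/= [jj _]jja; exact: inv_strE.
move=> n; have [l lE] := torsor_frob heightG Yt A1 uP (projT2 (d (tag (s n))) (tagged (s n))).
exists l; rewrite [LHS]/= /z -rmorphXn -lE; exact: alpi.
Qed.

End Descent.

Lemma enat_min_witness (P : nat -> Prop) n :
  enat_le (enat_min P) (Some n) -> exists2 j, P j & (j <= n)%N.
Proof.
rewrite /enat_min; case: pselect => // exP; case: ex_minnP => j /asboolP Pj _ jn.
by exists j.
Qed.

Theorem proposition2p3 (k : fieldType) (p : nat) (chp : p \in [pchar k]%R)
    (G : gfunctor k)
    (finG : finite_gf G) (commG : commutative_gf G) (unipG : unipotent G)
    (heightG : height_one chp G)
    (ntG : nontrivial_gf G) :
  enat_le (V_order chp G) (ed G).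
Proof.
have [C _] := finite_coords finG; have [E _] := generic_field_exists k (cdim C).
have [n [n_gt0 Vn pn]] := V_order_bound C chp commG unipG ntG.
case edE : (ed G) => [d|]; last by case: (V_order chp G).
have : enat_le (ed G) (Some d) by rewrite edE /=.
case/enat_min_witness => e eP ed_d.
(* The generic torsor takes part in the supremum, so its essential dimension is at most d. *)
have /eP : exists (K : fieldType) (iK : {rmorphism k -> K}) (X : gspace G (CAlg iK)),
    is_torsor X /\ ed_torsor (gen_space commG heightG E) = ed_torsor X.
  exists (sf_type (invariant_field commG heightG E)), (inv_str commG heightG E).
  by exists (gen_space commG heightG E); split=> //; apply: gen_space_torsor.
case/enat_min_witness => r [L [iL [jj [trL [Y [Yt Yiso]]]]]] re.
have := generic_descent_bound Yt Yiso trL; move/(leq_trans pn).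
rewrite ltn_exp2l ?prime_gt1 ?(pcharf_prime chp) // => nr.
case: (V_order chp G) Vn => //= v vn.
by rewrite (leq_trans vn) // (leq_trans _ ed_d) // (leq_trans _ re) // -(prednK n_gt0).
Qed.
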